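(* Let $d\geq 2$ and let $k\ge 1$ be an integer. (i) For every set $D\subset\mathbb{R}^+$ of $k$ distances, $m_{\mathbb{R}^d}(D)\geq m_{\mathbb{R}^d}(\{1\})^k$. (ii) $\sup_{|D|=k}\chi^m_{\mathbb{R}^d}(D)\geq 1/m_{\mathbb{R}^d}(\{1\})^k$, where the supremum is over all sets $D\subset\mathbb{R}^+$ with exactly $k$ elements.
   Context: $\mathbb{R}^+$ is the set of positive reals. For $D\subset\mathbb{R}^+$, a set $A\subset\mathbb{R}^d$ is $D$-avoiding if no two points of $A$ are at Euclidean distance belonging to $D$. $Q(x,r)$ is the open axis-parallel cube of side length $r$ centered at $x$. For a measurable set $A\subset\mathbb{R}^d$, $\bar d(A)=\limsup_{R\to\infty}|A\cap Q(0,R)|/|Q(0,R)|$, where $|\cdot|$ is Lebesgue measure. $m_{\mathbb{R}^d}(D)=\sup \bar d(A)$, the supremum over all Lebesgue measurable $D$-avoiding sets $A\subset\mathbb{R}^d$. $\chi^m_{\mathbb{R}^d}(D)$ is the least number of colors needed to color $\mathbb{R}^d$ so that each color class is a Lebesgue measurable $D$-avoiding set. *)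

(* Defs.v *)
From mathcomp Require Import all_boot all_order all_algebra.
From mathcomp Require Import all_classical all_reals all_analysis.

Set Implicit Arguments.
Unset Strict Implicit.
Unset Printing Implicit Defensive.
Import Order.TTheory GRing.Theory Num.Theory.
Import numFieldNormedType.Exports.

Local Open Scope classical_set_scope.
Local Open Scope ring_scope.

(* 'rV[R]_d carries the sup norm in the library, hence an explicit Euclidean
   distance. *)
Definition edist (R : realType) (d : nat) (x y : 'rV[R]_d) : R :=
  Num.sqrt (\sum_(i < d) (x ord0 i - y ord0 i) ^+ 2).

Definition box (R : realType) (d : nat) (a b : 'rV[R]_d) : set 'rV[R]_d :=
  [set x | forall i : 'I_d, a ord0 i < x ord0 i <= b ord0 i].

(* Sequences ab of boxes ](ab k).1, (ab k).2] covering A; the endpoints are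
   ordered so that the product of the side lengths is the volume. *)
Definition box_covers (R : realType) (d : nat) (A : set 'rV[R]_d) :
    set (nat -> 'rV[R]_d * 'rV[R]_d) :=
  [set ab : nat -> 'rV[R]_d * 'rV[R]_d |
            (forall k (i : 'I_d), (ab k).1 ord0 i <= (ab k).2 ord0 i) /\
            A `<=` \bigcup_k box (ab k).1 (ab k).2].

(* d-dimensional Lebesgue outer measure, for d > 0. *)
Definition lebesgue_outer (R : realType) (d : nat) (A : set 'rV[R]_d) :
    \bar R :=
  ereal_inf
    [set (\sum_(k <oo)
            (\prod_(i < d) ((ab k).2 ord0 i - (ab k).1 ord0 i))%:E)%E
    | ab in box_covers A].

(* Lebesgue measurability is Caratheodory measurability; on such sets
   lebesgue_outer is the (complete) Lebesgue measure. *)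
Definition lebesgue_measurable (R : realType) (d : nat) (A : set 'rV[R]_d) :
    Prop :=
  (@lebesgue_outer R d).-caratheodory A.

Definition cube (R : realType) (d : nat) (x : 'rV[R]_d) (r : R) :
    set 'rV[R]_d :=
  [set y | forall i : 'I_d, `|y ord0 i - x ord0 i| < r / 2].

Definition upper_density (R : realType) (d : nat) (A : set 'rV[R]_d) :
    \bar R :=
  limf_esup
    (fun r : R => (lebesgue_outer (A `&` cube (0 : 'rV[R]_d) r) /
                   lebesgue_outer (cube (0 : 'rV[R]_d) r))%E)
    (pinfty_nbhs R).

Definition avoiding (R : realType) (d : nat) (D : set R) (A : set 'rV[R]_d) :
    Prop :=
  forall x y, A x -> A y -> ~ D (edist x y).

Definition max_density (R : realType) (d : nat) (D : set R) : \bar R :=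
  ereal_sup [set upper_density A
            | A in [set A : set 'rV[R]_d |
                     lebesgue_measurable A /\ avoiding D A]].

Definition measurably_colorable (R : realType) (d : nat) (D : set R)
    (n : nat) : Prop :=
  exists c : 'rV[R]_d -> 'I_n,
    forall j : 'I_n, lebesgue_measurable (c @^-1` [set j]) /\
                     avoiding D (c @^-1` [set j]).

(* The infimum is the least element when some finite number of colors suffices,
   and +oo otherwise. *)
Definition measurable_chromatic (R : realType) (d : nat) (D : set R) : \bar R :=
  ereal_inf [set (n%:R : R)%:E | n in measurably_colorable d D].

Definition distance_sets (R : realType) (k : nat) : set (set R) :=
  [set D | D `<=` [set t | 0 < t] /\ (D #= `I_k)%card].

(* Main.v *)
(** A finite model of a D-avoiding set is a subset S of a finite abelian group G together with
    a homomorphism p : Z^d -> G such that z and z + p w are never both in S when h |w| is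
    within C h of D.  Finite models and measurable sets have the same maximal density: a
    model is turned into a measurable set by periodizing it over the cells of side h, and a
    measurable set is approximated from inside by a compact set, whose distances keep away
    from D, so that the cells meeting it, wrapped around a torus, form a model for all small h.
    A product of models for D1 and D2 is a model for their union, and a model for {1} rescales
    to one for {t}; this gives m(D) >= m({1})^k.

    The upper bound rests on m(D + {t}) <= m(D) m({1}) + eps for all large t.  In a model S for
    D + {t}, let g be the average of the indicator of S over boxes of side eta and f its average
    over much larger boxes, still small with respect to t.  By pigeonhole on the energies of
    the averages, the two scales can be chosen so that g and f are close in L^2.  Then S is not
    sparse at scale eta around most points of F = {f > eps}.  If two such points were at
    distance about t, so would be two points of S: averaging over suitable vectors of length
    about t is nearly zero on functions whose averages over small boxes nearly vanish.  Hence F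
    is essentially a model for {t}, its density is at most m({1}) + eps, and f <= m(D) + eps.

    The last averages run over pieces of M arcs of the sphere in a coordinate plane, with
    different slopes.  Expanding the square, the pairs from one arc contribute 1/M; for two
    arcs, the difference of their points drifts along a coordinate axis at a nearly constant
    nonzero speed, so that the correlation is averaged over long segments, and smearing by small
    boxes makes it an average of correlations over boxes, which is small.  This replaces the
    decay of the Fourier transform of the sphere.

    Iterating gives D with k elements and m(D) <= m({1})^k + eps.  In a colouring with n colours
    some class has upper density at least 1/n, hence n m(D) >= 1. *)
Require Import Defs.
From HB Require Import structures.
From mathcomp Require Import all_boot all_order all_algebra.
From mathcomp Require Import zify ring lra.
From mathcomp Require Import boolp reals.
Set Implicit Arguments.
Unset Strict Implicit.
Unset Printing Implicit Defensive.
Import Order.TTheory GRing.Theory Num.Theory.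
Local Open Scope ring_scope.

HB.saturate finfun_of.
HB.saturate prod.

(** * Averages over boxes *)

Definition avg (R : realFieldType) (T : finType) (f : T -> R) : R :=
  (\sum_x f x) / #|T|%:R.

Section Average.
Variable R : realFieldType.
Implicit Types T U : finType.

Lemma eq_avg T (f g : T -> R) : f =1 g -> avg f = avg g.
Proof. by move=> fg; rewrite /avg (eq_bigr g). Qed.

Lemma avgD T (f g : T -> R) : avg (fun x => f x + g x) = avg f + avg g.
Proof. by rewrite /avg big_split mulrDl. Qed.

Lemma avgN T (f : T -> R) : avg (fun x => - f x) = - avg f.
Proof. by rewrite /avg sumrN mulNr. Qed.

Lemma avgB T (f g : T -> R) : avg (fun x => f x - g x) = avg f - avg g.
Proof. by rewrite avgD avgN. Qed.

Lemma avg_sum T n (f : T -> 'I_n -> R) :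
  avg (fun x => \sum_m f x m) = \sum_m avg (f ^~ m).
Proof. by rewrite /avg exchange_big mulr_suml. Qed.

Lemma avgZ T c (f : T -> R) : avg (fun x => c * f x) = c * avg f.
Proof. by rewrite /avg -mulr_sumr mulrA. Qed.

Lemma avgZr T c (f : T -> R) : avg (fun x => f x * c) = avg f * c.
Proof. by rewrite /avg -mulr_suml mulrAC. Qed.

Lemma avg_cst T c : (0 < #|T|)%N -> avg (fun _ : T => c) = c :> R.
Proof.
move=> T0; rewrite /avg sumr_const -[c *+ _]mulr_natr mulfK //.
by rewrite pnatr_eq0 -lt0n.
Qed.

Lemma ler_avg T (f g : T -> R) : (forall x, f x <= g x) -> avg f <= avg g.
Proof. by move=> fg; rewrite ler_wpM2r ?invr_ge0 ?ler0n // ler_sum. Qed.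

Lemma avg_ge0 T (f : T -> R) : (forall x, 0 <= f x) -> 0 <= avg f.
Proof. by move=> f0; rewrite divr_ge0 ?ler0n // sumr_ge0. Qed.

Lemma avg_le T (f : T -> R) c : (0 < #|T|)%N ->
  (forall x, f x <= c) -> avg f <= c.
Proof. by move=> T0 fc; rewrite -(avg_cst c T0) ler_avg. Qed.

Lemma avg_ge T (f : T -> R) c : (0 < #|T|)%N ->
  (forall x, c <= f x) -> c <= avg f.
Proof. by move=> T0 fc; rewrite -(avg_cst c T0) ler_avg. Qed.

Lemma ler_norm_avg T (f : T -> R) : `|avg f| <= avg (fun x => `|f x|).
Proof.
rewrite /avg normrM normfV normr_nat ler_wpM2r ?invr_ge0 ?ler0n //.
exact: ler_norm_sum.
Qed.

Lemma avg_norm_le T (f : T -> R) c : (0 < #|T|)%N ->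
  (forall x, `|f x| <= c) -> `|avg f| <= c.
Proof. by move=> T0 fc; apply: le_trans (ler_norm_avg f) (avg_le T0 fc). Qed.

Lemma avg_exchange T U (f : T -> U -> R) :
  avg (fun x => avg (f x)) = avg (fun y => avg (f ^~ y)).
Proof.
by rewrite /avg -!mulr_suml exchange_big /= -!mulrA [_^-1 * _]mulrC.
Qed.

Lemma avg_pair T U (f : T * U -> R) :
  avg f = avg (fun x => avg (fun y => f (x, y))).
Proof.
rewrite /avg -mulr_suml pair_big /= card_prod natrM invfM -mulrA; congr (_ * _).
  by apply: eq_bigr => -[].
by rewrite mulrC.
Qed.

Lemma avg_bij T U (h : T -> U) (f : U -> R) :
  bijective h -> avg f = avg (f \o h).
Proof.
move=> bh; rewrite /avg (bij_eq_card bh); congr (_ / _).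
by apply: reindex; apply: onW_bij.
Qed.

Lemma sqr_avg_le T (f : T -> R) : avg f ^+ 2 <= avg (fun x => f x ^+ 2).
Proof.
have [T0|T0] := posnP #|T|.
  by rewrite /avg T0 invr0 !mulr0 expr0n.
have : 0 <= avg (fun x => (f x - avg f) ^+ 2) by apply: avg_ge0 => x; apply: sqr_ge0.
rewrite (@eq_avg _ _ (fun x => f x ^+ 2 - (2 * avg f) * f x + avg f ^+ 2)); last first.
  by move=> x /=; ring.
by rewrite avgD avgB avgZ avg_cst //; nra.
Qed.

Lemma avg_ind T (A : {set T}) : avg (fun x => (x \in A)%:R) = #|A|%:R / #|T|%:R :> R.
Proof.
rewrite /avg -natr_sum -sum1_card [in RHS]big_mkcond /=; by [].
Qed.

(** Split the first [m + n] terms once at [m] and once at [n]. *)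
Lemma sum_ord_shift (m n : nat) (F : nat -> R) :
  \sum_(c < n) F (m + c)%N - \sum_(c < n) F c =
  \sum_(c < m) (F (n + c)%N - F c).
Proof.
rewrite sumrB.
have E : \sum_(c < m + n) F c = \sum_(c < m) F c + \sum_(c < n) F (m + c)%N.
  by rewrite big_split_ord.
move: E; have : \sum_(c < m + n) F c = \sum_(c < n) F c + \sum_(c < m) F (n + c)%N.
  by rewrite addnC big_split_ord.
by move=> -> H; lra.
Qed.

Lemma avg_ord_shift (m n : nat) (F : nat -> R) : (0 < n)%N ->
  (forall c, `|F c| <= 1) ->
  `|avg (fun c : 'I_n => F (m + c)%N) - avg (fun c : 'I_n => F c)| <= 2 * m%:R / n%:R.
Proof.
move=> n0 F1; rewrite /avg card_ord -mulrBl sum_ord_shift normrM normfV normr_nat.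
rewrite ler_wpM2r ?invr_ge0 ?ler0n //; apply: le_trans (ler_norm_sum _ _ _) _.
rewrite mulr_natr -[X in _ *+ X](card_ord m) -sumr_const; apply: ler_sum => c _.
by apply: le_trans (ler_normB _ _) _; rewrite -[2]/(1 + 1) lerD.
Qed.

End Average.

Section Boxes.
Variables (R : realFieldType) (d : nat).

Definition ibox n := {ffun 'I_d -> 'I_n}.

Definition ivec n (x : ibox n) : {ffun 'I_d -> int} := [ffun k => (x k : nat)%:Z].

Definition setc (V : Type) (k : 'I_d) (c : V) (x : {ffun 'I_d -> V}) :
  {ffun 'I_d -> V} := [ffun l => if l == k then c else x l].

Definition ev (k : 'I_d) (c : int) : {ffun 'I_d -> int} :=
  [ffun l => if l == k then c else 0].

Lemma card_ibox n : #|ibox n| = (n ^ d)%N.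
Proof. by rewrite card_ffun !card_ord. Qed.

Lemma card_ibox_gt0 n : (0 < n)%N -> (0 < #|ibox n|)%N.
Proof. by move=> n0; rewrite card_ibox expn_gt0 n0. Qed.

(** Redrawing one coordinate independently preserves the uniform distribution. This isolates a
    coordinate, so that one-dimensional estimates apply to boxes. *)
Lemma avg_resample n (k : 'I_d) (F : ibox n -> R) : (0 < n)%N ->
  avg F = avg (fun x => avg (fun c : 'I_n => F (setc k c x))).
Proof.
move=> n0; rewrite -(avg_pair (fun p : ibox n * 'I_n => F (setc k p.2 p.1))).
(* Swapping coordinate [k] with the fresh value is an involution, hence a bijection. *)
pose h (p : ibox n * 'I_n) : ibox n * 'I_n := (setc k p.2 p.1, p.1 k).
have hK : involutive h.
  move=> [x c]; rewrite /h /=; congr (_, _); last by rewrite ffunE eqxx.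
  by apply/ffunP => l; rewrite !ffunE; case: eqP => // ->.
transitivity (avg (fun p : ibox n * 'I_n => F p.1)).
  by rewrite avg_pair /=; apply: eq_avg => x; rewrite avg_cst // card_ord.
by rewrite (avg_bij _ (Bijective hK hK)).
Qed.

Lemma sum_ev (w : {ffun 'I_d -> int}) : w = \sum_k ev k (w k).
Proof.
apply/ffunP => l; rewrite sum_ffunE (bigD1 l) //= ffunE eqxx big1 ?addr0 // => k kl.
by rewrite ffunE eq_sym (negbTE kl).
Qed.

Lemma ivec_setc n (k : 'I_d) (c : 'I_n) (x : ibox n) :
  ivec (setc k c x) = setc k (0 : int) (ivec x) + ev k (c : nat).
Proof.
apply/ffunP => l; rewrite !ffunE; case: ifP => _; rewrite ?add0r ?addr0 //.
Qed.

End Boxes.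

Section BoxAverage.
Variables (R : realFieldType) (d : nat) (G : finZmodType).
Implicit Types (p : {additive {ffun 'I_d -> int} -> G}) (f : G -> R).

Definition bavg p n f (z : G) : R := avg (fun x : ibox d n => f (z + p (ivec x))).

Lemma avg_shift f (a : G) : avg (fun z => f (z + a)) = avg f.
Proof.
rewrite [RHS](@avg_bij _ _ _ (fun z => z + a)) //.
by exists (fun z => z - a) => z; rewrite ?addrK ?subrK.
Qed.

Lemma cardG_gt0 : (0 < #|G|)%N.
Proof. by apply/card_gt0P; exists 0. Qed.

Lemma avg_bavg p n f : (0 < n)%N -> avg (bavg p n f) = avg f.
Proof.
move=> n0; rewrite /bavg avg_exchange -[RHS](@avg_cst _ (ibox d n)) ?card_ibox_gt0 //.
by apply: eq_avg => x; rewrite avg_shift.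
Qed.

Lemma bavgC p q m n f z : bavg p m (bavg q n f) z = bavg q n (bavg p m f) z.
Proof.
rewrite /bavg avg_exchange; apply: eq_avg => x; apply: eq_avg => y.
by rewrite addrAC.
Qed.

Lemma bavg_norm_le p n f c z : (0 < n)%N -> (forall z, `|f z| <= c) ->
  `|bavg p n f z| <= c.
Proof. by move=> n0 fc; apply: avg_norm_le => //; apply: card_ibox_gt0. Qed.

Lemma bavg_le p n f c z : (0 < n)%N -> (forall z, f z <= c) -> bavg p n f z <= c.
Proof. by move=> n0 fc; apply: avg_le => //; apply: card_ibox_gt0. Qed.

Lemma bavg_ge p n f c z : (0 < n)%N -> (forall z, c <= f z) -> c <= bavg p n f z.
Proof. by move=> n0 fc; apply: avg_ge => //; apply: card_ibox_gt0. Qed.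

Lemma bavg_sqr_le p n f : (0 < n)%N ->
  avg (fun z => bavg p n f z ^+ 2) <= avg (fun z => f z ^+ 2).
Proof.
move=> n0; rewrite -[leRHS](avg_bavg p _ n0); apply: ler_avg => z; exact: sqr_avg_le.
Qed.

Lemma bavg_shift_ev p n f (k : 'I_d) (m : nat) z : (0 < n)%N ->
  (forall z, `|f z| <= 1) ->
  `|bavg p n f (z + p (ev k m)) - bavg p n f z| <= 2 * m%:R / n%:R.
Proof.
move=> n0 f1; rewrite /bavg [X in `|X - _|](avg_resample k _ n0).
rewrite [X in `|_ - X|](avg_resample k _ n0) -avgB.
apply: avg_norm_le; first exact: card_ibox_gt0.
move=> x; set F := fun c : nat => f (z + p (setc k 0 (ivec x)) + p (ev k c)).
have F1 c : `|F c| <= 1 by apply: f1.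
apply: le_trans (avg_ord_shift m n0 F1); rewrite le_eqVlt; apply/orP; left.
apply/eqP; congr (`| _ - _ |); apply: eq_avg => c; rewrite /F ivec_setc.
  rewrite -!addrA -!raddfD; do 2 congr (_ _); congr (p _).
  by apply/ffunP => l; rewrite !ffunE; case: ifP => _; rewrite ?PoszD; ring.
by rewrite raddfD addrA.
Qed.

(** Move along one coordinate at a time; by [bavg_shift_ev] each move replaces only a small fraction
    of the box. *)
Lemma bavg_shift p n f (w : {ffun 'I_d -> int}) (m : nat) z : (0 < n)%N ->
  (forall z, `|f z| <= 1) -> (forall k, 0 <= w k <= m%:Z) ->
  `|bavg p n f (z + p w) - bavg p n f z| <= d%:R * (2 * m%:R / n%:R).
Proof.
move=> n0 f1 wm; rewrite [w]sum_ev.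
have H (s : seq 'I_d) z' : `|bavg p n f (z' + p (\sum_(k <- s) ev k (w k))) - bavg p n f z'|
    <= \sum_(k <- s) (2 * m%:R / n%:R).
  elim: s z' => [|k s IH] z'; first by rewrite !big_nil raddf0 addr0 subrr normr0.
  rewrite !big_cons raddfD addrA.
  set z2 := z' + p (ev k (w k)).
  apply: le_trans (ler_distD (bavg p n f z2) _ _) _; rewrite [leRHS]addrC lerD //.
  have /andP[w0 w1] := wm k; rewrite /z2; case: (w k) w0 w1 => // j _ jm.
  apply: le_trans (bavg_shift_ev _ _ _ _ n0 f1) _.
  by rewrite ler_wpM2r ?invr_ge0 // ler_wpM2l // ler_nat; lia.
apply: le_trans (H _ _) _.
by rewrite sumr_const card_ord -[_ *+ d]mulr_natl.
Qed.

Lemma ivec_bound n (x : ibox d n) k : 0 <= ivec x k <= n%:Z.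
Proof. by rewrite ffunE /= lez_nat ltnW. Qed.

(** An average at scale [n] is almost invariant under shifts of size [m], so for [m] small against
    [n] averaging again hardly changes it. *)
Lemma bavg_bavg p m n f z : (0 < m)%N -> (0 < n)%N -> (forall z, `|f z| <= 1) ->
  `|bavg p m (bavg p n f) z - bavg p n f z| <= d%:R * (2 * m%:R / n%:R).
Proof.
move=> m0 n0 f1; rewrite {1}/bavg -[X in `|_ - X|](@avg_cst _ (ibox d m) (bavg p n f z)) ?card_ibox_gt0 //.
rewrite -avgB; apply: avg_norm_le; first exact: card_ibox_gt0.
by move=> x; apply: bavg_shift => // k; apply: ivec_bound.
Qed.

End BoxAverage.

(** * Correlations along a walk of nearly constant speed *)

Section SlowWalk.
Variables (R : realFieldType) (G : nat -> R) (kappa : R).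
Hypothesis G1 : forall m, `|G m| <= 1.
Hypothesis Glip : forall m, `|G m.+1 - G m| <= kappa.

Lemma lipschitz_iter m j : `|G (m + j)%N - G m| <= kappa * j%:R.
Proof.
elim: j => [|j IH]; first by rewrite addn0 subrr normr0 mulr0.
apply: le_trans (ler_distD (G (m + j)%N) _ _) _.
rewrite addnS -natr1 mulrDr mulr1 addrC; apply: lerD => //; exact: Glip.
Qed.

Let P n := \sum_(j < n) G j.

Let kappa0 : 0 <= kappa.
Proof. by apply: le_trans (Glip 0); rewrite normr_ge0. Qed.

Let PD m j : P (m + j)%N = P m + \sum_(i < j) G (m + i)%N.
Proof. by rewrite /P big_split_ord. Qed.

Lemma primitive_lipschitz m n : `|P n - P m| <= `|n%:R - m%:R|.
Proof.
wlog mn : m n / (m <= n)%N.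
  move=> H; case/orP: (leq_total m n) => mn; first exact: H.
  by rewrite distrC [leRHS]distrC; apply: H.
rewrite -(subnKC mn) PD natrD ![_ + _ - _]addrAC !subrr !add0r normr_nat.
apply: le_trans (ler_norm_sum _ _ _) _.
rewrite -[X in X%:R](card_ord (n - m)) -sumr_const.
by apply: ler_sum => i _; apply: G1.
Qed.

(** First-order Taylor expansion of the primitive [P]: within [c] steps [G] varies by at most
    [kappa * c]. *)
Lemma primitive_step (m n c : nat) : (n <= m + c)%N -> (m <= n + c)%N ->
  `|P n - P m - (n%:R - m%:R) * G m| <= kappa * c%:R ^+ 2.
Proof.
move=> nm mn.
have aux (j : nat) (f : 'I_j -> R) : (j <= c)%N ->
    (forall i, `|f i| <= kappa * c%:R) -> `|\sum_(i < j) f i| <= kappa * c%:R ^+ 2.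
  move=> jc fle; apply: le_trans (ler_norm_sum _ _ _) _.
  apply: le_trans (ler_sum _ (fun i _ => fle i)) _.
  rewrite sumr_const card_ord -[_ *+ j]mulr_natr expr2 mulrA.
  by rewrite ler_wpM2l ?ler_nat // mulr_ge0.
case/orP: (leq_total m n) => le.
  have jc : (n - m <= c)%N by lia.
  have -> : P n - P m - (n%:R - m%:R) * G m =
      \sum_(i < n - m) G (m + i)%N - (n - m)%:R * G m.
    by rewrite -{1}(subnKC le) PD natrB //; ring.
  rewrite [_%:R * _]mulr_natl -[X in _ *+ X](card_ord (n - m)) -sumr_const -sumrB.
  apply: aux => // i; apply: le_trans (lipschitz_iter _ _) _.
  by rewrite ler_wpM2l // ler_nat; have := ltn_ord i; lia.
have jc : (m - n <= c)%N by lia.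
have -> : P n - P m - (n%:R - m%:R) * G m = \sum_(i < m - n) (G m - G (n + i)%N).
  rewrite sumrB sumr_const card_ord -[_ *+ (m - n)]mulr_natr natrB //.
  by rewrite -{1}(subnKC le) PD; ring.
apply: aux => // i; have im := ltn_ord i.
have E : (n + i + (m - (n + i)) = m)%N by lia.
rewrite -{1}E; apply: le_trans (lipschitz_iter _ _) _.
by rewrite ler_wpM2l // ler_nat; lia.
Qed.

(* Along n the potential [P (n a) - e a * G (n a)], where e is the rounding error of n,
   increases by about [lambda * G (n a)] at each step. *)
Lemma slow_walk (n : nat -> nat) (Phi : nat -> R) (b beta lambda : R) (c A : nat) :
  (forall a, (a <= A)%N -> `|(n a)%:R - (Phi a - b)| <= 1) ->
  (forall a, (a < A)%N -> `|Phi a.+1 - Phi a - lambda| <= beta) ->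
  0 < lambda -> lambda + beta + 2 <= c%:R ->
  `|lambda * \sum_(a < A.+1) G (n a) - (P (n A) - P (n 0%N))| <=
    A%:R * (beta + kappa * (c%:R ^+ 2 + c%:R)) + 2 + lambda.
Proof.
move=> n_Phi Phi_step l0 lc.
pose e a := (n a)%:R - (Phi a - b).
pose Q a := P (n a) - e a * G (n a).
have step a : (a < A)%N ->
    `|lambda * G (n a) - (Q a.+1 - Q a)| <= beta + kappa * (c%:R ^+ 2 + c%:R).
  move=> aA.
  have e0 : `|e a| <= 1 by apply: n_Phi; lia.
  have e1 : `|e a.+1| <= 1 by apply: n_Phi; lia.
  have D := Phi_step a aA.
  have nn : `|(n a.+1)%:R - (n a)%:R| <= c%:R :> R.
    move: e0 e1 D; rewrite /e !ler_norml; lra.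
  have n1 : (n a.+1 <= n a + c)%N.
    by rewrite -(ler_nat R) natrD; move: nn; rewrite ler_norml; lra.
  have n2 : (n a <= n a.+1 + c)%N.
    by rewrite -(ler_nat R) natrD; move: nn; rewrite ler_norml; lra.
  have S := primitive_step n1 n2.
  have L : `|G (n a.+1) - G (n a)| <= kappa * c%:R.
    case/orP: (leq_total (n a) (n a.+1)) => le; last rewrite distrC.
      rewrite -(subnKC le); apply: le_trans (lipschitz_iter _ _) _.
      by rewrite ler_wpM2l // ler_nat; lia.
    rewrite -(subnKC le); apply: le_trans (lipschitz_iter _ _) _.
    by rewrite ler_wpM2l // ler_nat; lia.
  (* The three terms are the Taylor error, the deviation of the speed from [lambda], and the
     rounding error times a variation of [G]. *)
  rewrite (_ : _ - _ = - (P (n a.+1) - P (n a) - ((n a.+1)%:R - (n a)%:R) * G (n a))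
    + (lambda - (Phi a.+1 - Phi a)) * G (n a) + e a.+1 * (G (n a.+1) - G (n a))); last first.
    by rewrite /Q /e; ring.
  apply: le_trans (ler_normD _ _) _.
  apply: le_trans (lerD (ler_normD _ _) (lexx _)) _.
  rewrite normrN !normrM.
  have := ler_pM (normr_ge0 _) (normr_ge0 _) e1 L.
  have D' : `|lambda - (Phi a.+1 - Phi a)| <= beta by rewrite distrC.
  have := ler_pM (normr_ge0 _) (normr_ge0 _) D' (G1 (n a)).
  lra.
have tele : Q A - Q 0%N = \sum_(a < A) (Q a.+1 - Q a).
  by rewrite -(big_mkord xpredT (fun a => Q a.+1 - Q a)) telescope_sumr.
have main : `|lambda * \sum_(a < A) G (n a) - (Q A - Q 0%N)| <=
    A%:R * (beta + kappa * (c%:R ^+ 2 + c%:R)).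
  rewrite tele mulr_sumr -sumrB; apply: le_trans (ler_norm_sum _ _ _) _.
  rewrite mulr_natl -[X in _ *+ X](card_ord A) -sumr_const.
  by apply: ler_sum => a _; apply: step.
have e0 : `|e 0%N| <= 1 by apply: n_Phi.
have eA : `|e A| <= 1 by apply: n_Phi.
rewrite big_ord_recr /=.
rewrite (_ : _ - _ = (lambda * \sum_(a < A) G (n a) - (Q A - Q 0%N)) +
   (e 0%N * G (n 0%N) - e A * G (n A)) + lambda * G (n A)); last by rewrite /Q; ring.
apply: le_trans (ler_normD _ _) _.
apply: le_trans (lerD (ler_normD _ _) (lexx _)) _.
rewrite -[A%:R * _ + 2 + _]addrA -addrA; apply: lerD => //.
apply: lerD; last by rewrite normrM gtr0_norm // ler_piMr // ltW.
apply: le_trans (ler_normB _ _) _; rewrite !normrM.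
have := ler_pM (normr_ge0 _) (normr_ge0 _) e0 (G1 (n 0%N)).
have := ler_pM (normr_ge0 _) (normr_ge0 _) eA (G1 (n A)).
lra.
Qed.

(** The endpoints of the walk in [slow_walk] are replaced by [0] and [r]. The start is off by the
    initial offset, the speed errors add up to at most [A * beta] at the end, and [P] is
    1-Lipschitz. *)
Lemma slow_walk_sum (n : nat -> nat) (Phi : nat -> R) (b beta lambda E : R) (c A r : nat) :
  (forall a, (a <= A)%N -> `|(n a)%:R - (Phi a - b)| <= 1) ->
  (forall a, (a < A)%N -> `|Phi a.+1 - Phi a - lambda| <= beta) ->
  0 < lambda -> lambda + beta + 2 <= c%:R -> 0 <= Phi 0%N - b <= E ->
  `|r%:R - lambda * A%:R| <= 1 ->
  `|lambda * \sum_(a < A.+1) G (n a) - \sum_(j < r) G j| <=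
    A%:R * (2 * beta + kappa * (c%:R ^+ 2 + c%:R)) + 2 * E + 5 + lambda.
Proof.
move=> n_Phi Phi_step l0 lc b0 rA.
have main := slow_walk n_Phi Phi_step l0 lc.
have PhiA k : (k <= A)%N -> `|Phi k - Phi 0%N - k%:R * lambda| <= k%:R * beta.
  elim: k => [_|k IH kA]; first by rewrite !mul0r subrr subr0 normr0.
  rewrite (_ : _ - _ = (Phi k - Phi 0%N - k%:R * lambda) + (Phi k.+1 - Phi k - lambda)).
    apply: le_trans (ler_normD _ _) _; rewrite -[k.+1%:R]natr1 mulrDl mul1r.
    by apply: lerD; [apply: IH; lia | apply: Phi_step].
  by rewrite -[k.+1%:R]natr1; ring.
have P0 : `|P (n 0%N) - P 0%N| <= 1 + E.
  apply: le_trans (primitive_lipschitz _ _) _; rewrite subr0 normr_nat.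
  by have := n_Phi 0%N isT; rewrite ler_norml; lra.
have PA : `|P (n A) - P r| <= 2 + E + A%:R * beta.
  apply: le_trans (primitive_lipschitz _ _) _.
  have := n_Phi A (leqnn _); have := PhiA A (leqnn _).
  move: rA b0; rewrite !ler_norml; lra.
move: P0 PA main; rewrite {2}/P big_ord0 /P => P0 PA main.
have -> : lambda * \sum_(a < A.+1) G (n a) - \sum_(j < r) G j =
  (lambda * \sum_(a < A.+1) G (n a) - (\sum_(j < n A) G j - \sum_(j < n 0%N) G j)) +
  (\sum_(j < n A) G j - \sum_(j < r) G j) - (\sum_(j < n 0%N) G j - 0) by ring.
apply: le_trans (ler_normB _ _) _.
apply: le_trans (lerD (ler_normD _ _) (lexx _)) _.
lra.
Qed.

End SlowWalk.

Section Correlation.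
Variables (R : archiRealFieldType) (d : nat) (T : finZmodType).
Variables (p : {additive {ffun 'I_d -> int} -> T}) (h : T -> R).
Hypothesis h1 : forall z, `|h z| <= 1.

Definition corr (w : {ffun 'I_d -> int}) : R := avg (fun z => h z * h (z + p w)).

Lemma corr_le1 w : `|corr w| <= 1.
Proof.
apply: avg_norm_le => [|z]; first exact: cardG_gt0.
by rewrite normrM mulr_ile1.
Qed.

(** After exchanging the averages, the inner one is a box average of [h] at [z + p W]; the other
    factor is bounded by 1. *)
Lemma avg_corr_cube (omega : nat) W : 
  `|avg (fun x : ibox d omega => corr (W + ivec x))| <= avg (fun z => `|bavg p omega h z|).
Proof.
rewrite /corr avg_exchange -[leRHS](avg_shift _ (p W)).
apply: le_trans (ler_norm_avg _) (ler_avg _) => z.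
rewrite avgZ normrM /bavg.
rewrite (@eq_avg _ _ _ (fun x : ibox d omega => h (z + p W + p (ivec x)))); last first.
  by move=> x; rewrite raddfD addrA.
by rewrite ler_piMl.
Qed.

Variables (e : 'I_d) (W : {ffun 'I_d -> int}) (omega : nat).
Hypothesis omega0 : (0 < omega)%N.

(** The coordinate [e] of the box variable [q] is erased. Shifting the line by [c < omega] costs at
    most [2 * omega], and averaging over [c] restores that coordinate, so that averages over full
    boxes appear. *)
Lemma avg_line_sum (r : nat) (b : int) (kappa : R) (Cj : nat) : (0 < Cj)%N ->
  avg (fun z => `|bavg p omega h z|) <= kappa ->
  `|avg (fun q : ibox d omega => \sum_(m < r) avg (fun j : 'I_Cj =>
     corr (W + setc e (0 : int) (ivec q) + ev e (b + m%:Z + j%:Z))))| <= r%:R * kappa + 2 * omega%:R.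
Proof.
move=> Cj0 hk; set G := fun (q : ibox d omega) (m : nat) => avg (fun j : 'I_Cj =>
     corr (W + setc e (0 : int) (ivec q) + ev e (b + m%:Z + j%:Z))).
have G1 q m : `|G q m| <= 1.
  by apply: avg_norm_le => [|i]; [rewrite card_ord | exact: corr_le1].
have shift (c : 'I_omega) : `|avg (fun q => \sum_(m < r) G q m) -
    avg (fun q => \sum_(m < r) G q (c + m)%N)| <= 2 * omega%:R.
  rewrite -avgB; apply: avg_norm_le => [|q]; first exact: card_ibox_gt0.
  rewrite distrC sum_ord_shift; apply: le_trans (ler_norm_sum _ _ _) _.
  apply: (@le_trans _ _ (\sum_(i < c) 2)).
    by apply: ler_sum => i _; apply: le_trans (ler_normB _ _) _; rewrite -[2]/(1 + 1) lerD.
  by rewrite sumr_const card_ord -[_ *+ c]mulr_natr ler_wpM2l // ler_nat ltnW.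
have E : `|avg (fun c : 'I_omega => avg (fun q => \sum_(m < r) G q (c + m)%N))| <= r%:R * kappa.
  have -> : avg (fun c : 'I_omega => avg (fun q => \sum_(m < r) G q (c + m)%N)) =
      \sum_(m < r) avg (fun j : 'I_Cj => avg (fun x : ibox d omega =>
        corr (W + ev e (b + m%:Z + j%:Z) + ivec x))).
    transitivity (\sum_(m < r) avg (fun c : 'I_omega => avg (fun q => G q (c + m)%N))).
      rewrite -avg_sum; apply: eq_avg => c; exact: avg_sum.
    apply: eq_bigr => m _; rewrite avg_exchange.
    transitivity (avg (fun q : ibox d omega => avg (fun j : 'I_Cj => avg (fun c : 'I_omega =>
        corr (W + ev e (b + m%:Z + j%:Z) + ivec (setc e c q)))))).
      apply: eq_avg => q; rewrite avg_exchange; apply: eq_avg => i; apply: eq_avg => c.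
      congr corr; rewrite ivec_setc -!addrA; congr (_ + _).
      rewrite [RHS]addrC -addrA; congr (_ + _).
      by apply/ffunP => l; rewrite !ffunE; case: ifP => _; rewrite ?PoszD; ring.
    rewrite avg_exchange; apply: eq_avg => i.
    by rewrite [RHS](avg_resample e _ omega0).
  apply: le_trans (ler_norm_sum _ _ _) _.
  rewrite mulr_natl -[X in _ *+ X](card_ord r) -sumr_const; apply: ler_sum => m _.
  apply: avg_norm_le => [|i]; first by rewrite card_ord.
  exact: le_trans (avg_corr_cube _ _) hk.
rewrite -(subrK (avg (fun c : 'I_omega => avg (fun q => \sum_(m < r) G q (c + m)%N)))
  (avg _)) addrC.
apply: le_trans (ler_normD _ _) _; apply: lerD => //.
rewrite -[X in `|X - _|](@avg_cst _ 'I_omega) ?card_ord // -avgB.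
by apply: avg_norm_le => //; rewrite card_ord.
Qed.

(** For fixed [q], averaging over the jitter [j] makes the correlation [2 / Cj]-Lipschitz along [e].
    By [slow_walk_sum], [lambda] times its sum along the walk is close to its sum over [r]
    consecutive points, which [avg_line_sum] bounds. *)
Lemma pair_smoothing (A Cj c r : nat) (phi : ibox d omega -> nat -> int)
    (Phi : ibox d omega -> nat -> R) (Phi0 beta lambda E kappa : R) : (0 < Cj)%N ->
  avg (fun z => `|bavg p omega h z|) <= kappa ->
  (forall q a, (a <= A)%N -> `|(phi q a)%:~R - Phi q a| <= 1) ->
  (forall q a, (a < A)%N -> `|Phi q a.+1 - Phi q a - lambda| <= beta) ->
  (forall q, `|Phi q 0%N - Phi0| <= E) ->
  0 < lambda -> beta <= lambda -> lambda + beta + 2 <= c%:R ->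
  `|r%:R - lambda * A%:R| <= 1 ->
  lambda * A.+1%:R * `|avg (fun q => avg (fun a : 'I_A.+1 => avg (fun j : 'I_Cj =>
     corr (W + setc e (0 : int) (ivec q) + ev e (phi q a + j%:Z)))))| <=
  r%:R * kappa + 2 * omega%:R +
  A%:R * (2 * beta + 2 / Cj%:R * (c%:R ^+ 2 + c%:R)) + 4 * E + 9 + lambda.
Proof.
move=> Cj0 hk phi_Phi Phi_step Phi_0 l0 bl lc rA.
(* The base [b] lies below the whole walk, which makes [phi q a - b] a natural number. *)
pose b := Num.floor (Phi0 - E - 1); pose bR : R := b%:~R.
have /andP[b1 b2] : bR <= Phi0 - E - 1 < bR + 1.
  by have := floor_itv (Phi0 - E - 1); rewrite intrD.
pose n q a := `|phi q a - b|%N.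
pose G (q : ibox d omega) (m : nat) := avg (fun j : 'I_Cj =>
     corr (W + setc e (0 : int) (ivec q) + ev e (b + m%:Z + j%:Z))).
have Phi_ge q a : (a <= A)%N -> Phi q 0%N <= Phi q a.
  elim: a => // a IH aA; have := IH (ltnW aA); have := Phi_step q a aA.
  by rewrite ler_norml; lra.
have nE q a : (a <= A)%N -> (n q a)%:Z = phi q a - b.
  move=> aA; rewrite /n gez0_abs // subr_ge0 -(ler_int R).
  move: (phi_Phi q a aA) (Phi_ge q a aA) (Phi_0 q); rewrite !ler_norml -/bR; lra.
have G1 q m : `|G q m| <= 1.
  by apply: avg_norm_le => [|i]; [rewrite card_ord | exact: corr_le1].
have Glip q m : `|G q m.+1 - G q m| <= 2 / Cj%:R.
  rewrite /G -[2 in leRHS]mulr1.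
  pose F i := corr (W + setc e (0 : int) (ivec q) + ev e (b + m%:Z + i%:Z)).
  have := @avg_ord_shift _ 1 Cj F Cj0 (fun=> corr_le1 _).
  congr (`|_ - _| <= _); apply: eq_avg => i; rewrite /F; congr (corr (_ + ev e _)).
  by rewrite -addn1 !PoszD; ring.
have key q : `|lambda * \sum_(a < A.+1) G q (n q a) - \sum_(j < r) G q j| <=
    A%:R * (2 * beta + 2 / Cj%:R * (c%:R ^+ 2 + c%:R)) + 2 * (2 * E + 2) + 5 + lambda.
  apply: (slow_walk_sum (G1 q) (Glip q) (Phi := Phi q) (b := bR)) => //.
  - move=> a aA; have := phi_Phi q a aA.
    have -> : (n q a)%:R = (phi q a)%:~R - bR :> R.
      by rewrite -[_%:R]/((n q a)%:Z%:~R) nE // rmorphB.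
    by congr (`|_| <= _); ring.
  - by move=> a aA; exact: Phi_step.
  - by move: (Phi_0 q); rewrite ler_norml; lra.
have EG : lambda * A.+1%:R * `|avg (fun q => avg (fun a : 'I_A.+1 => avg (fun j : 'I_Cj =>
     corr (W + setc e (0 : int) (ivec q) + ev e (phi q a + j%:Z)))))| =
  `|avg (fun q => lambda * \sum_(a < A.+1) G q (n q a))|.
  rewrite -[X in X * `|_|]gtr0_norm ?mulr_gt0 // -normrM -avgZ; congr `|_|.
  apply: eq_avg => q; rewrite /avg !card_ord -!mulrA; congr (_ * _).
  rewrite [RHS](_ : _ = A.+1%:R * ((\sum_(a < A.+1) G q (n q a)) / A.+1%:R)); last first.
    by rewrite [RHS]mulrC divfK // pnatr_eq0.
  congr (_ * (_ / _)); apply: eq_bigr => a _; rewrite /G /avg card_ord; congr (_ / _).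
  apply: eq_bigr => j _; congr (corr (_ + ev e (_ + _))).
  rewrite nE; first by ring.
  by rewrite -ltnS.
rewrite EG.
have L := avg_line_sum r b Cj0 hk.
rewrite -(subrK (avg (fun q => \sum_(m < r) G q m)) (avg (fun q => lambda * _))) -avgB.
apply: le_trans (ler_normD _ _) _.
have : `|avg (fun q => lambda * \sum_(a < A.+1) G q (n q a) - \sum_(m < r) G q m)| <=
   A%:R * (2 * beta + 2 / Cj%:R * (c%:R ^+ 2 + c%:R)) + 2 * (2 * E + 2) + 5 + lambda.
  by apply: avg_norm_le => //; apply: card_ibox_gt0.
move: L; rewrite -/G; lra.
Qed.

End Correlation.

(** * Vectors of prescribed length *)

Section Cap.
Variables (R : realType) (d : nat) (N : R) (e : 'I_d).
Hypothesis N0 : 0 < N.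

(** The height in direction [e] of the sphere of radius [N] above the other coordinates of [x]. The
    square root makes it 0 when these lie outside the ball. *)
Definition cap (x : {ffun 'I_d -> int}) : R :=
  Num.sqrt (N ^+ 2 - \sum_(k | k != e) (x k)%:~R ^+ 2).

Let D : R := d%:R.
Let D1 : 1 <= D.
Proof. by rewrite -[1]/(1%:R) ler_nat; case: d e => // -[]. Qed.

(** The first condition keeps away from the equator, where the slope of the sphere blows up. *)
Definition good_cap (x : {ffun 'I_d -> int}) :=
  N <= 4 * D * cap x /\ forall k, `|(x k)%:~R| <= 2 * N.

Lemma good_cap_gt0 x : good_cap x -> 0 < cap x.
Proof.
case=> h _; have D0 : 0 < 4 * D by have := D1; lra.
by rewrite -(pmulr_rgt0 _ D0); apply: lt_le_trans h.
Qed.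

Lemma sqr_cap x : good_cap x ->
  cap x ^+ 2 = N ^+ 2 - \sum_(k | k != e) (x k)%:~R ^+ 2.
Proof. by move/good_cap_gt0; rewrite sqrtr_gt0 => h; rewrite sqr_sqrtr // ltW. Qed.

Lemma cap_le x : cap x <= N.
Proof.
rewrite -[leRHS]gtr0_norm // -sqrtr_sqr.
rewrite ler_wsqrtr // gerBl sumr_ge0 // => k _; exact: sqr_ge0.
Qed.

(** Factor the difference of squares; the sum of the two heights is at least [N / (2 D)]. *)
Lemma cap_lipschitz x x' (delta : R) : good_cap x -> good_cap x' ->
  (forall k, `|(x k)%:~R - (x' k)%:~R| <= delta) ->
  `|cap x - cap x'| <= 8 * D ^+ 2 * delta.
Proof.
move=> gx gx' xx'; have [h1 h2] := gx; have [h3 h4] := gx'.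
have c0 := good_cap_gt0 gx; have c0' := good_cap_gt0 gx'.
have E : (cap x - cap x') * (cap x + cap x') =
    \sum_(k | k != e) ((x' k)%:~R - (x k)%:~R) * ((x' k)%:~R + (x k)%:~R).
  rewrite -subr_sqr !sqr_cap //.
  rewrite [RHS](eq_bigr (fun k => (x' k)%:~R ^+ 2 - (x k)%:~R ^+ 2)); last first.
    by move=> k _ /=; ring.
  by rewrite sumrB; ring.
have d0 : 0 <= delta by apply: le_trans (xx' e).
have S : `|cap x - cap x'| * (cap x + cap x') <= D * (delta * (4 * N)).
  rewrite -[cap x + cap x']gtr0_norm ?addr_gt0 // -normrM E.
  apply: le_trans (ler_norm_sum _ _ _) _.
  have -> : D * (delta * (4 * N)) = \sum_(k < d) (delta * (4 * N)).
    by rewrite sumr_const card_ord -[RHS]mulr_natl.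
  rewrite big_mkcond /=.
  apply: ler_sum => k _; case: ifP => _; last by rewrite !mulr_ge0 // ltW.
  rewrite normrM; apply: ler_pM => //; first by rewrite distrC.
  by apply: le_trans (ler_normD _ _) _; have := h2 k; have := h4 k; lra.
have D0 : 0 < D by have := D1; lra.
have : `|cap x - cap x'| * (2 * N) <= 4 * D * (D * (delta * (4 * N))).
  apply: le_trans (_ : _ <= `|cap x - cap x'| * (4 * D * (cap x + cap x'))) _.
    by rewrite ler_wpM2l //; lra.
  rewrite [leLHS](_ : _ = 4 * D * (`|cap x - cap x'| * (cap x + cap x'))); last by ring.
  by apply: ler_wpM2l => //; rewrite mulr_ge0 // ltW.
move=> h; have N2 : 0 < 2 * N by move: N0; lra.
rewrite -(ler_pM2r N2).
by apply: le_trans h _; rewrite le_eqVlt; apply/orP; left; apply/eqP; ring.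
Qed.

Lemma cap_ev (f : 'I_d) (z : int) x : f != e -> good_cap x -> good_cap (x + ev f z) ->
  cap (x + ev f z) ^+ 2 = cap x ^+ 2 - (2 * (x f)%:~R + z%:~R) * z%:~R.
Proof.
move=> fe g g'; rewrite !sqr_cap // (bigD1 f) //= [in RHS](bigD1 f) //= !ffunE eqxx intrD.
rewrite (eq_bigr (fun k => (x k)%:~R ^+ 2)); last first.
  by move=> k /andP[_ kf]; rewrite !ffunE (negbTE kf) addr0.
ring.
Qed.

(** A discrete derivative of the square root: the slope in direction [f] is minus the coordinate
    over the height. The factor [N] on the left records that the error is of order
    [(delta + 1) / N]. *)
Lemma cap_slope (f : 'I_d) x xi (delta : R) : f != e ->
  good_cap x -> good_cap (x + ev f 1) -> good_cap xi ->
  (forall k, `|(x k)%:~R - (xi k)%:~R| <= delta) ->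
  (forall k, `|((x + ev f 1) k)%:~R - (xi k)%:~R| <= delta) ->
  N * `|cap (x + ev f 1) - cap x + (xi f)%:~R / cap xi| <=
    16 * D ^+ 2 * (2 + 16 * D ^+ 2) * (delta + 1).
Proof.
move=> fe gx gx' gxi xd xd'.
have L := cap_lipschitz gx gxi xd; have L' := cap_lipschitz gx' gxi xd'.
have sq := cap_ev fe gx gx'.
have [c1 _] := gx; have [c2 _] := gx'; have [c3 b3] := gxi.
have p1 := good_cap_gt0 gx; have p2 := good_cap_gt0 gx'; have p3 := good_cap_gt0 gxi.
have d0 : 0 <= delta by apply: le_trans (xd e).
have D0 : 0 < D by have := D1; lra.
have n3 := cap_le xi.
move: sq L L' c1 c2 p1 p2 n3 c3 p3 (xd f) (b3 f).
set y := cap x; set y' := cap (x + _); set s := cap xi; set u := (x f)%:~R; set v := (xi f)%:~R.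
move=> sq L L' c1 c2 p1 p2 n3 c3 p3 uv v2.
have E : (y' - y + v / s) * ((y + y') * s) = (2 * (v - u) - 1) * s + v * ((y - s) + (y' - s)).
  have -> : (y' - y + v / s) * ((y + y') * s) = (y' ^+ 2 - y ^+ 2) * s + v * (y + y') * (s / s).
    ring.
  rewrite divff ?gt_eqF // sq; ring.
have B : `|y' - y + v / s| * ((y + y') * s) <= N * ((2 * delta + 1) + 2 * (16 * D ^+ 2 * delta)).
  rewrite -[(y + y') * s]gtr0_norm ?mulr_gt0 ?addr_gt0 // -normrM E.
  apply: le_trans (ler_normD _ _) _; rewrite [leRHS]mulrDr; apply: lerD.
    rewrite normrM mulrC; apply: ler_pM => //; first by rewrite gtr0_norm.
    by move: uv; rewrite !ler_norml; lra.
  rewrite normrM [leRHS](_ : _ = (2 * N) * (16 * D ^+ 2 * delta)); last by ring.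
  apply: ler_pM => //; apply: le_trans (ler_normD _ _) _.
  by move: L L'; lra.
have den : 2 * N ^+ 2 <= 16 * D ^+ 2 * ((y + y') * s).
  have -> : 16 * D ^+ 2 * ((y + y') * s) = (4 * D * y + 4 * D * y') * (4 * D * s) by ring.
  rewrite (_ : 2 * N ^+ 2 = (N + N) * N); last by ring.
  by apply: ler_pM; lra.
have : `|y' - y + v / s| * (2 * N ^+ 2) <=
    16 * D ^+ 2 * (N * ((2 * delta + 1) + 2 * (16 * D ^+ 2 * delta))).
  apply: le_trans (ler_wpM2l (normr_ge0 _) den) _.
  by rewrite mulrCA ler_wpM2l // mulr_ge0 // sqr_ge0.
move=> h; have N2 : 0 < 2 * N by move: N0; lra.
rewrite -(ler_pM2r N2).
rewrite (_ : N * _ * (2 * N) = `|y' - y + v / s| * (2 * N ^+ 2)); last by ring.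
apply: le_trans h _.
rewrite (_ : 16 * D ^+ 2 * (N * _) = 16 * D ^+ 2 * (2 * delta + 1 + 2 * (16 * D ^+ 2 * delta)) * N);
  last by ring.
rewrite (_ : _ * (2 * N) = 16 * D ^+ 2 * (2 * ((2 + 16 * D ^+ 2) * (delta + 1))) * N); last by ring.
apply: ler_wpM2r; first exact: ltW.
apply: ler_wpM2l; first by rewrite mulr_ge0 ?sqr_ge0.
have := mulr_ge0 (sqr_ge0 D) d0; have := sqr_ge0 D; lra.
Qed.

(* The slope [t / sqrt (m - t^2)] has derivative at least [1 / sqrt m]; the
   inequality between difference quotients is obtained by clearing denominators. *)
Lemma cap_slope_increasing (f : 'I_d) xi (z : nat) : f != e ->
  good_cap xi -> good_cap (xi + ev f z) ->
  z%:R <= N * (((xi + ev f z) f)%:~R / cap (xi + ev f z) - (xi f)%:~R / cap xi).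
Proof.
move=> fe g g'; have sq := cap_ev fe g g'.
have p1 := good_cap_gt0 g; have p2 := good_cap_gt0 g'.
have n1 := cap_le xi; have n2 := cap_le (xi + ev f z).
rewrite !ffunE eqxx intrD; move: sq p1 p2 n1 n2.
set y := cap xi; set y' := cap _; set u : R := (xi f)%:~R.
rewrite -[z%:~R]/(z%:R); set w : R := z%:R => sq p1 p2 n1 n2.
have w0 : 0 <= w by rewrite /w.
have E : ((u + w) / y' - u / y) * (y * y' * (2 * (y + y'))) =
   w * (y + y') ^+ 2 + w * (2 * u + w) ^+ 2.
  have -> : ((u + w) / y' - u / y) * (y * y' * (2 * (y + y'))) =
      ((u + w) * y * (y' / y') - u * y' * (y / y)) * (2 * (y + y')) by ring.
  rewrite !divff ?gt_eqF // !mulr1.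
  have -> : ((u + w) * y - u * y') * (2 * (y + y')) =
    w * (y + y') ^+ 2 + (2 * u + w) * (y ^+ 2 - y' ^+ 2) by ring.
  by rewrite sq; ring.
have pos : 0 < y * y' * (2 * (y + y')) by rewrite !mulr_gt0 // addr_gt0.
rewrite -(ler_pM2r pos) -[leRHS]mulrA E.
have q1 : y * y' * (2 * (y + y')) <= N * (y + y') ^+ 2.
  have -> : N * (y + y') ^+ 2 = N * (y + y') * (y + y') by ring.
  rewrite mulrA; apply: ler_wpM2r; first by rewrite ltW // addr_gt0.
  have := ler_wpM2r (ltW p2) n1; have := ler_wpM2r (ltW p1) n2; lra.
apply: le_trans (ler_wpM2l w0 q1) _; rewrite mulrCA; apply: ler_wpM2l; first exact: ltW.
by rewrite lerDl mulr_ge0 // sqr_ge0.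
Qed.

Lemma slope_bound (f : 'I_d) xi : good_cap xi -> `|(xi f)%:~R / cap xi| <= 8 * D.
Proof.
move=> g; have p := good_cap_gt0 g; have [c b] := g.
rewrite normrM normfV [`|cap _|]gtr0_norm // ler_pdivrMr //.
by have := b f; lra.
Qed.

End Cap.

Lemma ler_mul_of_slope (R : realFieldType) (x y zeta N lambda Z : R) :
  0 < N -> zeta <= N * lambda -> 0 <= y -> x * Z * N <= zeta * y -> x * Z <= lambda * y.
Proof.
move=> N0 zN y0 h; rewrite -(ler_pM2r N0); apply: le_trans h _.
by rewrite mulrAC [lambda * N]mulrC ler_wpM2r.
Qed.

(** Divide by [lambda * A]. Of the five units of [1 / Z], one pays for [omega] and [E], two for
    [beta] and the jitter, one for the constants including the rounding of [r], and one for the last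
    [lambda]. *)
Lemma pair_numeric (R : realFieldType) (X kappa r omega A A' beta E Cj c lambda zeta N Z : R) :
  0 < N -> 0 < lambda -> 0 < Z -> 0 < Cj -> 0 <= A' -> A = A' + 1 -> 0 <= kappa <= 1 ->
  0 <= beta -> 0 <= c ->
  zeta <= N * lambda ->
  lambda * A * X <= r * kappa + 2 * omega + A' * (2 * beta + 2 / Cj * (c ^+ 2 + c)) +
    4 * E + 9 + lambda ->
  `|r - lambda * A'| <= 1 ->
  (2 * omega + 4 * E) * Z * N <= zeta * A ->
  2 * beta * Z * N <= zeta ->
  2 * (c ^+ 2 + c) * Z * N <= zeta * Cj ->
  10 * Z * N <= zeta * A -> Z <= A -> X <= kappa + 5 / Z.
Proof.
move=> N0 l0 Z0 C0 A0 AE /andP[k0 k1] b0 c0 zl main rA h1 h2 h3 h4 h5.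
have A1 : 0 < A by lra.
have g1 := ler_mul_of_slope N0 zl (ltW A1) h1.
have g2 : 2 * beta * Z <= lambda * 1 by apply: ler_mul_of_slope zl _ _ => //; rewrite mulr1.
have g3 := ler_mul_of_slope N0 zl (ltW C0) h3.
have g4 := ler_mul_of_slope N0 zl (ltW A1) h4.
have rk : r * kappa <= lambda * A * kappa + 1.
  have : r <= lambda * A + 1 by rewrite AE; move: rA; rewrite ler_norml; lra.
  move/(ler_wpM2r k0); lra.
have g3' : 2 / Cj * (c ^+ 2 + c) * Z <= lambda.
  rewrite (_ : _ * Z = 2 * (c ^+ 2 + c) * Z / Cj); last by ring.
  by rewrite ler_pdivrMr.
have L0 : 0 < lambda * A by rewrite mulr_gt0.
have g5 : A' * (2 * beta + 2 / Cj * (c ^+ 2 + c)) * Z <= 2 * (lambda * A).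
  have s : (2 * beta + 2 / Cj * (c ^+ 2 + c)) * Z <= 2 * lambda by lra.
  have := ler_wpM2l A0 s; rewrite AE; lra.
have g6 : lambda * Z <= lambda * A by rewrite ler_wpM2l // ltW.
have fin : lambda * A * X * Z <= lambda * A * kappa * Z + 5 * (lambda * A).
  have := ler_wpM2r (ltW Z0) main; have := ler_wpM2r (ltW Z0) rk; lra.
rewrite -(ler_pM2l L0) -(ler_pM2r Z0); apply: le_trans fin _.
rewrite [leRHS](_ : _ = lambda * A * kappa * Z + 5 * (lambda * A) * (Z / Z)); last by ring.
by rewrite divff ?gt_eqF // mulr1.
Qed.

(** * Averages over arcs of a sphere *)

Section ShellAverage.
Variables (R : realType) (d : nat) (T : finZmodType).
Variables (p : {additive {ffun 'I_d -> int} -> T}) (h : T -> R).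
Hypothesis h1 : forall z, `|h z| <= 1.
Variables (e f : 'I_d) (w0 : {ffun 'I_d -> int}) (N M zeta omega A' Cj Z Delta : nat).
Variable (kappa : R).
Hypothesis fe : f != e.
Let A := A'.+1.
Hypothesis (N0 : (0 < N)%N) (M0 : (0 < M)%N) (omega0 : (0 < omega)%N) (Cj0 : (0 < Cj)%N).
Hypothesis (zeta0 : (0 < zeta)%N) (Z0 : (0 < Z)%N).
Hypothesis hDelta : (M * zeta + A + omega <= Delta)%N.
Hypothesis good : forall x : {ffun 'I_d -> int},
  (forall k, 0 <= x k - w0 k <= Delta%:Z) -> good_cap (N%:R : R) e x.
Hypothesis kappa01 : 0 <= kappa <= 1.
Hypothesis hk : avg (fun z => `|bavg p omega h z|) <= kappa.
Let D : R := d%:R.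
Let K2 : R := 16 * D ^+ 2 * (2 + 16 * D ^+ 2).
Let c : nat := 32 * d + 2.
Hypothesis H1 : (2 + 32 * D ^+ 2) * omega%:R * Z%:R * N%:R <= zeta%:R * A%:R.
Hypothesis H2 : 4 * K2 * (A%:R + omega%:R + 1) * Z%:R <= zeta%:R.
Hypothesis H3 : 2 * (c%:R ^+ 2 + c%:R) * Z%:R * N%:R <= zeta%:R * Cj%:R :> R.
Hypothesis H4 : 10 * Z%:R * N%:R <= zeta%:R * A%:R :> R.
Hypothesis H5 : (Z <= A)%N.

Let cp := cap (N%:R : R) e.

(** Arc [i] starts [i * zeta] steps from [w0] in direction [f], and [a] is the position along it;
    [q] smears the point over a small box. *)
Definition shell_base (i : nat) (q : ibox d omega) (a : nat) : {ffun 'I_d -> int} :=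
  w0 + ivec q + ev f (i * zeta + a)%N.

(** Coordinate [e] is reset to lie near the sphere; the jitter [j] makes correlations vary slowly
    along [e]. *)
Definition shell_vec (i : nat) (q : ibox d omega) (a j : nat) : {ffun 'I_d -> int} :=
  setc e (0 : int) (shell_base i q a) + ev e (Num.floor (cp (shell_base i q a)) + j%:Z).

Let ref (i a : nat) : {ffun 'I_d -> int} := w0 + ev f (i * zeta + a)%N.

Let NR0 : 0 < N%:R :> R. Proof. by rewrite ltr0n. Qed.
Let ZR0 : 0 < Z%:R :> R. Proof. by rewrite ltr0n. Qed.
Let ZR1 : 1 <= Z%:R :> R. Proof. by rewrite -[1]/(1%:R) ler_nat. Qed.

Lemma good_shell_base i q a : (i < M)%N -> (a <= A)%N -> good_cap (N%:R : R) e (shell_base i q a).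
Proof.
move=> iM aA; apply: good => k; rewrite !ffunE.
have qk := ltn_ord (q k).
have iz : (i.+1 * zeta <= M * zeta)%N by rewrite leq_mul2r iM orbT.
move: hDelta iz qk aA; rewrite mulSn.
by move: (nat_of_ord _) (w0 k) (i * zeta)%N (M * zeta)%N => qk u iz Mz; case: ifP => _; clear; lia.
Qed.

Lemma good_ref i a : (i < M)%N -> (a <= A)%N -> good_cap (N%:R : R) e (ref i a).
Proof.
move=> iM aA; apply: good => k; rewrite !ffunE.
have iz : (i.+1 * zeta <= M * zeta)%N by rewrite leq_mul2r iM orbT.
move: hDelta iz aA; rewrite mulSn.
by move: (w0 k) (i * zeta)%N (M * zeta)%N => u iz Mz; case: ifP => _; clear; lia.
Qed.

(** Arc [i] descends by about this amount at each step of [a]. *)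
Let slope i : R := (ref i 0 f)%:~R / cp (ref i 0).

Lemma shell_base_succ i q a : shell_base i q a.+1 = shell_base i q a + ev f 1.
Proof.
rewrite /shell_base -[RHS]addrA; congr (_ + _).
by apply/ffunP => k; rewrite !ffunE; case: ifP => _; rewrite ?addr0 // addnS -addn1 PoszD.
Qed.

Lemma shell_base_ref i q a k : (a <= A)%N ->
  `|(shell_base i q a k)%:~R - (ref i 0 k)%:~R| <= A%:R + omega%:R :> R.
Proof.
move=> aA; rewrite -rmorphB /= !ffunE -natrD -[_%:R]/((A + omega)%:Z%:~R) -intr_norm ler_int.
have := ltn_ord (q k); move: aA.
by move: (nat_of_ord _) (w0 k) (i * zeta)%N => qk u iz; case: ifP => _; clear; lia.
Qed.

Lemma slope_step i q a : (i < M)%N -> (a < A)%N ->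
  N%:R * `|cp (shell_base i q a.+1) - cp (shell_base i q a) + slope i| <=
  K2 * (A%:R + omega%:R + 1).
Proof.
move=> iM aA; rewrite shell_base_succ; apply: cap_slope => //.
- by apply: good_shell_base => //; apply: ltnW.
- by rewrite -shell_base_succ; apply: good_shell_base.
- exact: good_ref.
- by move=> k; apply: shell_base_ref; apply: ltnW.
- by move=> k; rewrite -shell_base_succ; apply: shell_base_ref.
Qed.

(** Distinct arcs start at least [zeta] apart, so [cap_slope_increasing] separates their slopes. The
    difference of slopes is the speed of the drift. *)
Lemma slope_lt i i' : (i < i')%N -> (i' < M)%N -> zeta%:R <= N%:R * (slope i' - slope i).
Proof.
move=> ii' iM.
have E : ref i' 0 = ref i 0 + ev f ((i' - i) * zeta)%N.
  rewrite /ref -addrA; congr (_ + _); apply/ffunP => k; rewrite !ffunE; case: ifP => _ //.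
  by rewrite !addn0 -PoszD -mulnDl subnKC // ltnW.
have g : good_cap (N%:R : R) e (ref i 0) by apply: good_ref => //; exact: ltn_trans iM.
have g' : good_cap (N%:R : R) e (ref i 0 + ev f ((i' - i) * zeta)%N).
  by rewrite -E; apply: good_ref.
have := cap_slope_increasing NR0 fe g g'.
rewrite -E; apply: le_trans; rewrite ler_nat leq_pmull // subn_gt0 //.
Qed.

Lemma slope_le i : (i < M)%N -> `|slope i| <= 8 * D.
Proof. by move=> iM; apply: slope_bound NR0 _ _ _; apply: good_ref. Qed.

(** With the same [a] on both arcs the displacements along [f] cancel, so that only coordinate [e]
    of the difference depends on [a]. *)
Lemma shell_vecB i q a j i' q' j' :
  shell_vec i q a j - shell_vec i' q' a j' =
  (ev f (i%:Z * zeta%:Z - i'%:Z * zeta%:Z) - setc e (0 : int) (ivec q') - ev e j') +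
   setc e (0 : int) (ivec q) +
   ev e ((Num.floor (cp (shell_base i q a)) - Num.floor (cp (shell_base i' q' a))) + j%:Z).
Proof.
rewrite /shell_vec; move: (Num.floor _) (Num.floor _) => F F'.
apply/ffunP => k; rewrite !ffunE; case: (eqVneq k e) => [->|ke].
  by rewrite eq_sym (negbTE fe); ring.
by case: ifP => _; rewrite ?PoszD ?PoszM; ring.
Qed.

Lemma shell_base_lip i q a : (i < M)%N -> (a <= A)%N ->
  `|cp (shell_base i q a) - cp (ref i a)| <= 8 * D ^+ 2 * omega%:R.
Proof.
move=> iM aA; apply: cap_lipschitz => //; [exact: good_shell_base | exact: good_ref | ].
move=> k; rewrite -rmorphB /= !ffunE -[_%:R]/(omega%:Z%:~R) -intr_norm ler_int.
have := ltn_ord (q k); move: (nat_of_ord _) (w0 k) (if _ then _ else _) => qk u v.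
by clear; lia.
Qed.

Let beta : R := 2 * (K2 * (A%:R + omega%:R + 1)) / N%:R.
Let E : R := 8 * D ^+ 2 * omega%:R.

Let D0 : 0 <= D. Proof. by rewrite /D. Qed.
Let K20 : 0 <= K2.
Proof. by rewrite /K2 !mulr_ge0 ?addr_ge0 ?mulr_ge0 ?sqr_ge0. Qed.

Let beta0 : 0 <= beta.
Proof.
apply: divr_ge0 => //; apply: mulr_ge0 => //; apply: mulr_ge0; first exact: K20.
by rewrite !addr_ge0.
Qed.

Let betaZ : 2 * beta * Z%:R * N%:R <= zeta%:R.
Proof.
apply: le_trans H2; rewrite /beta le_eqVlt; apply/orP; left; apply/eqP.
by field; rewrite gt_eqF.
Qed.

Lemma progression_pair_le W (phi : ibox d omega -> nat -> int) (Phi : ibox d omega -> nat -> R) (Phi0 lambda : R) :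
  (forall q a, (a <= A')%N -> `|(phi q a)%:~R - Phi q a| <= 1) ->
  (forall q a, (a < A')%N -> `|Phi q a.+1 - Phi q a - lambda| <= beta) ->
  (forall q, `|Phi q 0%N - Phi0| <= E) ->
  zeta%:R <= N%:R * lambda -> lambda <= 16 * D ->
  `|avg (fun q => avg (fun a : 'I_A => avg (fun j : 'I_Cj =>
     corr p h (W + setc e (0 : int) (ivec q) + ev e (phi q a + j%:Z)))))| <= kappa + 5 / Z%:R.
Proof.
move=> phi_Phi Phi_step Phi_0 zl lD.
have l0 : 0 < lambda by rewrite -(pmulr_rgt0 _ NR0); apply: lt_le_trans zl; rewrite ltr0n.
have bl : beta <= lambda.
  have b1 : beta * N%:R <= lambda * N%:R.
    have := le_trans betaZ zl; rewrite [N%:R * lambda]mulrC => b2.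
    apply: le_trans b2; rewrite [leRHS](_ : _ = beta * N%:R * (2 * Z%:R)); last by ring.
    have z2 : 1 <= 2 * Z%:R :> R by apply: le_trans ZR1 _; rewrite mulr_natl mulr2n lerDl.
    by apply: ler_peMr z2; rewrite mulr_ge0.
  by rewrite -(ler_pM2r NR0).
(* The value [32 * d + 2] of [c] comes from [beta <= lambda <= 16 * D]. *)
have lc : lambda + beta + 2 <= c%:R.
  have -> : c%:R = 32 * D + 2 :> R by rewrite /c natrD natrM.
  by move: (beta) (D) bl lD => b D'; lra.
pose r := Num.truncn (lambda * A'%:R).
have /andP[r1 r2] : r%:R <= lambda * A'%:R < r.+1%:R.
  by apply: truncn_itv; rewrite mulr_ge0 // ltW.
have rA : `|r%:R - lambda * A'%:R| <= 1 by move: r2; rewrite -natr1 ler_norml; lra.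
have main := pair_smoothing h1 e W omega0 Cj0 hk phi_Phi Phi_step Phi_0 l0 bl lc rA.
apply: pair_numeric NR0 l0 ZR0 _ _ _ kappa01 beta0 _ zl main rA _ betaZ H3 H4 _ => //.
- by rewrite ltr0n.
- by rewrite natr1.
- by apply: le_trans H1; rewrite le_eqVlt; apply/orP; left; apply/eqP; rewrite /E; ring.
- by rewrite ler_nat.
Qed.

Lemma pair_bound i i' q' j' : (i < M)%N -> (i' < M)%N -> i != i' ->
  `|avg (fun q => avg (fun a : 'I_A => avg (fun j : 'I_Cj =>
     corr p h (shell_vec i q a j - shell_vec i' q' a j'))))| <= kappa + 5 / Z%:R.
Proof.
move=> iM iM' ii'.
pose W := ev f (i%:Z * zeta%:Z - i'%:Z * zeta%:Z) - setc e (0 : int) (ivec q') - ev e j'.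
pose y q a := cp (shell_base i q a); pose y' a := cp (shell_base i' q' a).
pose phi q a := Num.floor (y q a) - Num.floor (y' a).
(* Centring the error of the floor at [- 1 / 2] gives the bound 1, instead of 2, for a difference of
   two floors. *)
have fl (u : R) : `|(Num.floor u)%:~R - u + 2^-1| <= 2^-1.
  by have := floor_itv u; rewrite intrD ler_norml; lra.
have phiP q a : `|(phi q a)%:~R - (y q a - y' a)| <= 1.
  rewrite /phi rmorphB /=; move: (fl (y q a)) (fl (y' a)); rewrite !ler_norml; lra.
have stepP q a : (a < A)%N ->
    `|(y q a.+1 - y' a.+1) - (y q a - y' a) - (slope i' - slope i)| <= beta.
  move=> aA; rewrite /beta ler_pdivlMr //.
  have := slope_step q iM aA; have := slope_step q' iM' aA.
  rewrite -/(y q a.+1) -/(y q a) -/(y' a.+1) -/(y' a) => s1 s2.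
  have -> : y q a.+1 - y' a.+1 - (y q a - y' a) - (slope i' - slope i) =
    (y q a.+1 - y q a + slope i) - (y' a.+1 - y' a + slope i') by ring.
  have := ler_wpM2r (ltW NR0) (ler_normB (y q a.+1 - y q a + slope i) (y' a.+1 - y' a + slope i')).
  lra.
have lipP a q : (a <= A)%N -> `|(y q a - y' a) - (cp (ref i a) - y' a)| <= E.
  move=> aA; have := shell_base_lip q iM aA; congr (`|_| <= _).
  by rewrite /y; ring.
have sl1 := slope_le iM; have sl2 := slope_le iM'.
have [lt_ii'|lt_i'i|/eqP] := ltngtP i i'; last by rewrite (negbTE ii').
  have := @progression_pair_le W phi (fun q a => y q a - y' a) (cp (ref i 0) - y' 0%N) (slope i' - slope i).
  rewrite (_ : avg _ = avg (fun q => avg (fun a : 'I_A => avg (fun j : 'I_Cj =>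
     corr p h (shell_vec i q a j - shell_vec i' q' a j'))))); last first.
    by do 3 (apply: eq_avg => ?); rewrite shell_vecB.
  apply => //.
  - by move=> q a aA; apply: stepP; rewrite ltnS ltnW.
  - by move=> q; apply: lipP.
  - exact: slope_lt.
  - by move: sl1 sl2; rewrite !ler_norml; lra.
(* For [i' < i] the drift is negative; reading the progression backwards makes it positive. *)
have := @progression_pair_le W (fun q a => phi q (A' - a)%N) (fun q a => y q (A' - a)%N - y' (A' - a)%N)
  (cp (ref i A') - y' A') (slope i - slope i').
rewrite (_ : avg _ = avg (fun q => avg (fun a : 'I_A => avg (fun j : 'I_Cj =>
     corr p h (shell_vec i q a j - shell_vec i' q' a j'))))); last first.
  apply: eq_avg => q.
  rewrite [RHS](avg_bij _ (Bijective (@rev_ordK A) (@rev_ordK A))) /=.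
  by do 2 (apply: eq_avg => ?); rewrite shell_vecB /= subSS.
apply => //.
- move=> q a aA; have := stepP q (A' - a.+1)%N.
  have -> : (A' - a.+1).+1 = (A' - a)%N by move: aA; case: (A') => // m am; rewrite subSS subSn.
  move=> /(_ (leq_trans (leq_subr _ _) (leqnSn _))).
  rewrite -[X in X <= _]normrN; congr (`|_| <= _); ring.
- by move=> q; rewrite subn0; apply: lipP.
- exact: slope_lt.
- by move: sl1 sl2; rewrite !ler_norml; lra.
Qed.

(** In the expanded square, the pairs with [i = i'] are bounded trivially and have weight [1 / M];
    [pair_bound] treats the others. *)
Theorem shell_average_small :
  avg (fun z => avg (fun a : 'I_A => avg (fun i : 'I_M => avg (fun q : ibox d omega =>
    avg (fun j : 'I_Cj => h (z + p (shell_vec i q a j)))))) ^+ 2) <=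
  M%:R^-1 + kappa + 5 / Z%:R.
Proof.
pose I : finType := ('I_M * (ibox d omega * 'I_Cj))%type.
pose v (a : 'I_A) (t : I) := shell_vec t.1 t.2.1 a t.2.2.
have cI : (0 < #|I|)%N by rewrite /I !card_prod !card_ord !muln_gt0 M0 card_ibox_gt0.
have cA : (0 < #|'I_A|)%N by rewrite card_ord.
have -> : avg (fun z => avg (fun a : 'I_A => avg (fun i : 'I_M => avg (fun q : ibox d omega =>
    avg (fun j : 'I_Cj => h (z + p (shell_vec i q a j)))))) ^+ 2) =
  avg (fun z => avg (fun a : 'I_A => avg (fun t : I => h (z + p (v a t)))) ^+ 2).
  apply: eq_avg => z; congr (_ ^+ 2); apply: eq_avg => a; rewrite avg_pair; apply: eq_avg => i.
  by rewrite avg_pair.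
(* Taking the average over [a] out of the square keeps only pairs with a common [a], the case of
   [shell_vecB]. *)
apply: (@le_trans _ _ (avg (fun z => avg (fun a : 'I_A => avg (fun t : I => h (z + p (v a t))) ^+ 2)))).
  by apply: ler_avg => z; apply: sqr_avg_le.
have -> : avg (fun z => avg (fun a : 'I_A => avg (fun t : I => h (z + p (v a t))) ^+ 2)) =
  avg (fun t' : I => avg (fun i : 'I_M => avg (fun q : ibox d omega => avg (fun a : 'I_A => avg (fun j : 'I_Cj =>
    corr p h (shell_vec i q a j - v a t')))))).
  rewrite avg_exchange.
  transitivity (avg (fun a : 'I_A => avg (fun t' : I => avg (fun t : I => corr p h (v a t - v a t'))))).
    apply: eq_avg => a.
    transitivity (avg (fun z => avg (fun t' : I => avg (fun t : I => h (z + p (v a t')) * h (z + p (v a t)))))).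
      apply: eq_avg => z; rewrite expr2 -avgZr; apply: eq_avg => t'; rewrite -avgZ.
      by apply: eq_avg.
    rewrite [LHS]avg_exchange; apply: eq_avg => t'; rewrite [LHS]avg_exchange; apply: eq_avg => t.
    rewrite /corr -[RHS](avg_shift _ (p (v a t'))); apply: eq_avg => z.
    by rewrite raddfB -[z + _ + _]addrA [p (v a t') + _]addrC subrK.
  rewrite [LHS]avg_exchange; apply: eq_avg => t'.
  transitivity (avg (fun a : 'I_A => avg (fun i : 'I_M => avg (fun q : ibox d omega => avg (fun j : 'I_Cj =>
    corr p h (shell_vec i q a j - v a t')))))).
    apply: eq_avg => a; rewrite avg_pair; apply: eq_avg => i; by rewrite avg_pair.
  rewrite [LHS]avg_exchange; apply: eq_avg => i.
  by rewrite [LHS]avg_exchange.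
apply: avg_le => // -[i' [q' j']].
apply: (@le_trans _ _ (avg (fun i : 'I_M => (i \in [set i'])%:R + (kappa + 5 / Z%:R)))); last first.
  by rewrite avgD avg_ind cards1 card_ord avg_cst ?card_ord // mul1r addrA.
apply: ler_avg => i; rewrite inE.
have kz : 0 <= kappa + 5 / Z%:R.
  by case/andP: kappa01 => k0 _; rewrite addr_ge0 // divr_ge0.
case: eqVneq => [_|ne].
  apply: (@le_trans _ _ 1); last by rewrite lerDl.
  apply: avg_le => [|q]; first exact: card_ibox_gt0.
  apply: avg_le => // a; apply: avg_le => [|j]; first by rewrite card_ord.
  by apply: le_trans (ler_norm _) (corr_le1 _ h1 _).
rewrite add0r; apply: le_trans (ler_norm _) _; exact: pair_bound.
Qed.

End ShellAverage.

(** * Points of a dense set at a prescribed distance *)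

Section Torus.
Variables (d n : nat).

(** Reduction modulo [n.+1], written as an integer multiple of 1 so that additivity is immediate. *)
Definition torus (w : {ffun 'I_d -> int}) : {ffun 'I_d -> 'I_n.+1} :=
  [ffun k => (inZp 1 : 'I_n.+1) *~ w k].

Lemma torus_is_zmod_morphism : zmod_morphism torus.
Proof. by move=> u v; apply/ffunP => k; rewrite !ffunE mulrzBr. Qed.

HB.instance Definition _ :=
  GRing.isZmodMorphism.Build {ffun 'I_d -> int} {ffun 'I_d -> 'I_n.+1} torus torus_is_zmod_morphism.

Lemma ivec_torus (w : {ffun 'I_d -> int}) : (forall k, 0 <= w k < n.+1%:Z) -> ivec (torus w) = w.
Proof.
move=> wn; apply/ffunP => k; rewrite !ffunE; case: (w k) (wn k) => // j.
rewrite -pmulrn Zp_mulrn => jn; congr Posz; rewrite /= modnMml mul1n.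
by rewrite modn_small //; case/andP: jn.
Qed.

Lemma torus_ivec (x : ibox d n.+1) : torus (ivec x) = x.
Proof.
apply/ffunP => k; rewrite !ffunE -pmulrn Zp_mulrn; apply: val_inj.
by rewrite /= modnMml mul1n modn_small.
Qed.

Lemma torus_eq0 (w : {ffun 'I_d -> int}) k : torus w = 0 -> (`|w k| < n.+1)%N -> w k = 0.
Proof.
move/ffunP/(_ k); rewrite !ffunE; case: (w k) => j /=.
  rewrite -pmulrn Zp_mulrn => /(congr1 val) /=; rewrite modnMml mul1n => + jn.
  by rewrite modn_small // => ->.
move=> /eqP; rewrite NegzE mulrNz oppr_eq0 => /eqP.
rewrite -pmulrn Zp_mulrn => /(congr1 val) /=; rewrite modnMml mul1n => + jn.
by rewrite modn_small.
Qed.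

End Torus.

Section LocalBox.
Variables (R : realFieldType) (d : nat).

Definition cube_vec (c : nat) : {ffun 'I_d -> int} := [ffun=> c%:Z].

Lemma avg_inj_le (U V : finType) (g : U -> V) (F : V -> R) : injective g ->
  (forall y, 0 <= F y) -> #|U|%:R * avg (F \o g) <= #|V|%:R * avg F.
Proof.
move=> gi F0.
have aux (W : finType) (H : W -> R) : #|W|%:R * avg H = \sum_x H x.
  have [W0|W0] := posnP #|W|.
    by rewrite W0 mul0r big1 // => x _; have := fintype0 x W0.
  by rewrite /avg mulrC divfK // pnatr_eq0 -lt0n.
rewrite !aux /comp -(big_map g xpredT F).
have us : uniq [seq g i | i <- index_enum U] by rewrite map_inj_uniq // index_enum_uniq.
rewrite big_uniq //= big_mkcond /=; apply: ler_sum => y _; by case: ifP.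
Qed.

(** The translated box embeds in the box of side [3 * sigma], which has [3 ^ d] times as many
    points. *)
Lemma avg_subbox (sigma n : nat) (w : {ffun 'I_d -> int}) (F : {ffun 'I_d -> int} -> R) :
  (0 < sigma)%N -> (3 * sigma = n.+1)%N -> (forall y, 0 <= F y) ->
  (forall k, 0 <= w k <= (2 * sigma)%:Z) ->
  avg (fun x : ibox d sigma => F (w + ivec x)) <= 3 ^+ d * avg (fun y : ibox d n.+1 => F (ivec y)).
Proof.
move=> s0 e3 F0 ws.
pose g (x : ibox d sigma) : ibox d n.+1 := torus n (w + ivec x).
have gE x : ivec (g x) = w + ivec x.
  apply: ivec_torus => k; rewrite !ffunE; have := ltn_ord (x k); have := ws k.
  by move: (nat_of_ord _) (w k) => xk wk; lia.
have gi : injective g.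
  move=> x y /(congr1 (@ivec d n.+1)); rewrite !gE => /addrI /ffunP xy.
  by apply/ffunP => k; apply: val_inj; have := xy k; rewrite !ffunE => -[].
have := @avg_inj_le _ _ g (fun y => F (ivec y)) gi (fun=> F0 _).
have cn : (n.+1 ^ d)%:R = 3 ^+ d * sigma%:R ^+ d :> R by rewrite -e3 natrX natrM exprMn.
rewrite !card_ibox cn natrX.
rewrite (@eq_avg _ _ _ (fun x => F (w + ivec x))) => [|x] /=; last by rewrite gE.
rewrite [X in _ <= X](_ : _ = sigma%:R ^+ d * (3 ^+ d * avg (fun y : ibox d n.+1 => F (ivec y)))).
  by rewrite ler_pM2l // exprn_gt0 // ltr0n.
ring.
Qed.

Lemma sum_ord_lt (n m : nat) : (\sum_(c < n) (c < m) <= m)%N.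
Proof.
have : (\sum_(c < n) (c < m) <= minn n m)%N.
  elim: n => [|n IH]; first by rewrite big_ord0.
  by rewrite big_ord_recr /=; apply: leq_trans (leq_add IH (leqnn _)) _; clear IH; lia.
by move=> h; apply: leq_trans h (geq_minr _ _).
Qed.

Lemma avg_near_face (n m : nat) (k : 'I_d) : (0 < n)%N ->
  avg (fun z : ibox d n => (n < z k + m)%N%:R) <= m%:R / n%:R :> R.
Proof.
move=> n0; rewrite (avg_resample k) //; apply: avg_le => [|z]; first exact: card_ibox_gt0.
rewrite (@eq_avg _ _ _ (fun c : 'I_n => (n < c + m)%N%:R)); last by move=> c; rewrite ffunE eqxx.
rewrite /avg card_ord ler_wpM2r ?invr_ge0 // -natr_sum ler_nat.
apply: leq_trans (sum_ord_lt n m); rewrite (reindex_inj rev_ord_inj) /=.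
apply: leq_sum => c _; have := ltn_ord c; case: (ltnP c m) => [_ _|cm cn]; first by case: (_ < _)%N.
by rewrite (_ : (_ < _)%N = false) //; apply/negbTE; lia.
Qed.

End LocalBox.

Section Discrepancy.
Variables (R : realFieldType) (d : nat) (G : finZmodType).
Variables (p : {additive {ffun 'I_d -> int} -> G}) (chi : G -> R) (z1 : G) (eta omega n : nat).
Hypothesis chi01 : forall z, 0 <= chi z <= 1.
Hypothesis (eta0 : (0 < eta)%N) (omega0 : (0 < omega)%N).

Definition disc (z : G) : R := chi z - bavg p eta chi z.

Lemma chi_norm z : `|chi z| <= 1.
Proof. by rewrite ler_norml; have := chi01 z; lra. Qed.

Lemma bavg01 m z : (0 < m)%N -> 0 <= bavg p m chi z <= 1.
Proof.
move=> m0; apply/andP; split; first by apply: bavg_ge => // y; case/andP: (chi01 y).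
by apply: bavg_le => // y; case/andP: (chi01 y).
Qed.

Lemma disc_norm z : `|disc z| <= 1.
Proof.
have := chi01 z; have := bavg01 z eta0; rewrite /disc ler_norml; lra.
Qed.

(** Averages of [chi] at scale [omega] hardly change when averaged again at scale [eta]. *)
Lemma bavg_disc z : `|bavg p omega disc z| <= d%:R * (2 * eta%:R / omega%:R).
Proof.
have -> : bavg p omega disc z = bavg p omega chi z - bavg p eta (bavg p omega chi) z.
  by rewrite bavgC /bavg -avgB.
rewrite distrC; apply: bavg_bavg => // y; exact: chi_norm.
Qed.

(** A copy of [disc] near [z1], transplanted to a torus of side [n.+1]; it makes the shell estimate
    local. *)
Definition ldisc (x : {ffun 'I_d -> 'I_n.+1}) : R := disc (z1 + p (ivec x)).

(** A box of side [omega] that does not wrap around the torus sees the same values as in [G]; the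
    other base points lie close to one of [d] faces. *)
Lemma avg_bavg_ldisc : 
  avg (fun x => `|bavg (torus n) omega ldisc x|) <=
    d%:R * (2 * eta%:R / omega%:R) + d%:R * (omega%:R / n.+1%:R).
Proof.
apply: (@le_trans _ _ (avg (fun x : ibox d n.+1 => d%:R * (2 * eta%:R / omega%:R) +
    \sum_(k < d) (n.+1 < x k + omega)%N%:R))); last first.
  rewrite avgD avg_cst ?card_ibox_gt0 // lerD2l avg_sum.
  apply: le_trans (ler_sum _ (fun k _ => avg_near_face R omega k (ltn0Sn n))) _.
  by rewrite sumr_const card_ord -[_ *+ d]mulr_natl.
apply: ler_avg => x.
have [/existsP[k kx]|/existsPn H] := boolP [exists k, (n.+1 < x k + omega)%N].
  apply: (@le_trans _ _ 1).
    by apply: bavg_norm_le => // y; apply: disc_norm.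
  rewrite (bigD1 k) //= kx addrCA lerDl addr_ge0 ?sumr_ge0 // mulr_ge0 // mulr_ge0 ?invr_ge0 //.
  by rewrite mulr_ge0.
rewrite [X in `|X|](_ : _ = bavg p omega disc (z1 + p (ivec x))).
  apply: le_trans (bavg_disc _) _; rewrite lerDl sumr_ge0 //.
apply: eq_avg => y; rewrite /ldisc -addrA -raddfD; congr (disc (_ + p _)).
rewrite -{1}(torus_ivec x) -raddfD ivec_torus // => k; rewrite !ffunE.
have := H k; have := ltn_ord (y k); move: (nat_of_ord (y k)) (nat_of_ord (x k)) => yk xk.
by rewrite -leqNgt; lia.
Qed.

End Discrepancy.

Section EuclideanNorm.
Variables (R : realType) (d : nat).

Definition sqn (w : {ffun 'I_d -> int}) : R := \sum_k (w k)%:~R ^+ 2.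
Definition enorm (w : {ffun 'I_d -> int}) : R := Num.sqrt (sqn w).

Lemma sqn_ge0 w : 0 <= sqn w.
Proof. by apply: sumr_ge0 => k _; apply: sqr_ge0. Qed.

Lemma enorm_ge0 w : 0 <= enorm w. Proof. exact: sqrtr_ge0. Qed.

Lemma sqr_enorm w : enorm w ^+ 2 = sqn w.
Proof. by rewrite sqr_sqrtr // sqn_ge0. Qed.

Lemma coord_le_enorm (w : {ffun 'I_d -> int}) k : `|(w k)%:~R| <= enorm w.
Proof.
rewrite -sqrtr_sqr ler_wsqrtr // /sqn (bigD1 k) //= lerDl.
by apply: sumr_ge0 => i _; apply: sqr_ge0.
Qed.

Lemma enormN w : enorm (- w) = enorm w.
Proof.
by congr Num.sqrt; apply: eq_bigr => k _; rewrite !ffunE rmorphN sqrrN.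
Qed.

(** If all coordinates were below [N / d], the squared norm would be less than [N ^ 2 / d]. *)
Lemma large_coord (N : R) (w : {ffun 'I_d -> int}) : 0 <= N -> N <= enorm w -> (0 < d)%N ->
  exists k, N <= d%:R * `|(w k)%:~R|.
Proof.
move=> N0 Nw d0; apply: contrapT => H.
have lt k : `|(w k)%:~R| * d%:R < N :> R.
  by rewrite ltNge mulrC; apply/negP => h; apply: H; exists k.
have D1 : 1 <= d%:R :> R by rewrite -[1]/(1%:R) ler_nat.
have : sqn w * d%:R ^+ 2 < d%:R * N ^+ 2.
  rewrite /sqn mulr_suml mulr_natl -[X in _ < N ^+ 2 *+ X](card_ord d) -sumr_const.
  apply: ltr_sum; last by move=> k _; have := lt k; rewrite -(real_normK (num_real _)) -exprMn;
    rewrite ltr_pXn2r ?nnegrE ?mulr_ge0.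
  by apply/hasP; exists (Ordinal d0); rewrite ?mem_index_enum.
have : N ^+ 2 <= sqn w by rewrite -sqr_enorm ler_pXn2r ?nnegrE ?enorm_ge0.
have : 0 <= N ^+ 2 by apply: sqr_ge0.
move: (N ^+ 2) (sqn w) => n s n0 ns.
have : n * d%:R ^+ 2 <= s * d%:R ^+ 2 by rewrite ler_wpM2r // sqr_ge0.
have : d%:R * n <= n * d%:R ^+ 2.
  by rewrite mulrC ler_wpM2l // expr2 ler_peMr.
lra.
Qed.

Variables (N : R) (e : 'I_d) (w0 : {ffun 'I_d -> int}) (Delta : nat).
Let D : R := d%:R.
Let D1 : 1 <= D.
Proof. by rewrite -[1]/(1%:R) ler_nat; case: d e => // -[]. Qed.
Hypothesis w0N : `|enorm w0 - N| <= D.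
Hypothesis w0e : N <= 2 * D * (w0 e)%:~R.
Hypothesis DeltaN : 32 * D ^+ 3 * (Delta%:R + 1) <= N.

Let D3 : D <= D ^+ 3.
Proof. by rewrite exprS ler_peMr ?exprn_ege1 // (le_trans _ D1). Qed.

Let ND : 32 * D <= N.
Proof.
apply: le_trans DeltaN; have h : D ^+ 3 <= D ^+ 3 * (Delta%:R + 1).
  by rewrite ler_peMr ?lerDr // (le_trans _ D3) // (le_trans _ D1).
by move: D3; lra.
Qed.

Let NDelta : 32 * Delta%:R <= N.
Proof.
apply: le_trans DeltaN; have h : 1 * Delta%:R <= D ^+ 3 * (Delta%:R + 1).
  by apply: ler_pM => //; [exact: le_trans D1 D3 | rewrite lerDl].
by lra.
Qed.

Let N0 : 0 < N. Proof. by move: ND D1; lra. Qed.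

(** By [w0e] the square of [w0 e] is at least [N ^ 2 / (4 D ^ 2)]; by [DeltaN], moving by at most
    [Delta] changes the other squares by less than that. *)
Lemma good_cap_near (x : {ffun 'I_d -> int}) : (forall k, 0 <= x k - w0 k <= Delta%:Z) -> good_cap N e x.
Proof.
move=> xw.
have xwR k : 0 <= ((x k)%:~R - (w0 k)%:~R : R) <= Delta%:R.
  have -> : (x k)%:~R - (w0 k)%:~R = (x k - w0 k)%:~R :> R by rewrite rmorphB.
  have /andP[a b] := xw k; apply/andP; split; first by rewrite ler0z.
  by rewrite [X in _ <= X]pmulrn ler_int.
have w0k k : `|(w0 k)%:~R| <= N + D :> R.
  by apply: le_trans (coord_le_enorm _ _) _; move: w0N; rewrite ler_norml; lra.
have xk k : `|(x k)%:~R| <= 2 * N :> R.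
  have := xwR k; have := w0k k; move: ND NDelta N0; rewrite !ler_norml; lra.
split=> //.
set S := \sum_(k | k != e) (w0 k)%:~R ^+ 2 : R.
set T := \sum_(k | k != e) (x k)%:~R ^+ 2 : R.
have TS : T <= S + D * (5 * N * Delta%:R).
  have -> : D * (5 * N * Delta%:R) = \sum_(k < d) (5 * N * Delta%:R).
    by rewrite sumr_const card_ord -[RHS]mulr_natl.
  rewrite /T /S big_mkcond [in leRHS]big_mkcond /= -big_split /=.
  apply: ler_sum => k _; case: ifP => _; last first.
    by rewrite add0r mulr_ge0 // mulr_ge0 // ltW.
  have [/andP[a0 a1] b] := (xwR k, w0k k).
  have -> : (x k)%:~R ^+ 2 = (w0 k)%:~R ^+ 2 +
      ((x k)%:~R - (w0 k)%:~R) * ((x k)%:~R + (w0 k)%:~R) :> R by ring.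
  rewrite lerD2l [leRHS]mulrC.
  apply: le_trans (ler_norm _) _; rewrite normrM; apply: ler_pM => //.
    by rewrite ger0_norm.
  apply: le_trans (ler_normD _ _) _; have := xk k; move: ND N0 b; lra.
have SE : S = enorm w0 ^+ 2 - (w0 e)%:~R ^+ 2.
  by rewrite sqr_enorm /sqn (bigD1 e) //= addrAC subrr add0r.
have en : enorm w0 <= N + D by move: w0N; rewrite ler_norml; lra.
have en2 : enorm w0 ^+ 2 <= (N + D) ^+ 2.
  by rewrite ler_pXn2r ?nnegrE ?enorm_ge0 // (le_trans _ en) ?enorm_ge0.
have we2 : N ^+ 2 <= 4 * D ^+ 2 * (w0 e)%:~R ^+ 2.
  rewrite [leRHS](_ : _ = (2 * D * (w0 e)%:~R) ^+ 2); last by ring.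
  by rewrite ler_pXn2r ?nnegrE ?(ltW N0) // (le_trans (ltW N0)).
have key : N ^+ 2 <= 16 * D ^+ 2 * (N ^+ 2 - T).
  have D20 : 0 <= 16 * D ^+ 2 by rewrite mulr_ge0 // sqr_ge0.
  have h1 : T <= (N + D) ^+ 2 - (w0 e)%:~R ^+ 2 + D * (5 * N * Delta%:R) by lra.
  have h2 := ler_wpM2l D20 h1.
  have h3 := ler_wpM2l (ltW N0) DeltaN.
  have h4 : D ^+ 3 * D <= D ^+ 3 * N.
    by rewrite ler_wpM2l ?exprn_ge0 // ?(le_trans _ D1) //; move: ND D1; lra.
  have h5 : 0 <= N * D ^+ 3 by rewrite mulr_ge0 ?(ltW N0) // exprn_ge0 // (le_trans _ D1).
  have h6 : 0 <= N * D ^+ 3 * Delta%:R by rewrite mulr_ge0.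
  lra.
have T0 : 0 <= N ^+ 2 - T.
  rewrite -(pmulr_rge0 _ (x := 16 * D ^+ 2)); first by apply: le_trans key; apply: sqr_ge0.
  by rewrite mulr_gt0 // exprn_gt0 // (lt_le_trans _ D1).
have c0 : 0 <= 4 * D * cap N e x.
  by rewrite mulr_ge0 ?sqrtr_ge0 // mulr_ge0 // (le_trans _ D1).
rewrite -(ler_pXn2r (n := 2)) ?nnegrE ?(ltW N0) //.
apply: le_trans key _; rewrite !exprMn sqr_sqrtr //.
by rewrite le_eqVlt; apply/orP; left; apply/eqP; rewrite -/T; ring.
Qed.

(** At [w0] itself the squares of [cap] and [w0 e] differ by [N ^ 2 - |w0| ^ 2]; [cap_lipschitz]
    does the rest. *)
Lemma cap_near (x : {ffun 'I_d -> int}) : (forall k, 0 <= x k - w0 k <= Delta%:Z) ->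
  `|cap N e x - (w0 e)%:~R| <= 8 * D ^+ 2 * Delta%:R + 12 * D ^+ 2.
Proof.
move=> xw; have gx := good_cap_near xw.
have gw : good_cap N e w0 by apply: good_cap_near => k; rewrite subrr.
have L : `|cap N e x - cap N e w0| <= 8 * D ^+ 2 * Delta%:R.
  apply: cap_lipschitz => // k.
  have -> : (x k)%:~R - (w0 k)%:~R = (x k - w0 k)%:~R :> R by rewrite rmorphB.
  rewrite -intr_norm [X in _ <= X]pmulrn ler_int.
  by have := xw k; move: (x k) (w0 k) => a b; lia.
suff W : `|cap N e w0 - (w0 e)%:~R| <= 12 * D ^+ 2.
  apply: le_trans (ler_distD (cap N e w0) _ _) _; exact: lerD.
have w0e0 : 0 < (w0 e)%:~R :> R.
  rewrite -(pmulr_rgt0 _ (x := 2 * D)); first exact: lt_le_trans w0e.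
  by rewrite mulr_gt0 // (lt_le_trans _ D1).
have c0 := good_cap_gt0 N0 gw; have [cN _] := gw.
have E : (cap N e w0 - (w0 e)%:~R) * (cap N e w0 + (w0 e)%:~R) = (N - enorm w0) * (N + enorm w0).
  have SE : sqn w0 = (w0 e)%:~R ^+ 2 + \sum_(k | k != e) (w0 k)%:~R ^+ 2 by rewrite /sqn (bigD1 e).
  by rewrite -!subr_sqr sqr_cap // sqr_enorm SE; ring.
have B : `|cap N e w0 - (w0 e)%:~R| * (cap N e w0 + (w0 e)%:~R) <= D * (3 * N).
  rewrite -[cap N e w0 + (w0 e)%:~R]gtr0_norm ?addr_gt0 // -normrM E normrM; apply: ler_pM => //.
    by rewrite distrC.
  rewrite ger0_norm ?addr_ge0 ?enorm_ge0 ?(ltW N0) //.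
  by move: w0N ND N0; rewrite ler_norml; lra.
have D0 : 0 < 4 * D by rewrite mulr_gt0 // (lt_le_trans _ D1).
rewrite -(ler_pM2r N0); apply: (@le_trans _ _ (4 * D * (D * (3 * N)))); last first.
  by rewrite le_eqVlt; apply/orP; left; apply/eqP; ring.
apply: le_trans (ler_wpM2l (ltW D0) B); rewrite mulrCA ler_wpM2l //.
apply: le_trans cN _; rewrite ler_wpM2l ?(ltW D0) // lerDl ltW //.
Qed.

(** The squared norm minus [N ^ 2] equals the difference of the squares of coordinate [e] and of the
    height. Factoring both, the quotient of the sums is at most 1, so that only the rounding and the
    jitter remain. *)
Lemma enorm_shell x (j Cj : nat) : (j < Cj)%N -> good_cap N e x ->
  `|enorm (setc e (0 : int) x + ev e (Num.floor (cap N e x) + j%:Z)) - N| <= Cj%:R.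
Proof.
move=> jC gx; set v := _ + ev e _; set y := cap N e x.
have ve : v e = Num.floor y + j%:Z by rewrite !ffunE eqxx add0r.
have vk k : k != e -> v k = x k by move=> ke; rewrite !ffunE (negbTE ke) addr0.
have y0 : 0 < y := good_cap_gt0 N0 gx.
have jC' : j%:R + 1 <= Cj%:R :> R by rewrite natr1 ler_nat.
have dist : `|(v e)%:~R - y| <= Cj%:R.
  rewrite ve intrD; have := floor_itv y; rewrite intrD.
  have j0 : 0 <= j%:R :> R by [].
  by rewrite -[j%:~R]/(j%:R : R) ler_norml; lra.
have E : (enorm v - N) * (enorm v + N) = ((v e)%:~R - y) * ((v e)%:~R + y).
  have SE : sqn v = (v e)%:~R ^+ 2 + \sum_(k | k != e) (x k)%:~R ^+ 2.
    by rewrite /sqn (bigD1 e) //=; congr (_ + _); apply: eq_bigr => k ke; rewrite vk.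
  by rewrite -!subr_sqr sqr_enorm SE sqr_cap //; ring.
have P : 0 < enorm v + N by rewrite ltr_wpDl // enorm_ge0.
rewrite -(ler_pM2r P) -[enorm v + N in leLHS]gtr0_norm // -normrM E normrM.
apply: ler_pM => //; apply: le_trans (ler_normD _ _) _; apply: lerD.
  exact: coord_le_enorm.
by rewrite gtr0_norm //; apply: cap_le.
Qed.

End EuclideanNorm.

Section LocalPair.
Variables (R : realFieldType) (d : nat) (G : finZmodType).
Variables (p : {additive {ffun 'I_d -> int} -> G}) (S : {set G}).

Definition ind (z : G) : R := (z \in S)%:R.

Lemma ind01 z : 0 <= ind z <= 1.
Proof. by rewrite /ind; case: (z \in S); rewrite ?lexx ler01. Qed.

Definition sparse (eta : nat) (a : R) (z : G) : R := ((bavg p eta ind z < a)%R)%:R.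

Lemma sparse01 eta a z : 0 <= sparse eta a z <= 1.
Proof. by rewrite /sparse; case: (_ < a); rewrite ?lexx ler01. Qed.

Variables (I : finType) (u : I -> {ffun 'I_d -> int}) (z0 z1 : G) (sigma n eta : nat) (a B theta : R).
Hypothesis (I0 : (0 < #|I|)%N) (sigma0 : (0 < sigma)%N) (eta0 : (0 < eta)%N).
Hypothesis n3 : (3 * sigma = n.+1)%N.
Hypothesis u_le : forall t k, (`|u t k| <= sigma)%N.
Hypothesis a01 : 0 < a <= 1.
Hypothesis discB : avg (fun y : {ffun 'I_d -> 'I_n.+1} =>
  avg (fun t => ldisc p ind z1 eta (y + torus n (u t))) ^+ 2) <= B.
Hypothesis sparse0 : avg (fun x : ibox d n.+1 => sparse eta a (z0 + p (ivec x))) <= theta.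
Hypothesis sparse1 : avg (fun x : ibox d n.+1 => sparse eta a (z1 + p (ivec x))) <= theta.
Hypothesis theta_small : 3 ^+ d * theta <= a / 4.
Hypothesis eta_small : d%:R * (2 * eta%:R / sigma%:R) <= a / 4.
Hypothesis B_small : 16 * (3 ^+ d * B) < a ^+ 4.

(** The offset [sigma] puts these points in the middle third of the large box, so that adding [u t]
    does not wrap around. *)
Let X (x : ibox d sigma) : {ffun 'I_d -> int} := cube_vec d sigma + ivec x.

Let g z := bavg p eta ind z.

Let g01 z : 0 <= g z <= 1.
Proof. by apply: bavg01 => // y; apply: ind01. Qed.

Let g_ge z : a * (1 - sparse eta a z) <= g z.
Proof.
case/andP: a01 => a0 a1; rewrite /sparse -/(g z); case: ltP => h.
  by rewrite subrr mulr0; case/andP: (g01 z).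
by rewrite subr0 mulr1.
Qed.

Let X_bound x t k : 0 <= (X x + u t) k < n.+1%:Z.
Proof.
rewrite !ffunE -n3; have := u_le t k; have := ltn_ord (x k).
by move: (nat_of_ord _) (u t k) => xk utk; lia.
Qed.

(** Suppose that there is no pair. Replacing the indicator at the second point by its local average
    [g] then leaves only the discrepancy, so that [L ^ 2 <= 3 ^ d * B]. But [g >= a] off the sparse
    points, which gives [L >= a ^ 2 / 4] and contradicts [B_small]. *)
Lemma local_pair : exists Y t, z0 + p Y \in S /\ z1 + p (Y + u t) \in S.
Proof.
apply: contrapT => H; case/andP: (a01) => a0 a1.
have zero x t : ind (z0 + p (X x)) * ind (z1 + p (X x + u t)) = 0.
  rewrite /ind; case E0 : (_ \in S); last by rewrite mul0r.
  by case E1 : (_ \in S); [case: H; exists (X x), t | rewrite mulr0].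
pose dis x := avg (fun t => disc p ind eta (z1 + p (X x + u t))).
pose gav x := avg (fun t => g (z1 + p (X x + u t))).
pose al x := ind (z0 + p (X x)).
have cs : (0 < #|ibox d sigma|)%N by apply: card_ibox_gt0.
have step2 x : al x * gav x <= `|dis x|.
  have -> : al x * gav x = - (al x * dis x).
    apply/eqP; rewrite -addr_eq0 -mulrDr -avgD -avgZ.
    rewrite (@eq_avg _ _ _ (fun=> 0)) ?avg_cst // => t.
    by rewrite /disc -/(g _) [g _ + _]addrC subrK; apply: zero.
  apply: le_trans (ler_norm _) _; rewrite normrN normrM.
  by rewrite ler_piMl // ger0_norm; case/andP: (ind01 (z0 + p (X x))).
pose L := avg (fun x => al x * gav x).
have L2 : L ^+ 2 <= 3 ^+ d * B.
  have L0 : 0 <= L.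
    apply: avg_ge0 => x; apply: mulr_ge0; first by case/andP: (ind01 (z0 + p (X x))).
    by apply: avg_ge0 => t; case/andP: (g01 (z1 + p (X x + u t))).
  apply: (@le_trans _ _ (avg (fun x => `|dis x|) ^+ 2)).
    rewrite ler_pXn2r ?nnegrE ?(le_trans L0) //; exact: ler_avg.
  apply: le_trans (sqr_avg_le _) _.
  pose F (Y : {ffun 'I_d -> int}) : R :=
    avg (fun t => ldisc p ind z1 eta (torus n Y + torus n (u t))) ^+ 2.
  rewrite (@eq_avg _ _ _ (fun x => F (cube_vec d sigma + ivec x))); last first.
    move=> x; rewrite real_normK ?num_real // /F /dis; congr (_ ^+ 2); apply: eq_avg => t.
    by rewrite /ldisc -raddfD /= ivec_torus // => k; apply: X_bound.
  apply: le_trans (avg_subbox (w := cube_vec d sigma) (F := F) sigma0 n3 _ _) _.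
  - by move=> Y; apply: sqr_ge0.
  - by move=> k; rewrite ffunE; lia.
  rewrite ler_wpM2l ?exprn_ge0 //; apply: le_trans discB; apply: ler_avg => y.
  by rewrite /F torus_ivec.
have sp (z : G) (w : {ffun 'I_d -> int}) : (forall k, 0 <= w k <= (2 * sigma)%:Z) ->
    avg (fun x : ibox d n.+1 => sparse eta a (z + p (ivec x))) <= theta ->
    avg (fun x : ibox d sigma => sparse eta a (z + p (w + ivec x))) <= a / 4.
  move=> w_bound spz; apply: le_trans theta_small.
  apply: le_trans (avg_subbox (F := fun Y => sparse eta a (z + p Y)) sigma0 n3 _ w_bound) _.
    by move=> Y; case/andP: (sparse01 eta a (z + p Y)).
  by rewrite ler_wpM2l ?exprn_ge0.
have step4 : a * avg al - a * (a / 4) <= L.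
  apply: (@le_trans _ _ (avg (fun x => a * al x -
      a * avg (fun t => sparse eta a (z1 + p (X x + u t)))))).
    rewrite avgB 2!avgZ lerD2l lerN2 ler_wpM2l ?(ltW a0) // avg_exchange.
    apply: avg_le => // t.
    rewrite (@eq_avg _ _ _ (fun x => sparse eta a (z1 + p ((cube_vec d sigma + u t) + ivec x)))).
      apply: sp => // k; rewrite !ffunE; have := u_le t k; move: (u t k) => utk; lia.
    by move=> x; rewrite /X addrAC.
  apply: ler_avg => x; rewrite /gav.
  have := ind01 (z0 + p (X x)); rewrite -/(al x) => /andP[al0 al1].
  have gge : a * (1 - avg (fun t => sparse eta a (z1 + p (X x + u t)))) <=
      avg (fun t => g (z1 + p (X x + u t))).
    rewrite -{1}(avg_cst 1 I0) -avgB -avgZ; apply: ler_avg => t; exact: g_ge.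
  apply: le_trans (ler_wpM2l al0 gge).
  have sp0 : 0 <= avg (fun t => sparse eta a (z1 + p (X x + u t))).
    by apply: avg_ge0 => t; case/andP: (sparse01 eta a (z1 + p (X x + u t))).
  rewrite mulrBr mulr1 mulrBr [al x * a]mulrC lerD2l lerN2 ler_piMl //.
  by rewrite mulr_ge0 // ltW.
(* The average of the first indicator over a box of side [sigma] is nearly that of [g], which is at
   least [a] at the points that are not sparse. *)
have step5 : a - a * (a / 4) - a / 4 <= avg al.
  pose z0' := z0 + p (cube_vec d sigma).
  have alE : avg al = bavg p sigma ind z0'.
    by apply: eq_avg => x; rewrite /al /X raddfD addrA.
  have gE : bavg p sigma g z0' = avg (fun x => g (z0 + p (X x))).
    by apply: eq_avg => x; rewrite /X raddfD addrA.
  have cmp : `|bavg p sigma g z0' - avg al| <= a / 4.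
    apply: le_trans eta_small; rewrite alE /g bavgC.
    by apply: bavg_bavg => // z; apply: chi_norm => y; apply: ind01.
  have gge : a - a * (a / 4) <= bavg p sigma g z0'.
    rewrite gE; apply: (@le_trans _ _ (avg (fun x => a * (1 - sparse eta a (z0 + p (X x)))))).
      rewrite avgZ avgB avg_cst // mulrBr mulr1 lerD2l lerN2 ler_wpM2l ?(ltW a0) //.
      by apply: sp => // k; rewrite ffunE; lia.
    by apply: ler_avg => x; apply: g_ge.
  by move: cmp; rewrite ler_norml; lra.
have a2 : a * a <= a by rewrite ler_piMr // ltW.
have La : a ^+ 2 / 4 <= L.
  apply: le_trans step4.
  have : a * (a / 2) <= a * avg al by rewrite ler_wpM2l ?(ltW a0) //; lra.
  by rewrite expr2; lra.
have : (a ^+ 2 / 4) ^+ 2 <= L ^+ 2.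
  have a40 : 0 <= a ^+ 2 / 4 by rewrite divr_ge0 ?sqr_ge0.
  by rewrite ler_pXn2r // nnegrE //; apply: le_trans La.
have -> : (a ^+ 2 / 4) ^+ 2 = a ^+ 4 / 16 by field.
move: B_small L2; lra.
Qed.

End LocalPair.

Section ShellPair.
Variables (R : realType) (d : nat) (G : finZmodType).
Variables (p : {additive {ffun 'I_d -> int} -> G}) (S : {set G}).
Variables (e f : 'I_d) (w0 : {ffun 'I_d -> int}) (z0 : G).
Variables (N M zeta omega A' Cj Z sigma n eta : nat) (a theta kappa : R).
Let D : R := d%:R.
Let Delta := (M * zeta + A'.+1 + omega)%N.
Hypothesis fe : f != e.
Hypothesis (N0 : (0 < N)%N) (M0 : (0 < M)%N) (omega0 : (0 < omega)%N) (Cj0 : (0 < Cj)%N).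
Hypothesis (zeta0 : (0 < zeta)%N) (Z0 : (0 < Z)%N) (sigma0 : (0 < sigma)%N) (eta0 : (0 < eta)%N).
Hypothesis n3 : (3 * sigma = n.+1)%N.
Hypothesis kappa01 : 0 <= kappa <= 1.
Hypothesis kappa_ge : D * (2 * eta%:R / omega%:R) + D * (omega%:R / n.+1%:R) <= kappa.
Hypothesis H1 : (2 + 32 * D ^+ 2) * omega%:R * Z%:R * N%:R <= zeta%:R * A'.+1%:R.
Hypothesis H2 : 4 * (16 * D ^+ 2 * (2 + 16 * D ^+ 2)) * (A'.+1%:R + omega%:R + 1) * Z%:R <= zeta%:R.
Hypothesis H3 : 2 * ((32 * d + 2)%:R ^+ 2 + (32 * d + 2)%:R) * Z%:R * N%:R <= zeta%:R * Cj%:R :> R.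
Hypothesis H4 : 10 * Z%:R * N%:R <= zeta%:R * A'.+1%:R :> R.
Hypothesis H5 : (Z <= A'.+1)%N.
Hypothesis DeltaN : 32 * D ^+ 3 * (Delta%:R + 1) <= N%:R.
Hypothesis disp : 8 * D ^+ 2 * Delta%:R + 12 * D ^+ 2 + 1 + Cj%:R <= sigma%:R.
Hypothesis a01 : 0 < a <= 1.
Hypothesis theta_small : 3 ^+ d * theta <= a / 4.
Hypothesis eta_small : D * (2 * eta%:R / sigma%:R) <= a / 4.
Hypothesis B_small : 16 * (3 ^+ d * (M%:R^-1 + kappa + 5 / Z%:R)) < a ^+ 4.
Hypothesis w0N : `|enorm R w0 - N%:R| <= D.
Hypothesis w0e : N%:R <= 2 * D * (w0 e)%:~R.
Hypothesis sparse0 : avg (fun x : ibox d n.+1 => sparse p S eta a (z0 + p (ivec x))) <= theta.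
Hypothesis sparse1 : avg (fun x : ibox d n.+1 => sparse p S eta a (z0 + p w0 + p (ivec x))) <= theta.

Let I : finType := ('I_A'.+1 * ('I_M * (ibox d omega * 'I_Cj)))%type.
Let base (t : I) := shell_base f w0 zeta t.2.1 t.2.2.1 t.1.
Let v (t : I) := shell_vec R e f w0 N zeta t.2.1 t.2.2.1 t.1 t.2.2.2.

Let base_near (t : I) k : 0 <= base t k - w0 k <= Delta%:Z.
Proof.
case: t => a' [i [q j]]; rewrite /base /= !ffunE.
have := ltn_ord a'; have := ltn_ord (q k).
have : (i.+1 * zeta <= M * zeta)%N by rewrite leq_mul2r ltn_ord orbT.
rewrite mulSn /Delta; move: (nat_of_ord (q k)) (nat_of_ord a') (w0 k) (i * zeta)%N (M * zeta)%N.
by move=> qk a0 u iz Mz; case: ifP => _; clear; lia.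
Qed.

Let D1 : 1 <= D.
Proof. by rewrite /D -[1]/(1%:R) ler_nat; case: d e => // -[]. Qed.

Let Delta_sigma : (Delta <= sigma)%N.
Proof.
rewrite -(ler_nat R); apply: le_trans disp.
have D2 : 1 <= D ^+ 2 by rewrite exprn_ege1.
have h : 1 * Delta%:R <= D ^+ 2 * Delta%:R by rewrite ler_wpM2r.
by move: D2 h; have : 0 <= Cj%:R :> R := ler0n _ _; have : 0 <= Delta%:R :> R := ler0n _ _; lra.
Qed.

Let v_near (t : I) k : (`|v t k - w0 k| <= sigma)%N.
Proof.
have [->|ke] := eqVneq k e.
  have -> : v t e = Num.floor (cap (N%:R : R) e (base t)) + (t.2.2.2 : nat)%:Z.
    by rewrite /v /shell_vec !ffunE eqxx add0r.
  have cn := cap_near w0N w0e DeltaN (fun k => base_near t k).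
  rewrite -lez_nat abszE -(ler_int R) intr_norm rmorphB rmorphD /=.
  have jC : (t.2.2.2 : nat)%:R <= Cj%:R :> R by rewrite ler_nat ltnW.
  have j0 : 0 <= (t.2.2.2 : nat)%:R :> R by [].
  rewrite -[(_ : nat)%:~R]/((t.2.2.2 : nat)%:R : R) -[sigma%:~R]/(sigma%:R : R).
  have := floor_itv (cap (N%:R : R) e (base t)); rewrite intrD.
  move: cn disp; rewrite !ler_norml -/D; lra.
have -> : v t k = base t k by rewrite /v /shell_vec !ffunE (negbTE ke) addr0.
have := base_near t k; have := Delta_sigma.
by move: (base t k) (w0 k) (Delta) => b w D'; clear; lia.
Qed.

(** All [v t] are close to [w0], so [local_pair] applies with base points [z0] and [z0 + p w0] and
    displacements [v t - w0]. *)
Lemma shell_pair : exists z w, [/\ `|enorm R w - N%:R| <= Cj%:R, z \in S & z + p w \in S].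
Proof.
have cI : (0 < #|I|)%N.
  by rewrite /I !card_prod !card_ord !muln_gt0 M0 Cj0 card_ibox_gt0.
have good := good_cap_near w0N w0e DeltaN.
have avg_disc := avg_bavg_ldisc p (z0 + p w0) n (@ind01 R _ S) eta0 omega0.
have ldisc1 y : `|ldisc p (ind R S) (z0 + p w0) eta (n := n) y| <= 1.
  by apply: disc_norm => // z; apply: ind01.
have main := shell_average_small ldisc1 fe N0 M0 omega0 Cj0 zeta0 Z0 (leqnn _) good
  kappa01 (le_trans avg_disc kappa_ge) H1 H2 H3 H4 H5.
have [||Y [t [Y0 Y1]]] := local_pair (u := fun t => v t - w0) cI sigma0 eta0 n3 _ a01 _
  sparse0 sparse1 theta_small eta_small B_small.
- by move=> t k; have := v_near t k; rewrite !ffunE.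
- apply: le_trans main.
  (* Translating by [w0] passes from the displacements [v t] to [v t - w0]. *)
  rewrite -[leRHS](avg_shift _ (- torus n w0)); apply: ler_avg => y.
  rewrite le_eqVlt; apply/orP; left; apply/eqP; congr (_ ^+ 2).
  rewrite avg_pair; apply: eq_avg => a'; rewrite avg_pair; apply: eq_avg => i.
  rewrite avg_pair; apply: eq_avg => q; apply: eq_avg => j.
  by congr ldisc; rewrite raddfB /= addrA [_ - _]addrAC.
exists (z0 + p Y), (v t); split=> //.
  rewrite /v /shell_vec; apply: (enorm_shell DeltaN); first exact: ltn_ord.
  by apply: good => k; apply: base_near.
move: Y1; congr (_ \in S); rewrite raddfD raddfB; move: (p w0) (p Y) (p (v t)) => b c x.
by rewrite addrACA [b + _]addrC addrNK.
Qed.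

End ShellPair.

(** * Choice of the scales *)

Lemma ltn0_mul (x y : nat) : (0 < x)%N -> (0 < y)%N -> (0 < x * y)%N.
Proof. by move=> ? ?; rewrite muln_gt0; apply/andP. Qed.

Lemma other_ord d (e : 'I_d) : (2 <= d)%N -> exists f : 'I_d, f != e.
Proof.
case: d e => [|[|n]] // e _; case: (eqVneq e ord0) => [->|ne].
  by exists (lift ord0 ord0).
by exists ord0; rewrite eq_sym.
Qed.

Lemma choice_delta (Z zeta A omega : nat) : (omega <= A)%N -> (A <= zeta)%N ->
  (Z * zeta + A + omega <= (Z + 2) * zeta)%N.
Proof. nia. Qed.

Lemma choice_w2 (d Z P : nat) : (0 < P)%N -> (0 < d)%N ->
  (d * Z <= (2 + 32 * d ^ 2) * Z * P)%N /\ (10 * Z * P <= (2 + 32 * d ^ 2) * Z * P)%N.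
Proof.
move=> P0; case: d => // d _.
have h1 : (d.+1 <= 2 + 32 * d.+1 ^ 2)%N by rewrite -mulnn; nia.
have h2 : (10 <= 2 + 32 * d.+1 ^ 2)%N by rewrite -mulnn; nia.
split; last by rewrite !leq_mul.
by rewrite -[X in (X <= _)%N]muln1 !leq_mul.
Qed.

Lemma choice_slope (x w Z P z : nat) : (x * w * Z * (P * z) = z * (x * Z * P * w))%N.
Proof. ring. Qed.

Lemma choice_jitter (x Z P z : nat) : (2 * x * Z * (P * z) = z * (2 * x * Z * P))%N.
Proof. ring. Qed.

Lemma choice_step (K2 A omega Z : nat) : (0 < A)%N -> (omega <= A)%N ->
  (4 * K2 * (A + omega + 1) * Z <= 12 * K2 * Z * A)%N.
Proof.
move=> A0 wA; apply: (@leq_trans (4 * K2 * (3 * A) * Z)); last by rewrite (_ : (12 * K2 * Z * A = 4 * K2 * (3 * A) * Z)%N) //; ring.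
by rewrite leq_mul // leq_mul //; lia.
Qed.

Lemma choice_const (Z P z w2 w : nat) : (10 * Z * P <= w2)%N -> (0 < w)%N ->
  (10 * Z * (P * z) <= z * (w2 * w))%N.
Proof.
move=> h w0; rewrite mulnA mulnC leq_mul //; apply: leq_trans h _; exact: leq_pmulr.
Qed.

Lemma choice_good (d K Z zeta D1 : nat) : (3 * d <= K)%N -> (D1 <= (Z + 3) * zeta)%N ->
  (32 * d ^ 3 * D1 <= K * 3 * (8 * d ^ 2 * (Z + 2) + 1) * zeta)%N.
Proof.
move=> Kd D1z; apply: (@leq_trans (32 * d ^ 3 * ((Z + 3) * zeta))); first by rewrite leq_mul.
rewrite mulnA leq_mul //.
apply: (@leq_trans (3 * d * 3 * (8 * d ^ 2 * (Z + 2)))); last by rewrite !leq_mul // leq_addr.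
rewrite (_ : (3 * d * 3 * (8 * d ^ 2 * (Z + 2)) = 72 * d ^ 3 * (Z + 2))%N); last by rewrite !expnS; ring.
rewrite -!mulnA mulnCA [leqRHS]mulnCA leq_mul //; lia.
Qed.

Lemma choice_disp (d Z zeta Delta Cj : nat) : (Delta <= (Z + 2) * zeta)%N ->
  (1 + Cj + 12 * d ^ 2 <= zeta)%N ->
  (8 * d ^ 2 * Delta + 12 * d ^ 2 + 1 + Cj <= (8 * d ^ 2 * (Z + 2) + 1) * zeta)%N.
Proof.
move=> h1 h2; rewrite mulnDl mul1n -!addnA leq_add //; last by lia.
by rewrite -[(_ * (Z + 2) * _)%N]mulnA leq_mul.
Qed.

Section CorePair.
Variables (R : realType) (d : nat).
Hypothesis d2 : (2 <= d)%N.

(** All scales are multiples of [eta] with ratios depending only on [a], [d] and [K]. The jitter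
    range [Cj], and with it the tolerance [C], does not grow with [eta]. *)
Lemma core_pair_oriented (a : R) (K : nat) : 0 < a <= 1 -> (3 * d <= K)%N ->
  exists m C eta0 : nat, [/\ (0 < m)%N, (0 < eta0)%N &
  forall eta, (eta0 <= eta)%N ->
  forall (G : finZmodType) (p : {additive {ffun 'I_d -> int} -> G}) (S : {set G})
    (z0 : G) (w0 : {ffun 'I_d -> int}) (e : 'I_d) (theta : R),
    `|enorm R w0 - (K * (m * eta))%:R| <= d%:R ->
    (K * (m * eta))%:R <= 2 * d%:R * (w0 e)%:~R :> R ->
    3 ^+ d * theta <= a / 4 ->
    avg (fun x : ibox d (m * eta) => sparse p S eta a (z0 + p (ivec x))) <= theta ->
    avg (fun x : ibox d (m * eta) => sparse p S eta a (z0 + p w0 + p (ivec x))) <= theta ->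
    exists z w, [/\ `|enorm R w - (K * (m * eta))%:R| <= C%:R, z \in S & z + p w \in S]].
Proof.
move=> a01 Kd; case/andP: (a01) => a0 a1.
(* With [Z] arcs and [kappa = 2 / Z] the bound of [shell_average_small] is [8 / Z], whence
   [128 = 16 * 8]. *)
pose Z := (Num.truncn (128 * 3 ^+ d / a ^+ 4)).+1.
have Zlt : 128 * 3 ^+ d / a ^+ 4 < Z%:R by apply: truncnS_gt.
have Z0 : (0 < Z)%N by [].
have d0 : (0 < d)%N by apply: ltnW.
pose w4 := (8 * d ^ 2 * (Z + 2) + 1)%N.
pose K2 := (16 * d ^ 2 * (2 + 16 * d ^ 2))%N.
pose w3 := (12 * K2 * Z)%N.
pose P := (K * 3 * w4)%N.
pose w2 := ((2 + 32 * d ^ 2) * Z * P)%N.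
pose w1 := (2 * d * Z)%N.
pose c := (32 * d + 2)%N.
pose Cj := (2 * (c ^ 2 + c) * Z * P)%N.
pose eta0 := (1 + Cj + 12 * d ^ 2)%N.
have K0 : (0 < K)%N by apply: leq_trans Kd; rewrite muln_gt0.
have w40 : (0 < w4)%N by rewrite /w4 addn1.
have K20 : (0 < K2)%N by rewrite /K2 !muln_gt0 ?expn_gt0 ?d0.
have w30 : (0 < w3)%N by apply: ltn0_mul => //; apply: ltn0_mul.
have P0 : (0 < P)%N by apply: ltn0_mul => //; apply: ltn0_mul.
have w20 : (0 < w2)%N by apply: ltn0_mul => //; apply: ltn0_mul.
have w10 : (0 < w1)%N by apply: ltn0_mul => //; apply: ltn0_mul.
have c0 : (0 < c)%N by rewrite /c addn2.
have Cj0 : (0 < Cj)%N by do 3 (apply: ltn0_mul => //); rewrite addn_gt0 c0 orbT.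
exists (3 * w4 * w3 * w2 * w1)%N, Cj, eta0; split=> //.
  by do 4 (apply: ltn0_mul => //).
move=> eta eta_ge G p S z0 w0 e theta.
(* The scales increase in the order [eta], [omega], [A], [zeta], [sigma], with ratios [w1] to [w4];
   the length [N] is [P * zeta]. *)
pose omega := (w1 * eta)%N; pose A := (w2 * omega)%N; pose zeta := (w3 * A)%N.
pose sigma := (w4 * zeta)%N.
have eta00 : (0 < eta)%N by apply: leq_trans eta_ge; rewrite /eta0 !addSn.
have omega0 : (0 < omega)%N by exact: ltn0_mul.
have A0 : (0 < A)%N by exact: ltn0_mul.
have zeta0 : (0 < zeta)%N by exact: ltn0_mul.
have sigma0 : (0 < sigma)%N by exact: ltn0_mul.
have -> : (3 * w4 * w3 * w2 * w1 * eta = 3 * sigma)%N by rewrite /sigma /zeta /A /omega !mulnA.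
have n3 : (3 * sigma = (3 * sigma).-1.+1)%N by rewrite prednK //; apply: ltn0_mul.
have A'E : (A = A.-1.+1)%N by rewrite prednK.
set N := (K * (3 * sigma))%N.
have NE : N = (P * zeta)%N by rewrite /N /P /sigma !mulnA.
have N0 : (0 < N)%N by rewrite NE; apply: ltn0_mul.
move=> w0N w0e th; rewrite n3 => sp0 sp1.
have [f fe] := other_ord e d2.
have Z2 : 2 <= Z%:R :> R.
  apply: ltW; apply: le_lt_trans Zlt; rewrite ler_pdivlMr ?exprn_gt0 //.
  have : 1 <= 3 ^+ d :> R by rewrite exprn_ege1 //; lra.
  have : a ^+ 4 <= 1 by rewrite exprn_ile1 // ltW.
  lra.
have ZR : 0 < Z%:R :> R by lra.
have D0 : 0 < d%:R :> R by rewrite ltr0n.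
have cast (x y : nat) : (x <= y)%N -> x%:R <= y%:R :> R by rewrite ler_nat.
have Zinv : Z%:R^-1 <= a / 8.
  rewrite -[leLHS]mul1r ler_pdivrMr // mulrAC ler_pdivlMr //.
  rewrite -(ler_pM2r (exprn_gt0 3 a0)) -[a * _ * _]mulrAC -exprS [leRHS]mulrC.
  move: Zlt; rewrite ltr_pdivrMr ?exprn_gt0 // => Zlt'.
  apply: le_trans (ltW Zlt').
  have : 1 <= 3 ^+ d :> R by rewrite exprn_ege1 //; lra.
  have : a ^+ 3 <= 1 by rewrite exprn_ile1 // ltW.
  lra.
have omega_A : (omega <= A)%N by rewrite leq_pmull.
have A_zeta : (A <= zeta)%N by rewrite leq_pmull.
have zeta_eta : (eta0 <= zeta)%N.
  apply: leq_trans eta_ge _; apply: leq_trans A_zeta; apply: leq_trans omega_A.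
  by rewrite leq_pmull.
have Delta_zeta : (Z * zeta + A + omega <= (Z + 2) * zeta)%N.
  exact: choice_delta.
have E : Z%:R^-1 = d%:R * (2 * eta%:R / (w1 * eta)%:R) :> R.
  by rewrite natrM /w1 !natrM; field; rewrite !pnatr_eq0 -!lt0n eta00 d0 Z0.
have [dzw2 zpw2] := choice_w2 Z P0 d0.
apply: (@shell_pair R d G p S e f w0 z0 N Z zeta omega A.-1 Cj Z sigma _ eta a theta (2 / Z%:R)
  fe N0 Z0 omega0 Cj0 zeta0 Z0 sigma0 eta00 n3) => //.
- by apply/andP; split; [rewrite divr_ge0 // ltW | rewrite ler_pdivrMr ?mul1r].
- rewrite -n3 [leRHS](_ : _ = Z%:R^-1 + Z%:R^-1); last by ring.
  apply: lerD.
    by rewrite E.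
  rewrite -[leRHS]mul1r mulrA ler_pdivrMr; last by rewrite ltr0n muln_gt0.
  rewrite mulrAC ler_pdivlMr // mul1r -natrM -natrM ler_nat.
  apply: (@leq_trans (w2 * omega)); first by rewrite mulnAC leq_mul.
  apply: leq_trans A_zeta _; rewrite /sigma mulnA leq_pmull // muln_gt0 //.
- by rewrite -A'E -!(natrX, natrM, natrD) ler_nat NE choice_slope.
- rewrite -A'E -[1 in leLHS]/(1%:R) -!(natrX, natrM, natrD) ler_nat.
  exact: choice_step.
- by rewrite -!(natrX, natrM, natrD) ler_nat NE choice_jitter.
- by rewrite -A'E -!(natrX, natrM, natrD) ler_nat NE; apply: choice_const.
- rewrite -A'E; apply: leq_trans (leq_pmulr w2 omega0); apply: leq_trans dzw2.
  by rewrite leq_pmull.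
- rewrite -A'E -[1 in leLHS]/(1%:R) -!(natrX, natrM, natrD) ler_nat NE.
  apply: choice_good Kd _; have -> : ((Z + 3) * zeta = (Z + 2) * zeta + zeta)%N by ring.
  by rewrite leq_add.
- rewrite -A'E -[1 in leLHS]/(1%:R) -!(natrX, natrM, natrD) ler_nat.
  exact: choice_disp.
- apply: (@le_trans _ _ (Z%:R^-1)); last by lra.
  have ws : (w1 * eta <= sigma)%N.
    by apply: leq_trans omega_A _; apply: leq_trans A_zeta _; rewrite leq_pmull.
  by rewrite E ler_wpM2l // ler_wpM2l ?mulr_ge0 // lef_pV2 ?posrE ?ltr0n ?ler_nat //.
- rewrite (_ : 16 * _ = 128 * 3 ^+ d / Z%:R); last by ring.
  by rewrite ltr_pdivrMr // [ltRHS]mulrC -ltr_pdivrMr ?exprn_gt0.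
Qed.

(** Some coordinate of [w0] is large in absolute value; if it is negative, exchange the two base
    points and use [- w0]. *)
Lemma core_pair (a : R) (K : nat) : 0 < a <= 1 -> (3 * d <= K)%N ->
  exists m C eta0 : nat, [/\ (0 < m)%N, (0 < eta0)%N &
  forall eta, (eta0 <= eta)%N ->
  forall (G : finZmodType) (p : {additive {ffun 'I_d -> int} -> G}) (S : {set G})
    (z0 : G) (w0 : {ffun 'I_d -> int}) (theta : R),
    `|enorm R w0 - (K * (m * eta))%:R| <= d%:R ->
    3 ^+ d * theta <= a / 4 ->
    avg (fun x : ibox d (m * eta) => sparse p S eta a (z0 + p (ivec x))) <= theta ->
    avg (fun x : ibox d (m * eta) => sparse p S eta a (z0 + p w0 + p (ivec x))) <= theta ->
    exists z w, [/\ `|enorm R w - (K * (m * eta))%:R| <= C%:R, z \in S & z + p w \in S]].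
Proof.
move=> a01 Kd; have [m [C [eta0 [m0 eta00 H]]]] := core_pair_oriented a01 Kd.
exists m, C, eta0; split=> // eta eta_ge G p S z0 w0 theta w0N th sp0 sp1.
have H' := H eta eta_ge G p S.
set N : R := (K * (m * eta))%:R in w0N *.
have NK : 3 * d%:R <= N.
  rewrite /N -natrM ler_nat; apply: leq_trans Kd _; rewrite leq_pmulr // muln_gt0 m0.
  exact: leq_trans eta_ge.
have D0 : 0 <= d%:R :> R by [].
have [||e he] := @large_coord R d (N - d%:R) w0 _ _ (ltnW d2).
- lra.
- by move: w0N; rewrite ler_norml; lra.
have [pos|neg] := leP (0 : R) ((w0 e)%:~R).
  by apply: (H' z0 w0 e theta) => //; move: he; rewrite ger0_norm //; rewrite -/N; lra.
have [] := H' (z0 + p w0) (- w0) e theta => //.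
- by rewrite enormN.
- by move: he; rewrite ltr0_norm // !ffunE rmorphN /= -/N; lra.
- by rewrite raddfN addrK.
by move=> z [w h]; exists z, w.
Qed.

End CorePair.

(** * Adding one distance *)

(* The lattice point w stands for the vector [h w] of R^d; the tolerance [C h] absorbs the
   diameters of the cells of side [h]. *)
Definition grid_avoiding (R : realType) (d : nat) (C h : R) (D : R -> Prop) (G : finZmodType)
    (p : {ffun 'I_d -> int} -> G) (S : {set G}) : Prop :=
  forall w t, D t -> `|h * enorm R w - t| <= C * h -> forall z, z \in S -> z + p w \notin S.

Definition density (R : realType) (G : finType) (S : {set G}) : R := #|S|%:R / #|G|%:R.

Section Wrap.
Variables (R : realType) (d s l n : nat) (C h Delta : R) (D : R -> Prop) (P : {set ibox d s}).
Hypothesis h0 : 0 < h.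
Hypothesis Dle : forall t, D t -> t <= Delta.
Hypothesis lE : (s + l = n.+1)%N.
Hypothesis hl : Delta + C * h < h * l.+1%:R.
Hypothesis Pavoid : forall a b, a \in P -> b \in P ->
  forall t, D t -> ~ `|h * enorm R (ivec b - ivec a) - t| <= C * h.

Definition wrap_set : {set {ffun 'I_d -> 'I_n.+1}} := [set torus n (ivec x) | x in P].

Lemma ivec_torus_ivec (x : ibox d s) : ivec (torus n (ivec x)) = ivec x.
Proof. by apply: ivec_torus => k; rewrite ffunE /= ltz_nat -lE; apply: ltn_addr. Qed.

Lemma card_wrap_set : #|wrap_set| = #|P|.
Proof.
apply: card_in_imset => x y _ _ /(congr1 (@ivec d n.+1)); rewrite !ivec_torus_ivec => /ffunP xy.
by apply/ffunP => k; apply: val_inj; have := xy k; rewrite !ffunE => -[].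
Qed.

(** Either the difference of the two points is [w] itself, or [w] goes around the torus. In the
    second case a coordinate of [w] exceeds the padding [l], and [w] is too long for all distances
    in [D]. *)
Lemma grid_avoiding_wrap_set : grid_avoiding C h D (torus n) wrap_set.
Proof.
move=> w t Dt wt z /imsetP[a aP ->]; apply/negP => /imsetP[b bP E].
have u0 : torus n (ivec b - ivec a - w) = 0 by rewrite !raddfB /= -E [torus _ _ + _]addrC addrK subrr.
have [/forallP small|/forallPn[k big]] := boolP [forall k, (`|((ivec b - ivec a - w) k)%R| < n.+1)%N].
  have : ivec b - ivec a = w.
    apply/eqP; rewrite -subr_eq0; apply/eqP/ffunP => k.
    by rewrite [RHS]ffunE; apply: torus_eq0 u0 _; apply: small.
  by move=> abw; apply: (Pavoid aP bP Dt); rewrite abw.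
have wk : (l.+1 <= `|w k|)%N.
  move: big; rewrite -leqNgt -lE !ffunE; have := ltn_ord (a k); have := ltn_ord (b k).
  by move: (nat_of_ord (a k)) (nat_of_ord (b k)) (w k) => ak bk wk; clear; lia.
have : l.+1%:R <= enorm R w.
  apply: le_trans (coord_le_enorm _ w k); rewrite -intr_norm -abszE -[leRHS]/((`|w k|%N)%:R : R).
  by rewrite ler_nat.
rewrite -(ler_pM2l h0) => hw; have := Dle Dt; move: wt hl; rewrite ler_norml; lra.
Qed.

End Wrap.

Lemma density_avg (R : realType) (G : finZmodType) (S : {set G}) : density R S = avg (ind R S).
Proof. by rewrite /density -avg_ind. Qed.

Lemma markov_avg (R : realType) (G : finZmodType) (f : G -> R) (c : R) : 0 < c ->
  (forall z, 0 <= f z) -> density R [set z | c < f z] <= avg f / c.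
Proof.
move=> c0 f0; rewrite ler_pdivlMr // density_avg -avgZr; apply: ler_avg => z.
rewrite /ind inE; case: ltP => h; rewrite ?mul1r ?mul0r //; exact: ltW.
Qed.

Section LocalDensity.
Variables (R : realType) (d : nat) (mD Delta : R) (D : R -> Prop).
Hypothesis mD_bound : forall (h : R) (G : finZmodType) (p : {additive {ffun 'I_d -> int} -> G})
  (S : {set G}), 0 < h -> grid_avoiding d%:R h D p S -> density R S <= mD.
Hypothesis Dle : forall t, D t -> t <= Delta.

(** The part of [S] seen in one box of side [s], wrapped with padding [l], is again a model for [D];
    the last factor is the ratio of the volumes. *)
Lemma bavg_ind_le (C h : R) (G : finZmodType) (p : {additive {ffun 'I_d -> int} -> G})
    (S : {set G}) (s l : nat) z : 0 < h -> d%:R <= C -> grid_avoiding C h D p S -> (0 < s)%N ->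
  Delta + d%:R * h < h * l.+1%:R ->
  bavg p s (ind R S) z <= mD * (1 + l%:R / s%:R) ^+ d.
Proof.
move=> h0 dC admS s0 hl.
have [n nE] : exists n, (s + l = n.+1)%N by exists (s + l).-1; rewrite prednK // addn_gt0 s0.
pose P : {set ibox d s} := [set x | z + p (ivec x) \in S].
have Pav a b : a \in P -> b \in P ->
    forall t, D t -> ~ `|h * enorm R (ivec b - ivec a) - t| <= d%:R * h.
  rewrite !inE => aP bP t Dt le; have := admS (ivec b - ivec a) t Dt.
  move/(_ (le_trans le (ler_wpM2r (ltW h0) dC)) _ aP)/negP; apply.
  by rewrite raddfB addrA -[z + _ + _]addrA [p (ivec a) + _]addrC addrA addrK.
have := mD_bound h0 (grid_avoiding_wrap_set h0 Dle nE hl Pav).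
rewrite /density (card_wrap_set P nE) (card_ibox d n.+1) -nE => le.
have -> : bavg p s (ind R S) z = #|P|%:R / (s ^ d)%:R.
  rewrite -(card_ibox d s) -avg_ind; apply: eq_avg => x; by rewrite inE.
have sR : 0 < s%:R :> R by rewrite ltr0n.
have -> : (1 + l%:R / s%:R) ^+ d = ((s + l) ^ d)%:R / (s ^ d)%:R :> R.
  rewrite !natrX -expr_div_n; congr (_ ^+ d); rewrite natrD mulrDl divff // gt_eqF //.
rewrite mulrA ler_wpM2r ?invr_ge0 //.
by move: le; rewrite ler_pdivrMr // ltr0n expn_gt0 addn_gt0 s0.
Qed.

End LocalDensity.

(** * Energies of averages and level sets *)

Section Energy.
Variables (R : realType) (d : nat) (G : finZmodType) (p : {additive {ffun 'I_d -> int} -> G}).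

(** Averaging along the reflected map is the adjoint of averaging along [p]. *)
Definition oppm : {additive {ffun 'I_d -> int} -> G} := p \o -%R.

Lemma bavg_adjoint n (f g : G -> R) :
  avg (fun z => f z * bavg oppm n g z) = avg (fun z => bavg p n f z * g z).
Proof.
rewrite (@eq_avg _ _ _ (fun z => avg (fun x : ibox d n => f z * g (z + oppm (ivec x))))); last first.
  by move=> z; rewrite -avgZ.
rewrite [RHS](@eq_avg _ _ _ (fun z => avg (fun x : ibox d n => f (z + p (ivec x)) * g z))); last first.
  by move=> z; rewrite -avgZr.
rewrite [LHS]avg_exchange [RHS]avg_exchange; apply: eq_avg => x.
rewrite -[LHS](avg_shift _ (p (ivec x))); apply: eq_avg => z.
by rewrite /oppm /= raddfN addrK.
Qed.

(** For the averaging operator [T] with adjoint [T'], the left side is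
    [|g|^2 - 2 |T g|^2 + |T' T g|^2], and [T'] is a contraction. *)
Lemma energy_gap n (g : G -> R) : (0 < n)%N ->
  avg (fun z => (g z - bavg oppm n (bavg p n g) z) ^+ 2) <=
  avg (fun z => g z ^+ 2) - avg (fun z => bavg p n g z ^+ 2).
Proof.
move=> n0; set f := bavg oppm n _.
rewrite (@eq_avg _ _ _ (fun z => g z ^+ 2 - 2 * (g z * f z) + f z ^+ 2)); last by move=> z; ring.
rewrite avgD avgB avgZ /f bavg_adjoint.
have := bavg_sqr_le oppm (bavg p n g) n0.
rewrite (@eq_avg _ _ (fun z => bavg p n g z * bavg p n g z) (fun z => bavg p n g z ^+ 2)) //.
lra.
Qed.

Lemma pigeonhole_increment (e : nat -> R) (J : nat) : (0 < J)%N ->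
  0 <= e 0%N -> e J <= 1 -> exists2 i, (i < J)%N & e i.+1 - e i <= J%:R^-1.
Proof.
move=> J0 e0 eJ; apply: contrapT => H.
have lt i : (i < J)%N -> J%:R^-1 < e i.+1 - e i.
  by move=> iJ; rewrite ltNge; apply/negP => h; apply: H; exists i.
have : \sum_(i < J) (J%:R^-1 : R) < \sum_(i < J) (e i.+1 - e i).
  apply: ltr_sum => [|i _]; last exact: lt.
  by apply/hasP; exists (Ordinal J0); rewrite ?mem_index_enum.
rewrite -(big_mkord xpredT (fun i => e i.+1 - e i)) telescope_sumr // sumr_const card_ord.
rewrite -[_ *+ J]mulr_natr mulVf ?pnatr_eq0 -?lt0n //; lra.
Qed.

End Energy.

Lemma expr1D_le (R : realFieldType) (x : R) (n : nat) : 0 <= x <= 1 ->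
  (1 + x) ^+ n <= 1 + 3 ^+ n * x.
Proof.
move=> /andP[x0 x1]; elim: n => [|n IH]; first by rewrite !expr0 mul1r lerDl.
rewrite exprSr; apply: le_trans (ler_wpM2r _ IH) _; first by rewrite addr_ge0.
have h1 : 1 <= 3 ^+ n :> R by rewrite exprn_ege1 //; lra.
rewrite exprS; move: (3 ^+ n) h1 => y h1.
have h2 : y * x * x <= y * x by rewrite ler_piMr // mulr_ge0 //; lra.
have h3 : x <= y * x by rewrite ler_peMl.
lra.
Qed.

Section Level.
Variables (R : realType) (d : nat) (mD m1 eps : R).
Hypothesis m1_bound : forall (h : R) (G : finZmodType) (p : {additive {ffun 'I_d -> int} -> G})
  (S : {set G}), 0 < h -> grid_avoiding d%:R h (fun t => t = 1) p S -> density R S <= m1.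
Hypothesis mD01 : 0 <= mD <= 1.
Hypothesis m101 : 0 <= m1 <= 1.
Hypothesis eps01 : 0 < eps <= 1.
(** Near a point of [{f > eps / 8}], every sparse point contributes at least [a ^ 2] to the square
    of [g - f]. The level [gamma'] makes the proportion of such points small enough for [core], and
    [gamma] makes the exceptional set have density at most [eps / 8]. *)
Let a := eps / 32.
Let gamma' := a ^+ 3 / (4 * 3 ^+ d).
Let gamma := gamma' * (eps / 8).
Variables (G : finZmodType) (p : {additive {ffun 'I_d -> int} -> G}) (S : {set G}).
Variables (s rho eta N : nat) (C : R).
Hypothesis (s0 : (0 < s)%N) (rho0 : (0 < rho)%N) (eta0 : (0 < eta)%N) (N0 : (0 < N)%N).
Hypothesis core : forall z0 w0 (theta : R), `|enorm R w0 - N%:R| <= d%:R -> 3 ^+ d * theta <= a / 4 ->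
  avg (fun x : ibox d rho => sparse p S eta a (z0 + p (ivec x))) <= theta ->
  avg (fun x : ibox d rho => sparse p S eta a (z0 + p w0 + p (ivec x))) <= theta ->
  exists z w, [/\ `|enorm R w - N%:R| <= C, z \in S & z + p w \in S].
Hypothesis avoid : forall w, `|enorm R w - N%:R| <= C -> forall z, z \in S -> z + p w \notin S.
Hypothesis local_le : forall z, bavg p s (ind R S) z <= mD + eps / 8.
Let energy n : R := avg (fun z => bavg p n (ind R S) z ^+ 2).
Hypothesis gap : energy eta - energy s <= gamma / 2.
Hypothesis eta_s : 4 * (d%:R * (eta%:R / s%:R)) <= gamma / 2.
Hypothesis rho_s : d%:R * (2 * rho%:R / s%:R) <= eps / 16.

Let chi := ind R S.
Let g := bavg p eta chi.
Let k := bavg p s g.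
Let f := bavg (oppm p) s k.

Let a0 : 0 < a. Proof. by case/andP: eps01 => e0 _; rewrite divr_gt0. Qed.
Let gamma'0 : 0 < gamma'.
Proof. by rewrite divr_gt0 ?exprn_gt0 // mulr_gt0 // exprn_gt0. Qed.

Let g01 z : 0 <= g z <= 1. Proof. by apply: bavg01 => // y; apply: ind01. Qed.

Let k0 z : 0 <= k z. Proof. by apply: bavg_ge => // y; case/andP: (g01 y). Qed.

Let k_le z : k z <= mD + eps / 8.
Proof. by rewrite /k /g bavgC; apply: bavg_le. Qed.

Let f0 z : 0 <= f z. Proof. by apply: bavg_ge. Qed.
Let f_le z : f z <= mD + eps / 8. Proof. by apply: bavg_le. Qed.

Let avg_f : avg f = density R S.
Proof. by rewrite /f /k /g !avg_bavg // density_avg. Qed.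

Let f_shift (x : ibox d rho) z : `|f (z + p (ivec x)) - f z| <= eps / 16.
Proof.
apply: le_trans rho_s; have -> : f z = f (z + p (ivec x) + oppm p (ivec x)).
  by rewrite /oppm /= raddfN addrK.
rewrite distrC; apply: bavg_shift => // [y|i]; last exact: ivec_bound.
by apply: bavg_norm_le => // y'; have := g01 y'; rewrite ler_norml; lra.
Qed.

Let gf2 z : R := (g z - f z) ^+ 2.

Let avg_gf2 : avg gf2 <= gamma.
Proof.
apply: le_trans (energy_gap p g s0) _; rewrite -/k.
have : energy s - avg (fun z => k z ^+ 2) <= 4 * (d%:R * (eta%:R / s%:R)).
  rewrite /energy -avgB; apply: avg_le => [|z]; first exact: cardG_gt0.
  have c01 : 0 <= bavg p s chi z <= 1 by apply: bavg01 => // y; apply: ind01.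
  have k1 : k z <= 1 by apply: bavg_le => // y; case/andP: (g01 y).
  have := bavg_bavg p z eta0 s0 (fun y => chi_norm (@ind01 R _ S) y); rewrite bavgC -/chi -/g -/k.
  have kk := k0 z.
  rewrite subr_sqr => cmp.
  have cmp' : `|bavg p s chi z - k z| <= 2 * (d%:R * (eta%:R / s%:R)).
    by rewrite distrC; apply: le_trans cmp _; rewrite le_eqVlt; apply/orP; left; apply/eqP; ring.
  apply: le_trans (ler_norm _) _; rewrite normrM.
  rewrite [leRHS](_ : _ = 2 * (d%:R * (eta%:R / s%:R)) * 2); last by ring.
  by apply: ler_pM => //; rewrite ger0_norm ?addr_ge0 //; case/andP: c01 => ? ?; lra.
have : energy eta = avg (fun z => g z ^+ 2) by [].
move: gap eta_s; lra.
Qed.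

Let F : {set G} := [set z | eps / 8 < f z].
(** Exceptional points, around which [g] and [f] are not close at scale [rho]. *)
Let Bd : {set G} := [set z | gamma' < bavg p rho gf2 z].

Let densF : density R S - eps / 8 <= (mD + eps / 8) * density R F.
Proof.
rewrite -avg_f -{1}(avg_cst (eps / 8) (cardG_gt0 G)) -avgB density_avg -avgZ.
apply: ler_avg => z; rewrite /ind inE; case: ltP => h.
  by rewrite /= mulr1; have := f_le z; case/andP: eps01 => e0 _; lra.
by rewrite /= mulr0 subr_le0.
Qed.

Let densBd : density R Bd <= eps / 8.
Proof.
apply: le_trans (markov_avg gamma'0 _) _.
  by move=> z; apply: bavg_ge => // y; apply: sqr_ge0.
by rewrite avg_bavg // ler_pdivrMr //; apply: le_trans avg_gf2 _; rewrite /gamma mulrC.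
Qed.

Let sparse_le z : z \in F :\: Bd ->
  avg (fun x : ibox d rho => sparse p S eta a (z + p (ivec x))) <= gamma' / a ^+ 2.
Proof.
rewrite !inE -leNgt => /andP[zB zF].
apply: (@le_trans _ _ (bavg p rho gf2 z / a ^+ 2)); last first.
  by rewrite ler_wpM2r // invr_ge0 sqr_ge0.
rewrite /bavg -avgZr; apply: ler_avg => x.
have := f_shift x z; set y := z + p (ivec x) => ivec.
rewrite /sparse -/chi -/(g y); case: ltP => h /=; last first.
  by rewrite mulr_ge0 ?invr_ge0 ?sqr_ge0.
rewrite ler_pdivlMr ?exprn_gt0 // mul1r /gf2 -[leRHS]sqrrN opprB.
(* Here [f y > eps / 8 - eps / 16] and [g y < eps / 32]. *)
have le : a <= f y - g y by move: ivec h zF; rewrite /a ler_norml; lra.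
by rewrite ler_pXn2r ?nnegrE ?(ltW a0) //; apply: le_trans le; apply: ltW.
Qed.

Let densD : density R F - density R Bd <= density R (F :\: Bd).
Proof.
rewrite !density_avg -avgB; apply: ler_avg => z; rewrite /ind !inE.
by case: (_ < _); case: (_ < _) => /=; lra.
Qed.

(** Otherwise [F] without [Bd] has density above [m1], hence is no model for [{1}] at mesh [1 / N]:
    two of its points differ by a vector of length about [N]. Around both of them few points are
    sparse, and [core] yields a pair in [S] that [avoid] excludes. *)
Lemma level_density : density R S <= mD * m1 + eps.
Proof.
rewrite leNgt; apply/negP => big; case/andP: (eps01) => e0 e1.
case/andP: (mD01) => D0 D1; case/andP: (m101) => m0 m1'.
have dF : m1 + eps / 8 < density R F.
  rewrite ltNge; apply/negP => le.
  have pos : 0 <= mD + eps / 8 by lra.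
  have := ler_wpM2l pos le; have := densF.
  have e2 : eps * eps <= eps by rewrite ler_piMr // ltW.
  have h1 : mD * eps <= eps by rewrite ler_piMl // ltW.
  have h2 : eps * m1 <= eps by rewrite ler_piMr // ltW.
  lra.
have dC : m1 < density R (F :\: Bd) by move: densD densBd; lra.
have N0R : 0 < N%:R :> R by rewrite ltr0n.
have : ~ grid_avoiding d%:R N%:R^-1 (fun t : R => t = 1) p (F :\: Bd).
  move=> H; have := m1_bound _ H; rewrite invr_gt0 => /(_ N0R); rewrite leNgt dC //.
apply => w t -> wt z zC; apply/negP => zwC.
have wN : `|enorm R w - N%:R| <= d%:R.
  move: wt; rewrite (_ : N%:R^-1 * enorm R w - 1 = (enorm R w - N%:R) / N%:R); last first.
    by field; rewrite gt_eqF.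
  by rewrite normrM normfV [`|N%:R|]gtr0_norm // ler_pM2r // invr_gt0.
have th : 3 ^+ d * (gamma' / a ^+ 2) <= a / 4.
  rewrite le_eqVlt; apply/orP; left; apply/eqP; rewrite /gamma'; field.
  by rewrite gt_eqF //= gt_eqF // exprn_gt0.
have [z' [w' [le zS]]] := core wN th (sparse_le zC) (sparse_le zwC).
by apply/negP; apply: avoid.
Qed.

End Level.

Lemma nat_above (R : realType) (x : R) : exists n : nat, x <= n%:R.
Proof. by exists (Num.truncn x).+1; apply: ltW; apply: truncnS_gt. Qed.

Lemma ler_div_swap (R : realFieldType) (x y z : R) : 0 < y -> 0 < z -> x / y <= z -> x / z <= y.
Proof. by move=> y0 z0; rewrite !ler_pdivrMr // mulrC. Qed.

Section Step.
Variables (R : realType) (d : nat) (mD m1 Delta : R) (D : R -> Prop).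
Hypothesis d2 : (2 <= d)%N.
Hypothesis m1_bound : forall (h : R) (G : finZmodType) (p : {additive {ffun 'I_d -> int} -> G})
  (S : {set G}), 0 < h -> grid_avoiding d%:R h (fun t => t = 1) p S -> density R S <= m1.
Hypothesis mD_bound : forall (h : R) (G : finZmodType) (p : {additive {ffun 'I_d -> int} -> G})
  (S : {set G}), 0 < h -> grid_avoiding d%:R h D p S -> density R S <= mD.
Hypothesis Dle : forall t, D t -> t <= Delta.
Hypothesis Delta0 : 0 <= Delta.
Hypothesis mD01 : 0 <= mD <= 1.
Hypothesis m101 : 0 <= m1 <= 1.

(** The length [t] is [N = P * eta] grid units. Pigeonhole on the energies at the decreasing scales
    [sc 0], ..., [sc J] selects two consecutive ones for [level_density]; [t0] makes the distances
    in [D] short against all scales, so that local densities are at most about [mD]. *)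
Lemma discrete_step (eps : R) : 0 < eps <= 1 ->
  exists (t0 C : R) (P : nat), [/\ 0 < t0, (0 < P)%N & forall t, t0 <= t ->
   exists eta0 : nat, forall eta, (eta0 <= eta)%N -> (0 < eta)%N ->
   forall (G : finZmodType) (p : {additive {ffun 'I_d -> int} -> G}) (S : {set G}),
   grid_avoiding C (t / (P * eta)%:R) (fun u => D u \/ u = t) p S -> density R S <= mD * m1 + eps].
Proof.
move=> eps01; case/andP: (eps01) => e0 e1.
pose a : R := eps / 32.
have a0 : 0 < a by rewrite divr_gt0.
have a01 : 0 < a <= 1 by rewrite a0 /a; lra.
pose gamma : R := a ^+ 3 / (4 * 3 ^+ d) * (eps / 8).
have g0 : 0 < gamma by rewrite mulr_gt0 ?divr_gt0 ?exprn_gt0 // mulr_gt0 // exprn_gt0.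
have [w wP] := nat_above (2 * d%:R / (eps / 16) + 4 * d%:R / (gamma / 2)).
(* The summand [3 * d] provides the lower bound on [K] in [core_pair]. *)
pose w5 := (w + 3 * d)%N.
have d0 : (0 < d)%N by apply: ltnW.
have D0 : 0 < d%:R :> R by rewrite ltr0n.
have [e0' g0'] := (ltW e0, ltW g0).
have w50 : (0 < w5)%N by rewrite addn_gt0 muln_gt0 d0 orbT.
have w5R : 0 < w5%:R :> R by rewrite ltr0n.
have ww5 : w%:R <= w5%:R :> R by rewrite ler_nat leq_addr.
have wa0 : 0 <= 2 * d%:R / (eps / 16) by rewrite divr_ge0 ?mulr_ge0 ?invr_ge0.
have wb0 : 0 <= 4 * d%:R / (gamma / 2).
  by apply: divr_ge0; [rewrite mulr_ge0 | apply: divr_ge0].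
have w5a : 2 * d%:R / w5%:R <= eps / 16.
  by apply: ler_div_swap => //; [rewrite divr_gt0 | apply: le_trans ww5; apply: le_trans wP; rewrite lerDl].
have w5b : 4 * d%:R / w5%:R <= gamma / 2.
  by apply: ler_div_swap => //; [rewrite divr_gt0 | apply: le_trans ww5; apply: le_trans wP; rewrite lerDr].
have [J' J'P] := nat_above (1 / (gamma / 2)); pose J := J'.+1.
have Jg : J%:R^-1 <= gamma / 2.
  rewrite -[leLHS]mul1r; apply: ler_div_swap; rewrite ?divr_gt0 //.
  by apply: le_trans J'P _; rewrite ler_nat.
have /choice[q qP] : forall K, exists q : nat * nat * nat, (3 * d <= K)%N ->
  [/\ (0 < q.1.1)%N, (0 < q.2)%N &
  forall eta, (q.2 <= eta)%N ->
  forall (G : finZmodType) (p : {additive {ffun 'I_d -> int} -> G}) (S : {set G})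
    (z0 : G) (w0 : {ffun 'I_d -> int}) (theta : R),
    `|enorm R w0 - (K * (q.1.1 * eta))%:R| <= d%:R ->
    3 ^+ d * theta <= a / 4 ->
    avg (fun x : ibox d (q.1.1 * eta) => sparse p S eta a (z0 + p (ivec x))) <= theta ->
    avg (fun x : ibox d (q.1.1 * eta) => sparse p S eta a (z0 + p w0 + p (ivec x))) <= theta ->
    exists z w, [/\ `|enorm R w - (K * (q.1.1 * eta))%:R| <= q.1.2%:R, z \in S & z + p w \in S]].
  move=> K; case: (leqP (3 * d) K) => [Kd|]; last by exists (0, 0, 0)%N.
  by have [m [C [eta0 H]]] := core_pair d2 a01 Kd; exists (m, C, eta0).
(* In [core_pair] the length is [K * (m * eta)] with [m] depending on [K]. As [kk i] is [N / sc i],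
   the value [K = kk i * w5] is known before the next scale, and the next ratio is [w5 * m]. *)
pose kk i := iter i (fun k => k * (w5 * (q (k * w5)%N).1.1))%N 1%N.
pose r i := (w5 * (q (kk i * w5)%N).1.1)%N.
have kkS i : kk i.+1 = (kk i * r i)%N by [].
have kk0 i : (0 < kk i)%N.
  elim: i => // i IH; rewrite kkS; apply: ltn0_mul => //; apply: ltn0_mul => //.
  have Kd : (3 * d <= kk i * w5)%N by rewrite -[X in (X <= _)%N]mul1n leq_mul // leq_addl.
  by have [] := qP _ Kd.
have kd i : (3 * d <= kk i * w5)%N by rewrite -[X in (X <= _)%N]mul1n leq_mul // leq_addl.
have r0 i : (0 < r i)%N by apply: ltn0_mul => //; have [] := qP _ (kd i).
have kkE i : kk i = \prod_(0 <= j < i) r j.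
  by elim: i => [|i IH]; [rewrite big_geq | rewrite big_nat_recr //= -IH -kkS].
(* The selected scale is not known in advance, so the tolerance covers all of them. *)
pose C : R := d%:R + \sum_(i < J) (q (kk i * w5)%N).1.2%:R.
pose P := kk J.
(* A bound for the relative padding [l / sc i]: one half is for [Delta], the other for the tolerance
   [d]. *)
pose x0 : R := eps / 8 / 3 ^+ d.
have x00 : 0 < x0 by rewrite !divr_gt0 // exprn_gt0.
have x01 : x0 <= 1.
  rewrite /x0 ler_pdivrMr ?exprn_gt0 // mul1r; have : 1 <= 3 ^+ d :> R by rewrite exprn_ege1 //; lra.
  lra.
pose t0 : R := P%:R * Delta / (x0 / 2) + 1.
have t00 : 0 < t0.
  by apply: ltr_wpDl => //; apply: divr_ge0; [rewrite !mulr_ge0 | rewrite divr_ge0 // ltW].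
exists t0, C, P; split=> //; first exact: kk0.
move=> t t0t.
have tpos : 0 < t by apply: lt_le_trans t0t.
have [eta1 eta1P] := nat_above (d%:R / (x0 / 2)).
pose eta0 := (eta1 + \sum_(i < J) (q (kk i * w5)%N).2)%N.
exists eta0 => eta eta_ge eta00 G p S admS.
pose sc i := (eta * \prod_(i <= j < J) r j)%N.
have scS i : (i < J)%N -> sc i = (w5 * ((q (kk i * w5)%N).1.1 * sc i.+1))%N.
  by move=> iJ; rewrite /sc big_ltn // /r !mulnA; congr (_ * _)%N; ring.
have sc_eta i : (eta <= sc i)%N.
  by rewrite leq_pmulr // prodn_gt0.
have kksc i : (i <= J)%N -> (kk i * sc i = P * eta)%N.
  move=> iJ; rewrite /sc mulnC -mulnA mulnC; congr (_ * _)%N.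
  by rewrite kkE mulnC -big_cat_nat // -kkE.
set N := (P * eta)%N in admS *.
have N0 : (0 < N)%N by apply: ltn0_mul => //; apply: kk0.
have NR : 0 < N%:R :> R by rewrite ltr0n.
have h0 : 0 < t / N%:R by rewrite divr_gt0.
pose e i : R := avg (fun z => bavg p (sc i) (ind R S) z ^+ 2).
have sc0 i : (0 < sc i)%N by apply: leq_trans (sc_eta i).
have [] := @pigeonhole_increment R e J isT.
- by apply: avg_ge0 => z; apply: sqr_ge0.
- apply: avg_le => [|z]; first exact: cardG_gt0.
  have /andP[b0 b1] := bavg01 p (@ind01 R _ S) z (sc0 J).
  by rewrite exprn_ile1.
move=> i iJ gap.
have Ksc : (kk i * w5 * ((q (kk i * w5)%N).1.1 * sc i.+1) = N)%N.
  by rewrite -mulnA -scS // kksc // ltnW.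
have [m0 q0 core] := qP _ (kd i).
have Ci : (q (kk i * w5)%N).1.2%:R <= C.
  by rewrite /C (bigD1 (Ordinal iJ)) //= addrCA lerDl addr_ge0 // sumr_ge0.
have dC : d%:R <= C by rewrite /C lerDl sumr_ge0.
apply: (@level_density R d mD m1 eps m1_bound mD01 m101 eps01 G p S (sc i)
  ((q (kk i * w5)%N).1.1 * sc i.+1)%N (sc i.+1) N (q (kk i * w5)%N).1.2%:R) => //.
- exact: ltn0_mul.
- move=> z0 w0 theta; rewrite -Ksc; apply: core.
  apply: leq_trans (sc_eta _); apply: leq_trans eta_ge; rewrite /eta0 (bigD1 (Ordinal iJ)) //=.
  by rewrite addnCA leq_addr.
- move=> w0 w0N z zS; apply: admS (or_intror erefl) _ z zS.
  have -> : t / N%:R * enorm R w0 - t = (enorm R w0 - N%:R) * (t / N%:R).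
    by field; rewrite gt_eqF.
  rewrite normrM [`|t / _|]gtr0_norm // ler_wpM2r ?(ltW h0) //.
  exact: le_trans Ci.
- move=> z; pose l := Num.truncn (Delta / (t / N%:R) + d%:R).
  have pos : 0 <= Delta / (t / N%:R) + d%:R by rewrite addr_ge0 // divr_ge0 // ltW.
  have /andP[l1 l2] := truncn_itv pos.
  have admD : grid_avoiding C (t / N%:R) D p S by move=> w' u Du; apply: admS; left.
  have hl : Delta + d%:R * (t / N%:R) < t / N%:R * l.+1%:R.
    move: l2; rewrite -(ltr_pM2l h0); apply: le_lt_trans.
    rewrite -/l le_eqVlt; apply/orP; left; apply/eqP.
    by move: (t / N%:R) h0 => y y0; field; rewrite gt_eqF.
  case/andP: (mD01) => mD0 mD1.
  apply: le_trans (bavg_ind_le mD_bound Dle z h0 dC admD (sc0 i) hl) _.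
  have scR : 0 < (sc i)%:R :> R by rewrite ltr0n.
  have NE : N%:R = (kk i)%:R * (sc i)%:R :> R by rewrite -natrM kksc // ltnW.
  have kP : (kk i <= P)%N.
    by rewrite -(leq_pmul2r (sc0 i)) kksc ?(ltnW iJ) // leq_mul.
  have x02 : 0 < x0 / 2 by rewrite divr_gt0.
  have b1 : P%:R * Delta / t <= x0 / 2.
    by apply: ler_div_swap => //; apply: le_trans t0t; rewrite /t0 lerDl.
  have b2 : d%:R / (sc i)%:R <= x0 / 2.
    apply: ler_div_swap => //; apply: le_trans eta1P _; rewrite ler_nat.
    by apply: leq_trans (sc_eta i); apply: leq_trans eta_ge; apply: leq_addr.
  have b3 : Delta / (t / N%:R) / (sc i)%:R <= P%:R * Delta / t.
    rewrite (_ : _ / _ / _ = (kk i)%:R * Delta / t); last first.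
      by rewrite NE; field; rewrite !gt_eqF // ltr0n.
    by rewrite ler_wpM2r ?invr_ge0 ?(ltW tpos) // ler_wpM2r // ler_nat.
  have lx : 0 <= (l%:R / (sc i)%:R : R) <= x0.
    apply/andP; split; first by rewrite divr_ge0.
    apply: le_trans (_ : _ <= (Delta / (t / N%:R) + d%:R) / (sc i)%:R) _.
      by rewrite ler_wpM2r ?invr_ge0.
    by rewrite mulrDl; lra.
  case/andP: lx => lx0 lx1.
  have := @expr1D_le R (l%:R / (sc i)%:R) d; rewrite lx0 (le_trans lx1 x01) => /(_ isT) h1.
  have h2 : 3 ^+ d * (l%:R / (sc i)%:R) <= eps / 8.
    apply: le_trans (ler_wpM2l _ lx1) _; first exact: exprn_ge0.
    by rewrite /x0 mulrC divfK // gt_eqF // exprn_gt0.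
  have := ler_wpM2l mD0 h1; have := ler_wpM2l mD0 h2.
  have h3 : mD * (eps / 8) <= eps / 8 by rewrite ler_piMl // divr_ge0.
  lra.
- by apply: le_trans Jg; apply: le_trans gap _.
- apply: le_trans w5b; rewrite -mulrA ler_wpM2l // ler_wpM2l //.
  rewrite ler_pdivrMr ?ltr0n // mulrC ler_pdivlMr // -natrM ler_nat (scS i iJ) mulnC.
  by rewrite leq_mul // leq_pmull.
- apply: le_trans w5a; rewrite (scS i iJ) natrM.
  rewrite le_eqVlt; apply/orP; left; apply/eqP; field.
  by rewrite !pnatr_eq0 -!lt0n m0 w50 sc0.
Qed.

End Step.

From mathcomp Require Import all_classical all_reals all_analysis measurable_realfun.
Import numFieldNormedType.Exports.
Local Open Scope classical_set_scope.
Local Open Scope ring_scope.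

(** * Lebesgue outer measure *)

Section BoxVolume.
Variables (R : realType) (d : nat).
Implicit Types (ab : 'rV[R]_d * 'rV[R]_d) (x : 'rV[R]_d).

Definition vol ab : R := \prod_(i < d) (ab.2 ord0 i - ab.1 ord0 i).

Definition ordered_box ab : Prop := forall i : 'I_d, ab.1 ord0 i <= ab.2 ord0 i.

Lemma vol_ge0 ab : ordered_box ab -> 0 <= vol ab.
Proof. by move=> o; apply: prodr_ge0 => i _; rewrite subr_ge0. Qed.

(* The indicator of a box, with the first j coordinates integrated out. *)
Definition partvol ab (j : nat) x : R := \prod_(l < d)
  (if (l < j)%N then ab.2 ord0 l - ab.1 ord0 l
   else ((ab.1 ord0 l < x ord0 l <= ab.2 ord0 l)%R : nat)%:R).

Lemma partvol_ge0 ab j x : ordered_box ab -> 0 <= partvol ab j x.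
Proof. by move=> o; apply: prodr_ge0 => i _; case: ifP; rewrite ?subr_ge0. Qed.

Definition box_ind ab x : R := \1_(box ab.1 ab.2) x.

Lemma partvol_box ab x : partvol ab 0 x = box_ind ab x.
Proof.
rewrite /partvol /box_ind indicE; have [xb|xb] := pselect (box ab.1 ab.2 x).
  by rewrite mem_set // big1 // => l _ /=; rewrite (xb l).
rewrite memNset //; have [/forallP H|/forallPn[l Hl]] :=
  boolP [forall l : 'I_d, ab.1 ord0 l < x ord0 l <= ab.2 ord0 l]; first by case: xb.
by rewrite (bigD1 l) //= ?ltn0 (negbTE Hl) mul0r.
Qed.

Lemma partvol_vol ab x : partvol ab d x = vol ab.
Proof. by apply: eq_bigr => l _; rewrite ltn_ord. Qed.

Definition set_coord x (j : 'I_d) (s : R) : 'rV[R]_d := \row_l (if l == j then s else x ord0 l).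

Let cofac ab (j : 'I_d) x : R := \prod_(l < d | l != j)
  (if (l < j)%N then ab.2 ord0 l - ab.1 ord0 l
   else ((ab.1 ord0 l < x ord0 l <= ab.2 ord0 l)%R : nat)%:R).

Let cofac_ge0 ab j x : ordered_box ab -> 0 <= cofac ab j x.
Proof. by move=> o; apply: prodr_ge0 => i _; case: ifP; rewrite ?subr_ge0. Qed.

Let partvol_set_coord ab (j : 'I_d) x s :
  partvol ab j (set_coord x j s) = cofac ab j x * \1_(`]ab.1 ord0 j, ab.2 ord0 j]%classic) s.
Proof.
rewrite /partvol (bigD1 j) //= ltnn mxE eqxx mulrC; congr (_ * _).
  by apply: eq_bigr => l lj; rewrite mxE (negbTE lj).
by rewrite indicE mem_setE /= in_itv.
Qed.

Let partvolS ab (j : 'I_d) x :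
  partvol ab j.+1 x = cofac ab j x * (ab.2 ord0 j - ab.1 ord0 j).
Proof.
rewrite /partvol (bigD1 j) //= ltnSn mulrC; congr (_ * _).
apply: eq_bigr => l lj; rewrite ltnS leq_eqVlt; case: eqP => // e.
by move: lj; rewrite (val_inj e) eqxx.
Qed.

Let integral_partvol ab (j : 'I_d) x : ordered_box ab ->
  (\int[@lebesgue_measure R]_(s in setT) (partvol ab j (set_coord x j s))%:E = (partvol ab j.+1 x)%:E)%E.
Proof.
move=> o; under eq_integral do rewrite partvol_set_coord EFinM.
rewrite ge0_integralZl //=; last 2 first.
- by apply/measurable_EFinP; apply: measurable_indic.
- by rewrite lee_fin cofac_ge0.
rewrite integral_indic // setIT /= lebesgue_measure_itv /= partvolS EFinM; congr (_ * _)%E.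
case: ifP => //; rewrite lte_fin => /negbT; rewrite -leNgt => ba.
have /eqP -> : ab.1 ord0 j == ab.2 ord0 j by rewrite eq_le ba o.
by rewrite subrr.
Qed.

Let measurable_partvol ab (j : 'I_d) x :
  measurable_fun setT (fun s : R => (partvol ab j (set_coord x j s))%:E).
Proof.
apply/measurable_EFinP.
rewrite (_ : (fun s => _) = (fun s => cofac ab j x * \1_(`]ab.1 ord0 j, ab.2 ord0 j]%classic) s)); last first.
  by apply/funext => s; rewrite partvol_set_coord.
by apply: measurable_funM => //; apply: measurable_indic.
Qed.

(** Integrate the inequality between indicators over one coordinate at a time, exchanging sum and
    integral; after [d] integrations the indicators have become volumes. *)
Lemma vol_le_series (I : finType) (A : I -> 'rV[R]_d * 'rV[R]_d) (B : nat -> 'rV[R]_d * 'rV[R]_d) :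
  (forall i, ordered_box (A i)) -> (forall k, ordered_box (B k)) ->
  (forall x, (\sum_i (box_ind (A i) x)%:E <= \sum_(k <oo) (box_ind (B k) x)%:E)%E) ->
  ((\sum_i vol (A i))%:E <= \sum_(k <oo) (vol (B k))%:E)%E.
Proof.
move=> oA oB le.
suff H j : (j <= d)%N -> forall x,
    (\sum_i (partvol (A i) j x)%:E <= \sum_(k <oo) (partvol (B k) j x)%:E)%E.
  have := H d (leqnn d) 0; under eq_bigr do rewrite partvol_vol.
  by under eq_eseriesr do rewrite partvol_vol; rewrite sumEFin.
elim: j => [_ x|j IH jd x].
  under eq_bigr do rewrite partvol_box; under eq_eseriesr do rewrite partvol_box.
  exact: le.
pose j' := Ordinal jd.
have -> : (\sum_i (partvol (A i) j.+1 x)%:E =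
    \int[@lebesgue_measure R]_(s in setT) \sum_i (partvol (A i) j (set_coord x j' s))%:E)%E.
  rewrite ge0_integral_sum //.
  - by apply: eq_bigr => i _; rewrite (integral_partvol j' x (oA i)).
  - by move=> i; apply: (measurable_partvol _ j').
  - by move=> i s _; rewrite lee_fin partvol_ge0.
have -> : (\sum_(k <oo) (partvol (B k) j.+1 x)%:E =
    \int[@lebesgue_measure R]_(s in setT) \sum_(k <oo) (partvol (B k) j (set_coord x j' s))%:E)%E.
  rewrite integral_nneseries //.
  - by apply: eq_eseriesr => k _; rewrite (integral_partvol j' x (oB k)).
  - by move=> k; apply: (measurable_partvol _ j').
  - by move=> k s _; rewrite lee_fin partvol_ge0.
apply: ge0_le_integral => //.
- by move=> s _; apply: sume_ge0 => i _; rewrite lee_fin partvol_ge0.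
- by apply: emeasurable_sum => i; apply: (measurable_partvol _ j').
- by apply: ge0_emeasurable_sum => [k s _ _|k _]; [rewrite lee_fin partvol_ge0 | apply: (measurable_partvol _ j')].
- by move=> s _; apply: IH; apply: ltnW.
Qed.

(** The indicators of a cover of [E] add up to at least the indicator of [E], so [vol_le_series]
    applies to every cover. *)
Lemma outer_ge_boxes (I : finType) (A : I -> 'rV[R]_d * 'rV[R]_d) (E : set 'rV[R]_d) :
  (forall i, ordered_box (A i)) ->
  (forall x, \sum_i box_ind (A i) x <= \1_E x) ->
  ((\sum_i vol (A i))%:E <= lebesgue_outer E)%E.
Proof.
move=> oA AE; apply: le_ereal_inf_tmp => _ [B [oB EB] <-].
apply: vol_le_series => // x; rewrite sumEFin.
apply: (@le_trans _ _ (\1_E x)%:E); first by rewrite lee_fin.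
have pos k : (0 <= (box_ind (B k) x)%:E)%E by rewrite lee_fin.
rewrite indicE; have [xE|xE] := pselect (E x); last first.
  by rewrite memNset //; apply: nneseries_ge0 => k _ _.
rewrite mem_set //; have [k _ xk] := EB x xE.
rewrite (nneseriesD1 (n := k)) // /box_ind indicE mem_set //.
by apply: leeDl; apply: nneseries_ge0 => i _ _.
Qed.

End BoxVolume.

Section Outer.
Variables (R : realType) (d : nat).
Local Notation V := 'rV[R]_d.+1.
Local Notation mu := (@lebesgue_outer R d.+1).
Local Open Scope ereal_scope.

Lemma lebesgue_outer_ge0 (A : set V) : 0 <= mu A.
Proof.
apply: le_ereal_inf_tmp => _ [B [oB _] <-]; apply: nneseries_ge0 => k _ _.
by rewrite lee_fin; apply: (vol_ge0 (ab := B k)).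
Qed.

Lemma lebesgue_outer_le : {homo mu : A B / A `<=` B >-> A <= B}.
Proof.
move=> A B AB; apply: le_ereal_inf_tmp => _ [C [oC BC] <-]; apply: ereal_inf_lbound.
by exists C => //; split=> //; apply: subset_trans BC.
Qed.

Lemma lebesgue_outer_box_le (ab : V * V) : ordered_box ab -> mu (box ab.1 ab.2) <= (vol ab)%:E.
Proof.
(* The cover is completed by degenerate boxes, of volume 0 in positive dimension. *)
move=> o; pose B (k : nat) : V * V := if k is 0%N then ab else (0, 0)%R.
apply: ereal_inf_lbound; exists B; first split.
- by case=> [|k] i //=; apply: o.
- by move=> x xab; exists 0%N.
rewrite (nneseriesD1 (n := 0%N)) //; last first.
  move=> k _; rewrite lee_fin; apply: (vol_ge0 (ab := B k)).
  by case: k => [|k] i /=.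
rewrite eseries0 ?adde0 // => k _; case: k => // k _ /=.
by rewrite (bigD1 ord0) //= mxE subrr mul0r.
Qed.

Lemma lebesgue_outer0 : mu set0 = 0.
Proof.
apply/eqP; rewrite eq_le lebesgue_outer_ge0 andbT.
apply: (@le_trans _ _ (vol ((0, 0)%R : V * V))%:E).
  by apply: le_trans (lebesgue_outer_box_le _); [apply: lebesgue_outer_le | move=> i].
by rewrite /vol (bigD1 ord0) //= mxE subrr mul0r.
Qed.

Lemma cover_approx (A : set V) (e : R) : (0 < e)%R -> mu A < +oo ->
  exists2 B, box_covers A B & \sum_(k <oo) (vol (B k))%:E <= mu A + e%:E.
Proof.
move=> e0 Aoo.
have fin : mu A \is a fin_num by rewrite ge0_fin_numE // lebesgue_outer_ge0.
have [_ [B cB <-] lt] := lb_ereal_inf_adherent e0 fin.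
by exists B => //; apply: ltW.
Qed.

(** Cover [A n] up to [e / 2 ^ n.+1] and enumerate the double family of boxes by a bijection between
    [nat] and [nat * nat]. *)
Lemma lebesgue_outer_sigma_subadditive : sigma_subadditive mu.
Proof.
move=> A; have [[i Aioo]|Afin] := pselect (exists i, mu (A i) = +oo).
  rewrite (eseries_pinfty _ _ Aioo) ?leey // => n _.
  by rewrite gt_eqF // (lt_le_trans _ (lebesgue_outer_ge0 _)).
apply/lee_addgt0Pr => e e0.
have e2 n : (0 < e / (2 ^ n.+1)%:R)%R by rewrite divr_gt0 // ltr0n expn_gt0.
have /choice[B PB] : forall n, exists B, box_covers (A n) B /\
    \sum_(k <oo) (vol (B k))%:E <= mu (A n) + (e / (2 ^ n.+1)%:R)%:E.
  move=> n; have [|B cB le] := cover_approx (A := A n) (e2 n); last by exists B.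
  by rewrite ltey; apply/eqP => h; apply: Afin; exists n.
have vB n k : 0 <= (vol (B n k))%:E by rewrite lee_fin vol_ge0 //; apply: (PB n).1.1.
apply: (@le_trans _ _ (\sum_(n <oo) \sum_(k <oo) (vol (B n k))%:E)); last first.
  apply: le_trans (epsilon_trick _ _ (ltW e0)); last by move=> n; apply: lebesgue_outer_ge0.
  by apply: lee_nneseries => [n _ _|n _]; [apply: nneseries_ge0 => k _ _ | apply: (PB n).2].
have /card_esym/ppcard_eqP[f] := card_nat2.
apply: (@le_trans _ _ (\sum_(m <oo) (vol (B (f m).1 (f m).2))%:E)).
  apply: ereal_inf_lbound; exists (fun m => B (f m).1 (f m).2) => //; split=> [m|].
    exact: (PB (f m).1).1.1.
  move=> x [n _ /(PB n).1.2[k _ xk]]; exists (f^-1%FUN (n, k)) => //=.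
  by rewrite invK ?inE.
rewrite nneseries_esumT //.
rewrite -(@reindex_esum R _ _ setT setT f (fun nk => (vol (B nk.1 nk.2))%:E)) //.
rewrite (_ : [set: nat * nat] = [set: nat] `*`` (fun=> setT)); last first.
  by apply/seteqP; split.
rewrite -(@esum_esum R _ _ setT (fun=> setT) (fun n k => (vol (B n k))%:E)) //.
rewrite -nneseries_esumT; last by move=> n; apply: esum_ge0.
by apply: lee_nneseries => [n _ _|n _]; [apply: esum_ge0 | rewrite nneseries_esumT].
Qed.

HB.instance Definition _ := isOuterMeasure.Build R V mu
  lebesgue_outer0 lebesgue_outer_ge0 lebesgue_outer_le lebesgue_outer_sigma_subadditive.

Let vol_split (ab : V * V) (i : 'I_d.+1) (m : R) :
  let L := (ab.1, \row_l (if l == i then m else ab.2 ord0 l))%R in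
  let U := (\row_l (if l == i then m else ab.1 ord0 l), ab.2)%R in
  (vol ab = vol L + vol U)%R.
Proof.
rewrite /vol /= (bigD1 i) //= [in RHS](bigD1 i) //= [X in (_ = _ + X)%R](bigD1 i) //= !mxE eqxx.
rewrite (eq_bigr (fun l => (ab.2 ord0 l - ab.1 ord0 l)%R)); last by move=> l li.
rewrite [X in (_ = (m - _) * X + _)%R](eq_bigr (fun l => (ab.2 ord0 l - ab.1 ord0 l)%R)); last first.
  by move=> l li; rewrite mxE (negbTE li).
rewrite [X in (_ = _ + (_ - m) * X)%R](eq_bigr (fun l => (ab.2 ord0 l - ab.1 ord0 l)%R)); last first.
  by move=> l li; rewrite mxE (negbTE li).
ring.
Qed.

(** The hyperplane cuts every box of a cover into two boxes whose volumes add up. *)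
Lemma halfspace_caratheodory (i : 'I_d.+1) (c : R) : mu.-caratheodory [set x : V | (x ord0 i <= c)%R].
Proof.
apply: le_caratheodory_measurable => X.
have [Xoo|Xoo] := eqVneq (mu X) +oo; first by rewrite [leRHS]Xoo leey.
apply/lee_addgt0Pr => e e0.
have [|B [oB XB] le] := @cover_approx X e e0; first by rewrite ltey.
(* Clamping [c] to the side of the box keeps both pieces ordered, one of them possibly
   degenerate. *)
pose m k : R := Num.max ((B k).1 ord0 i) (Num.min ((B k).2 ord0 i) c).
have m1 k : ((B k).1 ord0 i <= m k)%R by rewrite le_max lexx.
have m2 k : (m k <= (B k).2 ord0 i)%R by rewrite ge_max oB ge_min lexx.
pose L k : V * V := ((B k).1, \row_l (if l == i then m k else (B k).2 ord0 l))%R.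
pose U k : V * V := (\row_l (if l == i then m k else (B k).1 ord0 l), (B k).2)%R.
have oL k : ordered_box (L k) by move=> l; rewrite /= mxE; case: eqP => [->|_] //; apply: oB.
have oU k : ordered_box (U k) by move=> l; rewrite /= mxE; case: eqP => [->|_] //; apply: oB.
apply: le_trans le; rewrite (@eq_eseriesr _ _ (fun k => (vol (L k))%:E + (vol (U k))%:E)); last first.
  by move=> k _; rewrite -EFinD -vol_split.
rewrite nneseriesD; [ | by move=> k _ _; rewrite lee_fin vol_ge0 | by move=> k _ _; rewrite lee_fin vol_ge0].
apply: leeD; apply: ereal_inf_lbound.
- exists L => //; split=> [k|x [/XB [k _ xk] xc]]; first exact: oL.
  exists k => // l; rewrite /= mxE; have := xk l; case: eqP => [->|_] // /andP[-> xb] /=.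
  by rewrite le_max le_min xb xc orbT.
- exists U => //; split=> [k|x [/XB [k _ xk] xc]]; first exact: oU.
  exists k => // l; rewrite /= mxE; have := xk l; case: eqP => [->|_] // /andP[xa ->].
  rewrite andbT gt_max xa /= gt_min; move/negP: xc; rewrite -ltNge => ->.
  by rewrite orbT.
Qed.

Lemma box_caratheodory (a b : V) : mu.-caratheodory (box a b).
Proof.
suff H j : (j <= d.+1)%N -> mu.-caratheodory
    [set x : V | forall i : 'I_d.+1, (i < j)%N -> (a ord0 i < x ord0 i <= b ord0 i)%R].
  have := H d.+1 (leqnn _); congr (mu.-caratheodory _).
  by apply/seteqP; split=> x xab i; [apply: xab | move=> _; apply: xab].
elim: j => [_|j IH jd].
  rewrite (_ : [set x | _] = setT); last by apply/seteqP; split.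
  rewrite -setC0; apply: caratheodory_measurable_setC; exact: caratheodory_measurable_set0.
pose j' := Ordinal jd.
rewrite (_ : [set x | _] = [set x : V | forall i : 'I_d.+1, (i < j)%N -> (a ord0 i < x ord0 i <= b ord0 i)%R]
   `&` ([set x : V | (x ord0 j' <= b ord0 j')%R] `\` [set x : V | (x ord0 j' <= a ord0 j')%R])); last first.
  apply/seteqP; split=> [x xab|x [xab [xb /negP]]] /=.
    split; first by move=> i ij; apply: xab; apply: ltnW.
    have /andP[xa xb] := xab j' (ltnSn _); split => //.
    by apply/negP; rewrite -ltNge.
  rewrite -ltNge => xa i; rewrite ltnS leq_eqVlt => /orP[/eqP ij|]; last exact: xab.
  by rewrite (_ : i = j') ?xa // ; apply: val_inj.
apply: caratheodory_measurable_setI; first by apply: IH; apply: ltnW.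
by apply: caratheodory_measurable_setD; apply: halfspace_caratheodory.
Qed.

Lemma countable_union_caratheodory (T : countType) (F : T -> set V) (P : T -> Prop) :
  (forall t, mu.-caratheodory (F t)) -> mu.-caratheodory [set x | exists2 t, P t & F t x].
Proof.
move=> mF.
pose H (n : nat) : set V := [set x | exists2 t, P t /\ pickle t = n & F t x].
rewrite (_ : [set x | _] = \bigcup_n H n).
  apply: caratheodory_measurable_bigcup => n.
  have [[t [Pt tn]]|no] := pselect (exists t, P t /\ pickle t = n).
    rewrite (_ : H n = F t) //; apply/seteqP; split=> [x [s [_ sn] sx]|x tx]; last by exists t.
    by have -> : t = s by apply: (pcan_inj pickleK); rewrite tn sn.
  rewrite (_ : H n = set0); first exact: caratheodory_measurable_set0.
  by apply/seteqP; split=> [x [t tP _]|//]; case: no; exists t.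
apply/seteqP; split=> [x [t Pt tx]|x [n _ [t [Pt _] tx]]]; last by exists t.
by exists (pickle t) => //; exists t.
Qed.

End Outer.

(** Bernoulli's inequality. *)
Lemma expr1B_ge (R : realFieldType) (x : R) (n : nat) : 0 <= x <= 1 -> 1 - n%:R * x <= (1 - x) ^+ n.
Proof.
move=> /andP[x0 x1]; elim: n => [|n IH]; first by rewrite mul0r subr0 expr0.
rewrite exprS; apply: le_trans (ler_wpM2l _ IH); last by rewrite subr_ge0.
have : 0 <= n%:R * x * x by rewrite !mulr_ge0.
by rewrite -[n.+1%:R]natr1; lra.
Qed.

Section CubeVolume.
Variables (R : realType) (d : nat).
Local Notation V := 'rV[R]_d.+1.
Local Notation mu := (@lebesgue_outer R d.+1).

Definition cst_box (a b : R) : V * V := (const_mx a, const_mx b).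

Lemma vol_cst_box a b : vol (cst_box a b) = (b - a) ^+ d.+1.
Proof.
by rewrite /vol (eq_bigr (fun=> b - a)) ?prodr_const ?card_ord // => i _; rewrite !mxE.
Qed.

Lemma outer_cube_le r : 0 <= r -> (mu (cube 0 r) <= (r ^+ d.+1)%:E)%E.
Proof.
move=> r0; have o : ordered_box (cst_box (- (r / 2)) (r / 2)).
  by move=> i; rewrite !mxE; lra.
apply: le_trans (_ : _ <= (vol (cst_box (- (r / 2)) (r / 2)))%:E)%E _.
  apply: le_trans (lebesgue_outer_box_le o); apply: lebesgue_outer_le => x xr i.
  by have := xr i; rewrite !mxE subr0 ltr_norml => /andP[-> /ltW ->].
by rewrite vol_cst_box lee_fin; rewrite le_eqVlt; apply/orP; left; apply/eqP; congr (_ ^+ _); lra.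
Qed.

Lemma outer_box_ge (ab : V * V) : ordered_box ab -> ((vol ab)%:E <= mu (box ab.1 ab.2))%E.
Proof.
move=> o; have := @outer_ge_boxes R d.+1 'I_1 (fun=> ab) (box ab.1 ab.2) (fun=> o).
rewrite big_ord1; apply=> x; by rewrite big_ord1.
Qed.

Lemma outer_cube r : 0 < r -> mu (cube 0 r) = (r ^+ d.+1)%:E.
Proof.
move=> r0; apply/eqP; rewrite eq_le outer_cube_le ?(ltW r0) //=.
(* Boxes are half-open and the cube is open, so a slightly smaller box is placed inside. *)
have low (x : R) : 0 < x <= 1 -> ((r ^+ d.+1 * (1 - d.+1%:R * x))%:E <= mu (cube 0 r))%E.
  move=> /andP[x0 x1]; pose s := r * (1 - x).
  have s0 : 0 <= s by rewrite mulr_ge0 ?(ltW r0) // subr_ge0.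
  have sr : s < r by rewrite /s -[ltRHS]mulr1 ltr_pM2l //; lra.
  have o : ordered_box (cst_box (- (s / 2)) (s / 2)) by move=> i; rewrite !mxE; lra.
  apply: (@le_trans _ _ (vol (cst_box (- (s / 2)) (s / 2)))%:E).
    rewrite vol_cst_box (_ : s / 2 - - (s / 2) = s); last by lra.
    by rewrite /s exprMn lee_fin ler_wpM2l ?exprn_ge0 ?(ltW r0) // expr1B_ge // x1 ltW.
  apply: le_trans (outer_box_ge o) _; apply: lebesgue_outer_le => y yb i.
  by have := yb i; rewrite !mxE subr0 ltr_norml; lra.
apply/lee_addgt0Pr => e e0.
have r1 : 0 < r ^+ d.+1 by rewrite exprn_gt0.
pose x := Num.min 1 (e / (r ^+ d.+1 * d.+1%:R)).
have xe : 0 < e / (r ^+ d.+1 * d.+1%:R) by rewrite divr_gt0 // mulr_gt0 // ltr0n.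
have x01 : 0 < x <= 1 by rewrite lt_min ltr01 xe ge_min lexx.
apply: le_trans (leeD (low x x01) (lexx _)); rewrite -EFinD lee_fin.
have : x * (r ^+ d.+1 * d.+1%:R) <= e.
  by rewrite -ler_pdivlMr ?mulr_gt0 ?ltr0n // ge_min lexx orbT.
by rewrite mulrBr mulr1; lra.
Qed.

Lemma upper_density_lt (A : set V) (b : R) : (upper_density A < b%:E)%E ->
  exists M, forall r, M < r -> 0 < r -> (mu (A `&` cube (0 : V) r) <= (b * r ^+ d.+1)%:E)%E.
Proof.
rewrite /upper_density limf_esupE => /ereal_inf_lt[_ [U [M [Mr MU]] <-] Ub].
exists M => r Mr' r0.
have : (mu (A `&` cube (0 : V) r) / mu (cube (0 : V) r) <= b%:E)%E.
  by apply: ltW; apply: le_lt_trans Ub; apply: ereal_sup_ubound; exists r => //; apply: MU.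
have rp : 0 < r ^+ d.+1 by rewrite exprn_gt0.
by rewrite outer_cube // inver gt_eqF // lee_pdivrMr // -EFinM.
Qed.

End CubeVolume.

(** * Finite models and measurable sets *)

Section Periodization.
Variables (R : realType) (d : nat) (D : set R) (h : R).
Variables (G : finZmodType) (p : {additive {ffun 'I_d.+1 -> int} -> G}) (S : {set G}).
Hypothesis h0 : 0 < h.
Local Notation V := 'rV[R]_d.+1.
Local Notation mu := (@lebesgue_outer R d.+1).

(** The ceiling fits boxes that are open on the left and closed on the right. *)
Definition ceilv (y : V) : {ffun 'I_d.+1 -> int} := [ffun i => Num.ceil (y ord0 i / h)].

Definition cell (w : {ffun 'I_d.+1 -> int}) : V * V :=
  (\row_i (h * ((w i)%:~R - 1)), \row_i (h * (w i)%:~R)).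

Lemma cell_ordered w : ordered_box (cell w).
Proof. by move=> i; rewrite !mxE ler_pM2l //; lra. Qed.

Lemma vol_cell w : vol (cell w) = h ^+ d.+1.
Proof.
rewrite /vol (eq_bigr (fun=> h)) ?prodr_const ?card_ord // => i _; rewrite !mxE; ring.
Qed.

Lemma cellP w y : box (cell w).1 (cell w).2 y <-> ceilv y = w.
Proof.
split=> [yw|<- i].
  apply/ffunP => i; rewrite ffunE; apply: ceil_def; have := yw i; rewrite !mxE.
  rewrite [h * _]mulrC -ltr_pdivlMr // [h * _]mulrC -ler_pdivrMr //.
  by rewrite rmorphB.
rewrite !mxE ffunE [h * _]mulrC -ltr_pdivlMr // [h * _]mulrC -ler_pdivrMr //.
by have := ceil_itv (y ord0 i / h); rewrite rmorphB.
Qed.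

(* Averaging over [x] in [density_le_max] makes up for [p] not being surjective. *)
Definition periodized (x : G) : set V := [set y | x + p (ceilv y) \in S].

Lemma periodized_measurable x : lebesgue_measurable (periodized x).
Proof.
rewrite /lebesgue_measurable (_ : periodized x = [set y | exists2 w : {ffun 'I_d.+1 -> int},
    x + p w \in S & box (cell w).1 (cell w).2 y]).
  by apply: countable_union_caratheodory => w; apply: box_caratheodory.
apply/seteqP; split=> [y yS|y [w wS /cellP yw]]; last by rewrite /periodized /= yw.
by exists (ceilv y) => //; apply/cellP.
Qed.

(* Comparing Euclidean norms through the l1 distance avoids Minkowski's inequality. *)
Lemma sqrt_sum_sqr_dist (n : nat) (u v : 'I_n -> R) :
  `|Num.sqrt (\sum_i u i ^+ 2) - Num.sqrt (\sum_i v i ^+ 2)| <= \sum_i `|u i - v i|.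
Proof.
set nu := Num.sqrt _; set nv := Num.sqrt _.
have s2 (w : 'I_n -> R) : 0 <= \sum_i w i ^+ 2 by apply: sumr_ge0 => i _; apply: sqr_ge0.
have coord (w : 'I_n -> R) i : `|w i| <= Num.sqrt (\sum_i w i ^+ 2).
  rewrite -sqrtr_sqr ler_wsqrtr // (bigD1 i) //= lerDl.
  by apply: sumr_ge0 => j _; apply: sqr_ge0.
have n0 : 0 <= nu + nv by rewrite addr_ge0 ?sqrtr_ge0.
have E : (nu - nv) * (nu + nv) = \sum_i (u i - v i) * (u i + v i).
  by rewrite -subr_sqr !sqr_sqrtr // -sumrB; apply: eq_bigr => i _; rewrite subr_sqr.
have [n00|npos] := eqVneq (nu + nv) 0.
  have nu0 : 0 <= nu := sqrtr_ge0 _; have nv0 : 0 <= nv := sqrtr_ge0 _.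
  have -> : nu - nv = 0 by lra.
  by rewrite normr0 sumr_ge0.
have np : 0 < nu + nv by rewrite lt_neqAle eq_sym npos.
rewrite -(ler_pM2r np) -[nu + nv in leLHS]gtr0_norm // -normrM E mulr_suml.
apply: le_trans (ler_norm_sum _ _ _) _; apply: ler_sum => i _; rewrite normrM ler_wpM2l //.
by apply: le_trans (ler_normD _ _) _; apply: lerD; apply: coord.
Qed.

(** Rounding up moves each coordinate of either point by an amount between 0 and [h], so the two
    errors differ by at most [h]. *)
Lemma cell_edist y y' : `|h * enorm R (ceilv y' - ceilv y) - Defs.edist y y'| <= d.+1%:R * h.
Proof.
have -> : h * enorm R (ceilv y' - ceilv y) =
    Num.sqrt (\sum_i (h * ((ceilv y' - ceilv y) i)%:~R) ^+ 2).
  rewrite (eq_bigr (fun i => h ^+ 2 * ((ceilv y' - ceilv y) i)%:~R ^+ 2)); last by move=> i _; rewrite exprMn.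
  by rewrite -mulr_sumr sqrtrM ?sqr_ge0 // sqrtr_sqr gtr0_norm.
have -> : Defs.edist y y' = Num.sqrt (\sum_i (y' ord0 i - y ord0 i) ^+ 2).
  by congr Num.sqrt; apply: eq_bigr => i _; rewrite -[RHS]sqrrN opprB.
apply: le_trans (sqrt_sum_sqr_dist _ _) _.
have -> : d.+1%:R * h = \sum_(i < d.+1) h by rewrite sumr_const card_ord mulr_natl.
apply: ler_sum => i _; rewrite !ffunE rmorphB /=.
have c (z : R) : 0 <= h * (Num.ceil (z / h))%:~R - z <= h.
  have := ceil_itv (z / h); rewrite rmorphB /= => /andP[c1 c2].
  rewrite -(ltr_pM2l h0) in c1; rewrite -(ler_pM2l h0) in c2.
  have E : h * (z / h) = z by rewrite mulrCA divff ?mulr1 // gt_eqF.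
  by move: c1 c2; rewrite E; lra.
by have := c (y ord0 i); have := c (y' ord0 i); rewrite ler_norml; lra.
Qed.

Lemma periodized_avoiding x : grid_avoiding d.+1%:R h D p S -> avoiding D (periodized x).
Proof.
move=> admS y y' yA y'A Dt.
have := admS (ceilv y' - ceilv y) _ Dt (cell_edist y y') _ yA.
by rewrite raddfB -addrA [p (ceilv y) + _]addrC subrK => /negP; apply.
Qed.

Definition window (n : nat) (q : ibox d.+1 (2 * n)) : {ffun 'I_d.+1 -> int} :=
  ivec q + [ffun=> 1 - n%:Z].

(** The cells of the window are disjoint, have volume [h ^ d.+1] and lie in the cube. *)
Lemma outer_periodized_ge x n :
  ((h ^+ d.+1 * \sum_(q : ibox d.+1 (2 * n)) ind R S (x + p (window q)))%:E <=
   mu (periodized x `&` cube (0 : V) (2 * n.+1%:R * h)))%E.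
Proof.
(* Cells outside the model are replaced by the empty box from 0 to 0. *)
pose A (q : ibox d.+1 (2 * n)) : V * V := if x + p (window q) \in S then cell (window q) else (0, 0).
have oA q : ordered_box (A q) by rewrite /A; case: ifP => _; [apply: cell_ordered | move=> i].
have -> : h ^+ d.+1 * \sum_(q : ibox d.+1 (2 * n)) ind R S (x + p (window q)) = \sum_q vol (A q).
  rewrite mulr_sumr; apply: eq_bigr => q _; rewrite /A /ind; case: ifP => _.
    by rewrite mulr1 vol_cell.
  by rewrite mulr0 /vol (bigD1 ord0) //= subrr mul0r.
apply: outer_ge_boxes => // y.
have inA q : box (A q).1 (A q).2 y -> x + p (window q) \in S /\ ceilv y = window q.
  rewrite /A; case: ifP => [qS /cellP //|_ /(_ ord0)]; by rewrite /= mxE lt_le_asym.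
have [[q yq]|no] := pselect (exists q, box (A q).1 (A q).2 y); last first.
  rewrite big1 ?indicE ?ler0n // => q _; rewrite /box_ind indicE memNset // => yq.
  by apply: no; exists q.
have [qS yw] := inA q yq.
rewrite (bigD1 q) //= big1 ?addr0; last first.
  move=> q' q'q; rewrite /box_ind indicE memNset // => /inA[_ yw'].
  case/eqP: q'q; apply/ffunP => i; apply: val_inj.
  have := congr1 (fun w : {ffun 'I_d.+1 -> int} => w i) (etrans (esym yw') yw).
  by rewrite !ffunE => /addIr [].
rewrite /box_ind !indicE mem_set // mem_set //; split; first by rewrite /periodized /= yw.
move=> i; have /cellP yb := yw; have := yb i; rewrite !mxE subr0 !ffunE.
rewrite rmorphD rmorphB /= => yi.
have q2 : (q i : nat)%:~R <= 2 * n%:R - 1 :> R.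
  by rewrite lerBrDr -[1]/(1%:R) -natrM -[_%:~R]/((q i : nat)%:R) -natrD ler_nat addn1 ltn_ord.
have q0 : 0 <= (q i : nat)%:~R :> R by rewrite -[_%:~R]/((q i : nat)%:R).
move: yi; rewrite -[n%:Z%:~R]/(n%:R : R) -[1%:~R]/(1 : R) => /andP[y1 y2].
have b1 : h * (- n%:R) <= h * ((q i : nat)%:~R + (1 - n%:R) - 1) by rewrite ler_wpM2l ?(ltW h0) //; lra.
have b2 : h * ((q i : nat)%:~R + (1 - n%:R)) <= h * n%:R by rewrite ler_wpM2l ?(ltW h0) //; lra.
by rewrite -[n.+1%:R]natr1 ltr_norml; lra.
Qed.

(** Suppose that all translates have upper density below [b < density R S]. As [G] is finite, one
    radius serves all [x], and averaging over [x] gives [density R S * n ^ d.+1 <= b * n.+1 ^ d.+1],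
    which fails for large [n]. *)
Lemma density_le_max : grid_avoiding d.+1%:R h D p S -> ((density R S)%:E <= max_density d.+1 D)%E.
Proof.
move=> admS; rewrite leNgt; apply/negP => lt.
have [b ltb bS] : exists2 b : R, (max_density d.+1 D < b%:E)%E & b < density R S.
  case: (max_density d.+1 D) lt => [m||] //.
    rewrite lte_fin => lt; exists ((m + density R S) / 2); rewrite ?lte_fin; lra.
  by move=> _; exists (density R S - 1); rewrite ?ltNyr //; lra.
have /choice[M MP] : forall x, exists M, forall r, M < r -> 0 < r ->
    (mu (periodized x `&` cube (0 : V) r) <= (b * r ^+ d.+1)%:E)%E.
  move=> x; apply: upper_density_lt; apply: le_lt_trans ltb; apply: ereal_sup_ubound.
  by exists (periodized x) => //; split; [apply: periodized_measurable | apply: periodized_avoiding].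
pose N0 := \sum_x `|M x|.
have key n : N0 < 2 * n.+1%:R * h -> density R S * n%:R ^+ d.+1 <= b * n.+1%:R ^+ d.+1.
  move=> Nn.
  have r0 : 0 < 2 * n.+1%:R * h by rewrite !mulr_gt0 // ltr0n.
  have le x : h ^+ d.+1 * \sum_(q : ibox d.+1 (2 * n)) ind R S (x + p (window q)) <=
      b * (2 * n.+1%:R * h) ^+ d.+1.
    rewrite -lee_fin; apply: le_trans (outer_periodized_ge x n) _; apply: MP => //.
    apply: le_lt_trans Nn; apply: le_trans (ler_norm _) _.
    by rewrite /N0 (bigD1 x) //= lerDl sumr_ge0.
  have := avg_le (cardG_gt0 G) le; rewrite avgZ.
  have -> : avg (fun x => \sum_(q : ibox d.+1 (2 * n)) ind R S (x + p (window q))) =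
      (2 * n%:R) ^+ d.+1 * density R S.
    rewrite {1}/avg exchange_big /= mulr_suml (eq_bigr (fun=> density R S)); last first.
      by move=> q _; rewrite density_avg -(avg_shift (ind R S) (p (window q))).
    by rewrite sumr_const card_ibox -[LHS]mulr_natl natrX natrM.
  rewrite !exprMn => h1.
  have c0 : 0 < 2 ^+ d.+1 * h ^+ d.+1 by rewrite mulr_gt0 ?exprn_gt0.
  by rewrite -(ler_pM2l c0); apply: le_trans (le_trans _ h1) _;
    rewrite le_eqVlt; apply/orP; left; apply/eqP; ring.
have d0 : 0 <= density R S by rewrite /density divr_ge0.
have [n1 n1P] := nat_above (N0 / h).
have [n2 n2P] := nat_above (density R S * d.+1%:R / (density R S - b)).
have bp : 0 < density R S - b by lra.
pose n := (n1 + n2)%N.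
have np : 0 < n.+1%:R :> R by rewrite ltr0n.
have := key n; rewrite (_ : N0 < _); last first.
  rewrite ler_pdivrMr // in n1P; apply: le_lt_trans n1P _; rewrite ltr_pM2r //.
  apply: (@lt_le_trans _ _ n.+1%:R); first by rewrite ltr_nat ltnS leq_addr.
  by rewrite ler_peMl //; lra.
move=> /(_ isT) H.
have x01 : 0 <= (n.+1%:R^-1 : R) <= 1 by rewrite invr_ge0 ler0n invf_le1 // ler1n.
have B := expr1B_ge d.+1 x01.
have E : n%:R ^+ d.+1 = (1 - n.+1%:R^-1) ^+ d.+1 * n.+1%:R ^+ d.+1 :> R.
  by rewrite -exprMn mulrBl mul1r mulVf ?gt_eqF // -natr1 addrK.
move: H; rewrite E mulrA ler_pM2r ?exprn_gt0 // => H.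
have H1 := le_trans (ler_wpM2l d0 B) H.
have H2 : density R S * d.+1%:R / n.+1%:R < density R S - b.
  rewrite ltr_pdivrMr // [ltRHS]mulrC -ltr_pdivrMr //; apply: le_lt_trans n2P _.
  by rewrite ltr_nat ltnS leq_addl.
have E3 : density R S * (1 - d.+1%:R / n.+1%:R) = density R S - density R S * d.+1%:R / n.+1%:R.
  by rewrite mulrBr mulr1 mulrA.
by move: H1 H2; rewrite E3 lerBlDl ltrBrDr => H1; rewrite ltNge H1.
Qed.

End Periodization.

(** * Compact sets and their discretization *)

Section CompactGap.
Variables (R : realType) (d : nat).
Local Notation V := 'rV[R]_d.

Lemma edist_continuous : continuous (fun xy : V * V => Defs.edist xy.1 xy.2).
Proof.
have cc i : continuous (fun xy : V * V => xy.1 ord0 i - xy.2 ord0 i).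
  move=> xy; apply: cvgB.
    by apply: (@continuous_comp _ _ _ fst (fun v : V => v ord0 i)); [exact: cvg_fst | exact: coord_continuous].
  by apply: (@continuous_comp _ _ _ snd (fun v : V => v ord0 i)); [exact: cvg_snd | exact: coord_continuous].
move=> xy; apply: (@continuous_comp _ _ _ (fun xy : V * V => \sum_(i < d) (xy.1 ord0 i - xy.2 ord0 i) ^+ 2) Num.sqrt);
  last exact: sqrt_continuous.
move: xy; apply: (@continuous_big R _ +%R 0); first exact: add_continuous.
move=> i _ xy; apply: (@continuous_comp _ _ _ (fun xy : V * V => xy.1 ord0 i - xy.2 ord0 i) (fun z : R => z ^+ 2)).
  exact: cc.
exact: exprn_continuous.
Qed.

(** The set of distances of a compact set is compact, hence closed, and its complement is a
    neighbourhood of [t]. *)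
Lemma avoiding_gap1 (K : set V) (t : R) : compact K -> (forall x y, K x -> K y -> Defs.edist x y <> t) ->
  exists2 tau, 0 < tau & forall x y, K x -> K y -> tau <= `|Defs.edist x y - t|.
Proof.
move=> cK Kt; pose E := (fun xy : V * V => Defs.edist xy.1 xy.2) @` (K `*` K).
have cE : compact E.
  apply: continuous_compact (compact_setX cK cK); apply: continuous_subspaceT; exact: edist_continuous.
have clE : closed E by apply: compact_closed cE; exact: Rhausdorff.
have : nbhs t (~` E).
  by apply: open_nbhs_nbhs; split; [exact: closed_openC | move=> [[x y] [Kx Ky] /= /(Kt x y Kx Ky)]].
move=> /nbhs_ballP[tau tau0 tE]; exists tau => // x y Kx Ky; rewrite leNgt; apply/negP => lt.
by apply: (tE (Defs.edist x y)); [rewrite /ball /= distrC | exists (x, y)].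
Qed.

Lemma avoiding_gap (K : set V) (D : set R) : compact K -> finite_set D -> avoiding D K ->
  exists2 tau, 0 < tau & forall t x y, D t -> K x -> K y -> tau <= `|Defs.edist x y - t|.
Proof.
move=> cK /finite_seqP[s ->]; elim: s => [|t s IH] av; first by exists 1.
have [|tau1 t1 P1] := @avoiding_gap1 K t cK.
  by move=> x y Kx Ky xy; apply: (av x y Kx Ky); rewrite /= xy mem_head.
have [|tau2 t2 P2] := IH; first by move=> x y Kx Ky xy; apply: (av x y Kx Ky); rewrite /= inE [_ \in s]xy orbT.
exists (Num.min tau1 tau2); first by rewrite lt_min t1.
move=> u x y /=; rewrite inE => /orP[/eqP ->|us] Kx Ky; rewrite ge_min.
  by rewrite P1.
by rewrite (P2 u x y) ?orbT.
Qed.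

End CompactGap.

(** Continuity of a product, by induction on the number of factors. *)
Lemma prod_enlarge (R : realFieldType) (n : nat) (x : 'I_n -> R) (e : R) : (forall i, 0 <= x i) -> 0 < e ->
  exists2 del, 0 < del & \prod_i (x i + del) <= \prod_i x i + e.
Proof.
elim: n x e => [|n IH] x e x0 e0; first by exists 1 => //; rewrite !big_ord0; lra.
pose P := \prod_(i < n) x (lift ord0 i).
have P0 : 0 <= P by apply: prodr_ge0.
have b0 : 0 < x ord0 + 1 by have := x0 ord0; lra.
have e1 : 0 < e / 2 / (x ord0 + 1) by rewrite !divr_gt0.
have [del del0 H] := IH (x \o lift ord0) _ (fun i => x0 _) e1.
pose del' := Num.min del (Num.min 1 (e / 2 / (P + 1))).
have d0 : 0 < del'.
  by rewrite !lt_min del0 ltr01 !divr_gt0 //; rewrite ltr_wpDl.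
have [dd d1 dP] : [/\ del' <= del, del' <= 1 & del' * (P + 1) <= e / 2].
  by rewrite -ler_pdivlMr ?ltr_wpDl // !ge_min !lexx !orbT.
exists del' => //; rewrite !big_ord_recl.
have H' : \prod_(i < n) (x (lift ord0 i) + del') <= P + e / 2 / (x ord0 + 1).
  apply: le_trans H; apply: ler_prod => i _; rewrite lerD2l dd andbT addr_ge0 //; exact: ltW.
apply: (@le_trans _ _ ((x ord0 + del') * (P + e / 2 / (x ord0 + 1)))).
  by rewrite ler_wpM2l // addr_ge0 // ltW.
have E : (x ord0 + 1) * (e / 2 / (x ord0 + 1)) = e / 2 by rewrite mulrCA divff ?mulr1 // gt_eqF.
have h1 : (x ord0 + del') * (e / 2 / (x ord0 + 1)) <= e / 2.
  by rewrite -[leRHS]E ler_wpM2r ?lerD2l // ltW.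
by rewrite -/P mulrDr mulrDl; lra.
Qed.

Section InnerCompact.
Variables (R : realType) (d : nat).
Local Notation V := 'rV[R]_d.+1.
Local Notation mu := (@lebesgue_outer R d.+1).

Definition closed_cube (r : R) : set V := [set y | forall i, y ord0 i \in `[- (r / 2), r / 2]].

Lemma closed_cube_compact r : compact (closed_cube r).
Proof.
apply: (@rV_compact _ _ (fun=> [set` `[- (r / 2), r / 2]])) => i; exact: segment_compact.
Qed.

Lemma outer_closed_cube_fin r : 0 <= r -> (mu (closed_cube r) < +oo)%E.
Proof.
move=> r0; have r1 : 0 <= r + 1 by lra.
apply: le_lt_trans (le_trans (lebesgue_outer_le _) (outer_cube_le d r1)) (ltry _).
by move=> y yr i; have := yr i; rewrite in_itv /= mxE subr0 ltr_norml; lra.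
Qed.

Lemma open_box_open (a b : V) : open [set y : V | forall i, a ord0 i < y ord0 i < b ord0 i].
Proof.
rewrite openE => y yab.
have H (i : 'I_d.+1) : nbhs y [set z : V | a ord0 i < z ord0 i < b ord0 i].
  have /near_in_itvoo : y ord0 i \in `]a ord0 i, b ord0 i[ by rewrite in_itv /= yab.
  move=> /(@coord_continuous _ 1 d.+1 ord0 i y) H; apply: (@filterS V (nbhs y) (nbhs_filter y) _ _ _ H) => z.
  by rewrite /= in_itv.
exact: (@filter_forall V _ _ (nbhs y) (nbhs_filter y) H).
Qed.

(** Remove from the closed cube an open set that contains the points outside [A] and has only
    slightly larger measure. *)
Lemma inner_compact (A : set V) (r e : R) : lebesgue_measurable A -> 0 <= r -> 0 < e ->
  exists K, [/\ compact K, K `<=` A, K `<=` closed_cube r &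
    (mu (closed_cube r `&` A) <= mu K + e%:E)%E].
Proof.
move=> mA r0 e0; pose Q := closed_cube r.
have finQ : (mu Q < +oo)%E by apply: outer_closed_cube_fin.
have finM : (mu (Q `&` ~` A) < +oo)%E.
  by apply: le_lt_trans finQ; apply: lebesgue_outer_le => x [].
have e2 : 0 < e / 2 by rewrite divr_gt0.
have [B [oB MB] leB] := cover_approx e2 finM.
have ek k : 0 < e / 2 / (2 ^ k.+1)%:R by rewrite !divr_gt0 // ltr0n expn_gt0.
have /choice[del delP] : forall k, exists del, 0 < del /\
    \prod_(i < d.+1) ((B k).2 ord0 i - (B k).1 ord0 i + del) <= vol (B k) + e / 2 / (2 ^ k.+1)%:R.
  move=> k; have [i|del d0 le] := @prod_enlarge R _ (fun i : 'I_d.+1 => (B k).2 ord0 i - (B k).1 ord0 i) _ _ (ek k).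
    by rewrite subr_ge0 oB.
  by exists del.
(* Enlarging the upper endpoints puts each half-open box inside an open one. *)
pose B' k : V * V := ((B k).1, \row_i ((B k).2 ord0 i + del k)).
have oB' k : ordered_box (B' k) by move=> i; rewrite mxE; have := oB k i; have [] := delP k; lra.
have vB' k : vol (B' k) <= vol (B k) + e / 2 / (2 ^ k.+1)%:R.
  apply: le_trans (delP k).2; rewrite le_eqVlt; apply/orP; left; apply/eqP.
  by apply: eq_bigr => i _; rewrite mxE addrAC.
pose O k := [set y : V | forall i, (B' k).1 ord0 i < y ord0 i < (B' k).2 ord0 i].
exists (Q `&` ~` \bigcup_k O k); split.
- apply: subclosed_compact (@closed_cube_compact r) _; last by move=> y [].
  apply: closedI; first by apply: compact_closed (@closed_cube_compact r); exact: norm_hausdorff.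
  by apply: open_closedC; apply: bigcup_open => k _; apply: open_box_open.
- move=> y [yQ yO]; apply: contrapT => yA; apply: yO.
  have [k _ yk] := MB y (conj yQ yA); exists k => // i; rewrite mxE.
  by have := yk i; have [] := delP k; lra.
- by move=> y [].
set K := _ `&` ~` _.
have H1 : (mu Q <= mu K + mu (\bigcup_k box (B' k).1 (B' k).2))%E.
  apply: le_trans (outer_measureU2 _ _ _); apply: lebesgue_outer_le => y yQ.
  have [yO|] := pselect ((\bigcup_k O k) y); [right | by left].
  by case: yO => k _ yk; exists k => // i; have := yk i => /andP[-> /ltW].
have H2 : (mu (\bigcup_k box (B' k).1 (B' k).2) <= mu (Q `&` ~` A) + e%:E)%E.
  apply: (@le_trans _ _ (\sum_(k <oo) (vol (B' k))%:E)%E).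
    by apply: ereal_inf_lbound; exists B' => //; split.
  have : (\sum_(k <oo) (vol (B' k))%:E <= \sum_(k <oo) ((vol (B k))%:E + (e / 2 / (2 ^ k.+1)%:R)%:E))%E.
    apply: lee_nneseries => k _; first by move=> _; rewrite lee_fin vol_ge0.
    by rewrite -EFinD lee_fin.
  move/le_trans; apply.
  apply: le_trans (epsilon_trick _ _ (ltW e2)) _.
    by move=> k; rewrite lee_fin vol_ge0 //; apply: oB.
  apply: le_trans (leeD leB (lexx _)) _.
  by rewrite -addeA -EFinD -splitr.
have finM' : mu (Q `&` ~` A) \is a fin_num by rewrite ge0_fin_numE // lebesgue_outer_ge0.
(* Measurability of [A] splits the measure of the cube, and the finite measure of the complement
   cancels. *)
rewrite -(leeD2rE _ _ finM') -[leLHS]/(mu (Q `&` A) + mu (Q `&` ~` A))%E -mA.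
apply: le_trans H1 _; apply: le_trans (leeD (lexx _) H2) _.
by rewrite addeCA addeC.
Qed.

End InnerCompact.

Lemma abs_window (z : int) (m : nat) : - m%:Z <= z <= m%:Z -> (`|(z + m%:Z)%R| < (2 * m).+1)%N.
Proof. lia. Qed.

Lemma shift_window (z : int) (m : nat) : - m%:Z <= z <= m%:Z -> z = `|(z + m%:Z)%R|%:Z + - m%:Z.
Proof. lia. Qed.

Section Discretize.
Variables (R : realType) (d : nat).
Local Notation V := 'rV[R]_d.+1.
Local Notation mu := (@lebesgue_outer R d.+1).

Lemma outer_seq_subadditive (I : eqType) (s : seq I) (A : I -> set V) :
  (mu [set x | exists2 i, i \in s & A i x] <= \sum_(i <- s) mu (A i))%E.
Proof.
elim: s => [|i s IH].
  by rewrite big_nil (_ : [set x | _] = set0) ?lebesgue_outer0 //; apply/seteqP; split=> [x []|].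
rewrite big_cons; apply: le_trans (leeD (lexx _) IH).
apply: le_trans (outer_measureU2 _ _ _); apply: lebesgue_outer_le => x [j].
by rewrite inE => /orP[/eqP ->|js] jx; [left | right; exists j].
Qed.

Lemma outer_finite_subadditive (I : finType) (P : pred I) (A : I -> set V) :
  (mu [set x | exists2 i, P i & A i x] <= \sum_(i | P i) mu (A i))%E.
Proof.
rewrite -big_filter; apply: le_trans (outer_seq_subadditive _ _).
by apply: lebesgue_outer_le => x [i Pi ix]; exists i => //; rewrite mem_filter Pi mem_index_enum.
Qed.

(** The cells that meet [K] form the model. Distances between cells are within [d.+1 * h] of
    distances in [K], which stay [tau] away from [D]; the last factor is the volume of the padded
    torus. *)
Lemma discretize (K : set V) (D : set R) (C tau Delta r h : R) :
  0 < h -> 0 <= r -> 0 <= C -> 0 <= Delta -> K `<=` closed_cube r -> (C + d.+1%:R) * h < tau ->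
  (forall t, D t -> t <= Delta) ->
  (forall t x y, D t -> K x -> K y -> tau <= `|Defs.edist x y - t|) ->
  exists (G : finZmodType) (p : {additive {ffun 'I_d.+1 -> int} -> G}) (S : {set G}),
    grid_avoiding C h D p S /\
    (mu K <= (density R S * (r + Delta + (C + 3) * h) ^+ d.+1)%:E)%E.
Proof.
move=> h0 r0 C0 Del0 Kr ht Dle gap.
(* The ceilings of the coordinates lie between [- N] and [N], hence [2 * N + 1] cells per side. *)
pose N := (Num.truncn (r / 2 / h)).+1; pose s := (2 * N).+1.
pose l := Num.truncn ((Delta + C * h) / h).
pose base : {ffun 'I_d.+1 -> int} := [ffun=> - N%:Z].
pose P : {set ibox d.+1 s} := finset (fun q => `[< exists2 y, K y & ceilv h y = ivec q + base >]).
have lE : (s + l = (2 * N + l).+1)%N by rewrite addSn.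
have x0 : 0 <= r / 2 / h by rewrite !divr_ge0 // ltW.
have z0 : 0 <= (Delta + C * h) / h by rewrite divr_ge0 ?(ltW h0) // addr_ge0 // mulr_ge0 // ltW.
have N1 : N%:R <= r / 2 / h + 1 by rewrite /N -[in leLHS]natr1 lerD2r truncn_le.
have N2 : r / 2 / h < N%:R by exact: truncnS_gt.
have l1 : l%:R <= (Delta + C * h) / h by rewrite truncn_le.
have l2 : (Delta + C * h) / h < l.+1%:R by exact: truncnS_gt.
have hl : Delta + C * h < h * l.+1%:R by rewrite [ltRHS]mulrC -ltr_pdivrMr.
have Pav a b : a \in P -> b \in P -> forall t, D t -> ~ `|h * enorm R (ivec b - ivec a) - t| <= C * h.
  rewrite !inE => -[y Ky ya] [y' Ky' yb] t Dt le.
  have := gap t y y' Dt Ky Ky'; rewrite leNgt => /negP; apply; apply: le_lt_trans ht.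
  have := cell_edist h0 y y'; rewrite yb ya opprD addrACA subrr addr0 => le'.
  rewrite (_ : Defs.edist y y' - t = (h * enorm R (ivec b - ivec a) - t) -
    (h * enorm R (ivec b - ivec a) - Defs.edist y y')); last by ring.
  by apply: le_trans (ler_normB _ _) _; rewrite mulrDl lerD.
exists _, (torus (2 * N + l)), (wrap_set _ P); split; first exact: grid_avoiding_wrap_set Dle lE hl Pav.
have cover : K `<=` [set x | exists2 q, q \in P & box (cell h (ivec q + base)).1 (cell h (ivec q + base)).2 x].
  move=> y Ky.
  have yN i : - N%:R <= ((ceilv h y i)%:~R : R) <= N%:R.
    have := Kr y Ky i; rewrite in_itv /= ffunE => /andP[y1 y2].
    apply/andP; split.
      apply: (@le_trans _ _ (y ord0 i / h)); last exact: ceil_ge.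
      by rewrite ler_pdivlMr // mulNr lerNl; move: N2; rewrite ltr_pdivrMr //; lra.
    rewrite -[N%:R]/(N%:Z%:~R : R) ler_int ceil_le_int ler_pdivrMr //; apply: le_trans y2 _.
    by rewrite -ler_pdivrMr //; apply: ltW.
  have yZ i : - N%:Z <= ceilv h y i <= N%:Z.
    by have := yN i; rewrite -[N%:R]/(N%:Z%:~R : R) -rmorphN !ler_int.
  have qlt i : (`|(ceilv h y i + N%:Z)%R| < s)%N.
    by apply: abs_window; apply: yZ.
  pose q : ibox d.+1 s := [ffun i => Ordinal (qlt i)].
  have E : ceilv h y = ivec q + base.
    apply/ffunP => i; rewrite [RHS]ffunE [base _]ffunE [ivec q _]ffunE [q _]ffunE /=.
    by apply: shift_window; apply: yZ.
  by exists q; [rewrite inE; apply/asboolP; exists y | case: (cellP h0 (ivec q + base) y) => _; apply].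
apply: le_trans (lebesgue_outer_le cover) _.
apply: le_trans (outer_finite_subadditive _ _) _.
apply: (@le_trans _ _ (\sum_(q in P) (h ^+ d.+1)%:E)%E).
  apply: lee_sum => q _; rewrite -(vol_cell h (ivec q + base)); apply: lebesgue_outer_box_le.
  exact: cell_ordered.
rewrite sumEFin lee_fin sumr_const /density (card_wrap_set P lE) (card_ibox d.+1 (2 * N + l).+1) -[leLHS]mulr_natl.
have n0 : 0 < (2 * N + l).+1%:R :> R by rewrite ltr0n.
rewrite natrX mulrAC ler_pdivlMr ?exprn_gt0 // -mulrA ler_wpM2l // -exprMn.
apply: lerXn2r; rewrite ?nnegrE.
- by rewrite mulr_ge0 // ltW.
- by rewrite !addr_ge0 // mulr_ge0 ?addr_ge0 // ltW.
(* The [2 * N + 1] cells have length at most [r + 3 * h], the padding at most [Delta + C * h]. *)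
rewrite -lE natrD /s -natr1 natrM; move: N1 l1.
rewrite -lerBlDr !ler_pdivlMr // ; lra.
Qed.

End Discretize.

Section MaxDensity.
Variables (R : realType) (d : nat).
Local Notation V := 'rV[R]_d.+1.
Local Notation mu := (@lebesgue_outer R d.+1).

Lemma upper_density_gt (A : set V) (a M : R) : (a%:E < upper_density A)%E ->
  exists r, [/\ M < r, 0 < r & ((a * r ^+ d.+1)%:E < mu (A `&` cube (0 : V) r))%E].
Proof.
rewrite /upper_density limf_esupE => lt.
pose U := [set r : R | Num.max M 0 < r].
have /(lt_le_trans lt) : (ereal_inf [set ereal_sup [set mu (A `&` cube (0 : V) r) / mu (cube (0 : V) r) | r in U] |
    U in pinfty_nbhs R] <= ereal_sup [set mu (A `&` cube (0 : V) r) / mu (cube (0 : V) r) | r in U])%E.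
  by apply: ereal_inf_lbound; exists U => //; exists (Num.max M 0); split; [exact: num_real | move=> x].
move=> /ereal_sup_gt[_ [r + <-]] ar; rewrite /U /= gt_max => /andP[Mr r0]; exists r; split => //.
have rp : 0 < r ^+ d.+1 by rewrite exprn_gt0.
move: ar; rewrite outer_cube // inver gt_eqF // EFinM => ar.
by rewrite -lte_pdivlMr // muleC -[in X in (_ < X)%E]muleC.
Qed.

Lemma finite_set_bound (D : set R) : finite_set D -> exists2 M, 0 <= M & forall t, D t -> t <= M.
Proof.
move=> /finite_seqP[s ->]; exists (\sum_(t <- s) `|t|); first by apply: sumr_ge0.
move=> t /= ts; apply: le_trans (ler_norm _) _.
by rewrite (big_rem t) //= lerDl sumr_ge0.
Qed.

(** Half of the excess [b - a] is given up for the compact subset, the other half for the padding of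
    the torus, whose relative size tends to 0 as the cube grows. *)
Lemma max_density_discrete (D : set R) (C a : R) : finite_set D -> 0 <= C -> 0 <= a ->
  (a%:E < max_density d.+1 D)%E ->
  exists2 h0, 0 < h0 & forall h, 0 < h <= h0 ->
    exists (G : finZmodType) (p : {additive {ffun 'I_d.+1 -> int} -> G}) (S : {set G}),
      grid_avoiding C h D p S /\ a <= density R S.
Proof.
move=> finD C0 a0 /ereal_sup_gt[_ [A [mA avA] <-]] aA.
have [b ab bA] : exists2 b : R, a < b & (b%:E < upper_density A)%E.
  case: (upper_density A) aA => [m||] //.
    rewrite lte_fin => am; exists ((a + m) / 2); rewrite ?lte_fin; lra.
  by move=> _; exists (a + 1); rewrite ?ltry //; lra.
have [Delta Del0 DleD] := finite_set_bound finD.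
pose g := (a + b) / 2.
have ag : 0 < g - a by rewrite /g; lra.
have [r [Mr r0 ltr]] := upper_density_gt (g * d.+1%:R * (Delta + 1) / (g - a)) bA.
have rp : 0 < r ^+ d.+1 by rewrite exprn_gt0.
have e0 : 0 < (b - a) / 2 * r ^+ d.+1 by rewrite mulr_gt0 // divr_gt0 // subr_gt0.
have [K [cK KA Kr muK]] := inner_compact mA (ltW r0) e0.
have avK : avoiding D K by move=> x y /KA xA /KA yA; apply: avA.
have [tau tau0 gap] := avoiding_gap cK finD avK.
pose c := C + 3 + d.+1%:R.
have c0 : 0 < c.
  rewrite /c; have : 0 <= d.+1%:R :> R by [].
  lra.
(* This mesh serves two needs: [(C + d.+1) * h < tau] and [(C + 3) * h <= 1]. *)
pose h0 := Num.min tau 1 / 2 / c.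
have m0 : 0 < Num.min tau 1 by rewrite lt_min tau0 ltr01.
exists h0; first by rewrite !divr_gt0.
move=> h /andP[hp hh0].
have hc : h * c <= Num.min tau 1 / 2 by rewrite -ler_pdivlMr.
have hc1 : h * c < tau.
  apply: le_lt_trans hc _; have : Num.min tau 1 <= tau by rewrite ge_min lexx.
  lra.
have hc2 : h * c <= 1.
  apply: le_trans hc _; have : Num.min tau 1 <= 1 by rewrite ge_min lexx orbT.
  lra.
have hd : 0 <= h * d.+1%:R by rewrite mulr_ge0 // ltW.
have hC : 0 <= h * C by rewrite mulr_ge0 // ltW.
have ht : (C + d.+1%:R) * h < tau by move: hc1; rewrite /c !mulrDr mulrDl mulrC [d.+1%:R * h]mulrC; lra.
have [G [p [S [admS muS]]]] := discretize hp (ltW r0) C0 Del0 Kr ht DleD gap.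
exists G, p, S; split => //.
have dens0 : 0 <= density R S by rewrite /density divr_ge0.
have rD : 0 < r + (Delta + 1) by lra.
have gr : g * r ^+ d.+1 <= density R S * (r + (Delta + 1)) ^+ d.+1.
  rewrite -lee_fin; apply: (@le_trans _ _ (mu K)); last first.
    apply: le_trans muS _; rewrite lee_fin ler_wpM2l // lerXn2r ?nnegrE //.
    - by rewrite !addr_ge0 ?mulr_ge0 ?addr_ge0 // ltW.
    - exact: ltW.
    - by move: hc2; rewrite /c !mulrDr mulrDl [C * h]mulrC; lra.
  have le1 : ((b * r ^+ d.+1)%:E <= mu K + ((b - a) / 2 * r ^+ d.+1)%:E)%E.
    apply: le_trans muK; apply: le_trans (ltW ltr) _; apply: lebesgue_outer_le => y [yA yr].
    split => // i; have := yr i; rewrite in_itv /= mxE subr0 ltr_norml => /andP[y1 y2].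
    by rewrite !ltW.
  rewrite -(leeD2rE _ _ (_ : ((b - a) / 2 * r ^+ d.+1)%:E \is a fin_num)) //.
  apply: le_trans le1; rewrite -EFinD lee_fin -mulrDl ler_wpM2r ?(ltW rp) // /g; lra.
have rDp : 0 < (r + (Delta + 1)) ^+ d.+1 by rewrite exprn_gt0.
rewrite -(ler_pM2r rDp); apply: le_trans gr.
pose x := (Delta + 1) / (r + (Delta + 1)).
have x01 : 0 <= x <= 1 by rewrite divr_ge0 ?(ltW rD) //= ?ler_pdivrMr //; lra.
have E : r ^+ d.+1 = (1 - x) ^+ d.+1 * (r + (Delta + 1)) ^+ d.+1.
  by rewrite -exprMn; congr (_ ^+ _); rewrite /x mulrBl mul1r divfK ?gt_eqF //; lra.
rewrite E mulrA ler_pM2r //.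
have g0 : 0 <= g by rewrite /g; lra.
apply: le_trans (ler_wpM2l g0 (expr1B_ge d.+1 x01)).
have : g * (d.+1%:R * x) <= g - a.
  rewrite /x !mulrA ler_pdivrMr //; move: (ltW Mr); rewrite ler_pdivrMr // => /le_trans; apply.
  by rewrite mulrC ler_wpM2l ?(ltW ag) //; lra.
by rewrite mulrBr mulr1; lra.
Qed.

End MaxDensity.

Section MaxDensityBounds.
Variables (R : realType) (d : nat).
Implicit Types D : set R.
Local Notation V := 'rV[R]_d.+1.
Local Notation mu := (@lebesgue_outer R d.+1).

Lemma max_density_ge0 D : (0 <= max_density d.+1 D)%E.
Proof.
have := @density_le_max R d D 1 _ (torus 0) finset.set0 ltr01; rewrite /density cards0 mul0r; apply.
by move=> w t _ _ z; rewrite inE.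
Qed.

Lemma max_density_le1 D : (max_density d.+1 D <= 1)%E.
Proof.
apply: ge_ereal_sup => _ [A _ <-]; rewrite leNgt; apply/negP => /(upper_density_gt 0)[r [_ r0]].
rewrite mul1r ltNge => /negP; apply; apply: le_trans (outer_cube_le d (ltW r0)).
by apply: lebesgue_outer_le => x [].
Qed.

Definition mdens D : R := fine (max_density d.+1 D).

Lemma mdensE D : max_density d.+1 D = (mdens D)%:E.
Proof.
rewrite /mdens fineK // fin_numE; apply/andP; split; apply/eqP => h.
  by have := max_density_ge0 D; rewrite h.
by have := max_density_le1 D; rewrite h.
Qed.

Lemma mdens01 D : 0 <= mdens D <= 1.
Proof. by rewrite -!lee_fin -mdensE max_density_ge0 max_density_le1. Qed.

Lemma density_le_mdens D (h : R) (G : finZmodType) (p : {additive {ffun 'I_d.+1 -> int} -> G})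
    (S : {set G}) : 0 < h -> grid_avoiding d.+1%:R h D p S -> density R S <= mdens D.
Proof. by move=> h0 /(density_le_max h0); rewrite mdensE lee_fin. Qed.

(** In one cube, large enough for the density bounds of all classes at once, subadditivity compares
    the volume with the sum over the classes. *)
Lemma colors_ge D n : measurably_colorable d.+1 D n -> 1 <= n%:R * mdens D.
Proof.
move=> [c cP]; apply/ler_addgt0Pr => e e0.
have n0 : 0 < n%:R + 1 :> R by have : 0 <= n%:R :> R by []; lra.
pose b := mdens D + e / (n%:R + 1).
have eb : 0 < e / (n%:R + 1) by rewrite divr_gt0.
have /choice[M MP] : forall j, exists M, forall r, M < r -> 0 < r ->
    (mu (c @^-1` [set j] `&` cube (0 : V) r) <= (b * r ^+ d.+1)%:E)%E.
  move=> j; apply: upper_density_lt; apply: (@le_lt_trans _ _ (mdens D)%:E).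
    by rewrite -mdensE; apply: ereal_sup_ubound; exists (c @^-1` [set j]) => //; apply: cP.
  by rewrite lte_fin ltrDl.
pose r := \sum_j `|M j| + 1.
have rM j : M j < r.
  apply: le_lt_trans (ler_norm _) _; rewrite /r (bigD1 j) //= -addrA ltrDl.
  by rewrite ltr_wpDl // sumr_ge0.
have r0 : 0 < r by rewrite ltr_wpDl // sumr_ge0.
have rp : 0 < r ^+ d.+1 by rewrite exprn_gt0.
have : (mu (cube (0 : V) r) <= \sum_(j < n) (b * r ^+ d.+1)%:E)%E.
  apply: (@le_trans _ _ (\sum_(j < n) mu (c @^-1` [set j] `&` cube (0 : V) r))%E).
    apply: le_trans (outer_finite_subadditive _ _).
    by apply: lebesgue_outer_le => x xr; exists (c x).
  by apply: lee_sum => j _; apply: MP.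
rewrite outer_cube // sumEFin lee_fin sumr_const card_ord -[_ *+ n]mulr_natl mulrA.
rewrite -[leLHS]mul1r ler_pM2r // => /le_trans; apply.
rewrite /b mulrDr lerD2l mulrA ler_pdivrMr // mulrDr mulr1 [leLHS]mulrC; lra.
Qed.

Lemma chromatic_ge D (x : R) : 0 <= x -> x * mdens D <= 1 -> (x%:E <= measurable_chromatic d.+1 D)%E.
Proof.
move=> x0 xD; apply: le_ereal_inf_tmp => _ [n /colors_ge nD <-]; rewrite lee_fin.
rewrite -[leLHS]mulr1; apply: le_trans (ler_wpM2l x0 nD) _.
by rewrite mulrCA -[leRHS]mulr1 ler_wpM2l.
Qed.

End MaxDensityBounds.

(** * Operations on finite models *)

Section Product.
Variables (R : realType) (d : nat) (C h : R) (G1 G2 : finZmodType).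
Variables (p1 : {additive {ffun 'I_d -> int} -> G1}) (p2 : {additive {ffun 'I_d -> int} -> G2}).

Definition pairm (w : {ffun 'I_d -> int}) : (G1 * G2)%type := (p1 w, p2 w).

Fact pairm_is_zmod_morphism : zmod_morphism pairm.
Proof. by move=> w w'; rewrite /pairm !raddfB. Qed.

HB.instance Definition _ := GRing.isZmodMorphism.Build _ _ pairm pairm_is_zmod_morphism.

Lemma grid_avoiding_product (D1 D2 : R -> Prop) (S1 : {set G1}) (S2 : {set G2}) :
  grid_avoiding C h D1 p1 S1 -> grid_avoiding C h D2 p2 S2 -> grid_avoiding C h (fun t => D1 t \/ D2 t) pairm (finset.setX S1 S2).
Proof.
move=> a1 a2 w t Dt wt [z1 z2]; rewrite !inE /= => /andP[zS1 zS2].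
by case: Dt => Dt; [rewrite (negbTE (a1 w t Dt wt _ zS1)) | rewrite (negbTE (a2 w t Dt wt _ zS2)) andbF].
Qed.

End Product.

Lemma density_product (R : realType) (G1 G2 : finType) (S1 : {set G1}) (S2 : {set G2}) :
  density R (finset.setX S1 S2) = density R S1 * density R S2.
Proof. by rewrite /density cardsX card_prod !natrM mulf_div. Qed.

Lemma grid_avoiding_scale (R : realType) (d : nat) (C h t : R) (G : finZmodType) (p : {ffun 'I_d -> int} -> G)
    (S : {set G}) : 0 < t -> grid_avoiding C (h / t) [set 1] p S -> grid_avoiding C h [set t] p S.
Proof.
move=> t0 aS w _ -> le; apply: (aS w 1 erefl).
have -> : h / t * enorm R w - 1 = (h * enorm R w - t) / t.
  by rewrite mulrBl divff ?gt_eqF // mulrAC.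
by rewrite normrM normfV (gtr0_norm t0) mulrA ler_pM2r ?invr_gt0.
Qed.

Lemma grid_avoiding_subset (R : realType) (d : nat) (C C' h : R) (D D' : R -> Prop) (G : finZmodType)
    (p : {ffun 'I_d -> int} -> G) (S : {set G}) :
  0 <= h -> C <= C' -> (forall t, D t -> D' t) -> grid_avoiding C' h D' p S -> grid_avoiding C h D p S.
Proof.
by move=> h0 CC DD a w t /DD Dt le; apply: a Dt (le_trans le _); rewrite ler_wpM2r.
Qed.

(** * The two inequalities *)

Section Main.
Variables (R : realType) (d : nat).
Implicit Types D : set R.
Local Notation m D := (@mdens R d D).
Local Notation m1 := (@mdens R d [set 1]).

Lemma distance_sets_finite k D : distance_sets k D -> finite_set D.
Proof. by move=> [_ Dk]; apply/finite_setP; exists k. Qed.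

Lemma distance_sets_rem k D t : distance_sets k.+1 D -> D t -> (D `\ t #= `I_k)%card ->
  distance_sets k (D `\ t).
Proof. by move=> [Dpos _] _ Dk; split=> // u [/Dpos]. Qed.

(** Remove one distance [t]; the product of a model for the rest with a rescaled model for [{1}] is
    a model for [D]. *)
Lemma power_discrete (C a : R) k D : 0 <= C -> 0 <= a < m1 -> distance_sets k D ->
  exists2 h0, 0 < h0 & forall h, 0 < h <= h0 ->
    exists (G : finZmodType) (p : {additive {ffun 'I_d.+1 -> int} -> G}) (S : {set G}),
      grid_avoiding C h D p S /\ a ^+ k <= density R S.
Proof.
move=> C0 /andP[a0 am]; elim: k D => [|k IH] D kD.
  have D0 : D = set0 by case: kD => _; rewrite II0 card_eq0 => /eqP.
  exists 1 => // h _; exists _, (torus 0), [set: _]%SET; split; first by move=> w t; rewrite D0.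
  by rewrite /density cardsT divff ?pnatr_eq0 -?lt0n ?cardG_gt0.
have [Dpos /eq_cardSP[t Dt Dk]] := kD.
have t0 : 0 < t := Dpos t Dt.
have [h0 h0p H0] := IH _ (distance_sets_rem kD Dt Dk).
have [|h1 h1p H1] := @max_density_discrete R d [set 1] C a (finite_set1 1) C0 a0.
  by rewrite mdensE lte_fin.
(* The model for [{1}] is taken at mesh [h / t]. *)
exists (Num.min h0 (t * h1)); first by rewrite lt_min h0p mulr_gt0.
move=> h; rewrite le_min => /and3P[hp hh0 hh1].
have [|G1 [p1 [S1 [a1 le1]]]] := H0 h; first by rewrite hp.
have [|G2 [p2 [S2 [a2 le2]]]] := H1 (h / t); first by rewrite divr_gt0 //= ler_pdivrMr // mulrC.
exists _, (pairm p1 p2), (finset.setX S1 S2); split.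
  have := grid_avoiding_product a1 (grid_avoiding_scale t0 a2); apply: grid_avoiding_subset => // [|u Du]; first exact: ltW.
  by have [ut|/eqP ut] := pselect (u = t); [right | left; split => //; apply/eqP].
by rewrite density_product exprSr ler_pM ?exprn_ge0.
Qed.

(** The densities supplied by [power_discrete] lie below [m1], so take [a = m1 * (1 - x)] and let
    [x] tend to 0. *)
Lemma power_le_mdens k D : (0 < k)%N -> distance_sets k D -> m1 ^+ k <= m D.
Proof.
move=> k0 kD; have /andP[m10 m1le] := mdens01 d [set (1 : R)].
have /andP[mD0 _] := mdens01 d D.
(* No nonnegative [a] lies below [m1 = 0]; in this case [0 < k] gives [0 ^ k = 0]. *)
have [m1z|m1n] := eqVneq m1 0; first by rewrite m1z expr0n gtn_eqF.
have m1p : 0 < m1 by rewrite lt_neqAle eq_sym m1n.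
have low x : 0 < x <= 1 -> (m1 * (1 - x)) ^+ k <= m D.
  move=> /andP[x0 x1].
  have xm : 0 <= m1 * (1 - x) < m1 by rewrite mulr_ge0 ?subr_ge0 //= -[ltRHS]mulr1 ltr_pM2l //; lra.
  have [h0 h0p /(_ h0)[|G [p [S [aS le]]]]] := power_discrete (ler0n R d.+1) xm kD.
    by rewrite h0p lexx.
  by apply: le_trans le _; apply: density_le_mdens h0p aS.
apply/ler_addgt0Pr => e e0.
have kp : 0 < k%:R :> R by rewrite ltr0n.
pose x := Num.min 1 (e / k%:R).
have x01 : 0 < x <= 1 by rewrite lt_min ltr01 divr_gt0 //= ge_min lexx.
have xe : k%:R * x <= e by rewrite mulrC -ler_pdivlMr // ge_min lexx orbT.
have := low x x01; rewrite exprMn.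
have x01' : 0 <= x <= 1 by case/andP: x01 => /ltW -> ->.
have m1k : 0 <= m1 ^+ k by rewrite exprn_ge0.
move=> /(le_trans (ler_wpM2l m1k (expr1B_ge k x01'))).
have : m1 ^+ k * (k%:R * x) <= e.
  rewrite -[leRHS]mul1r; apply: ler_pM => //; first by rewrite mulr_ge0 //; case/andP: x01'.
  by rewrite exprn_ile1.
by rewrite mulrBr mulr1; lra.
Qed.

(** A [t] above all elements of [D] is a new distance. A larger density would give, at a fine mesh
    of the form [t / (P * eta)], a model that [discrete_step] excludes; halving [eps] there makes
    the contradiction strict. *)
Lemma mdens_add_distance (d1 : (0 < d)%N) k D (eps : R) : 0 < eps <= 1 -> distance_sets k D ->
  exists2 t, distance_sets k.+1 (D `|` [set t]) & m (D `|` [set t]) <= m D * m1 + eps.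
Proof.
move=> eps01 kD; have finD := distance_sets_finite kD.
have [Delta Del0 DleD] := finite_set_bound finD.
have [Dpos Dk] := kD.
have e2 : 0 < eps / 2 <= 1 by lra.
have [t0 [C [P [t0p P0 H]]]] := @discrete_step R d.+1 (m D) m1 Delta D d1
  (fun h G p S => @density_le_mdens R d [set 1] h G p S) (fun h G p S => @density_le_mdens R d D h G p S)
  DleD Del0 (mdens01 d D) (mdens01 d [set 1]) _ e2.
pose t := t0 + Delta + 1.
have t0t : t0 <= t by rewrite /t; lra.
have tp : 0 < t by rewrite /t; lra.
have nDt : ~ D t by move=> /DleD; rewrite /t; lra.
have kD' : distance_sets k.+1 (D `|` [set t]).
  split; first by move=> u [/Dpos|->].
  apply/eq_cardSP; exists t; first by right.
  rewrite (_ : (D `|` [set t]) `\ t = D) //.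
  apply/seteqP; split=> u; first by case=> -[Du|ut] nut //; case: nut.
  by move=> Du; split; [left | move=> ut; apply: nDt; rewrite -ut].
exists t => //; rewrite leNgt; apply/negP => lt.
have [eta0 Heta] := H t t0t.
have /andP[mD0 _] := mdens01 d D; have /andP[m10 _] := mdens01 d [set (1 : R)].
have a0 : 0 <= m D * m1 + eps by rewrite addr_ge0 ?mulr_ge0 //; lra.
have [|h0 h0p Hh] := @max_density_discrete R d (D `|` [set t]) `|C| _ (distance_sets_finite kD') (normr_ge0 C) a0.
  by rewrite mdensE lte_fin.
have [n nP] := nat_above (t / h0).
pose eta := (eta0 + n).+1.
have ep : 0 < (P * eta)%:R :> R by rewrite ltr0n muln_gt0 P0.
have hp : 0 < t / (P * eta)%:R by rewrite divr_gt0.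
have [|G [p [S [aS le]]]] := Hh (t / (P * eta)%:R).
  rewrite hp /= ler_pdivrMr // mulrC -ler_pdivrMr //; apply: le_trans nP _; rewrite ler_nat.
  apply: leq_trans (leq_pmull _ P0); rewrite /eta; apply: leq_trans (leqnSn _); exact: leq_addl.
have := Heta eta (leq_trans (leq_addr _ _) (leqnSn _)) (ltn0Sn _) G p S.
have aS' := grid_avoiding_subset (ltW hp) (ler_norm C) (fun u (h : D u \/ u = t) => h) aS.
by move=> /(_ aS'); lra.
Qed.

(** Add one distance at a time; half of [eps] goes to the previous distances and half to the new
    one. *)
Lemma small_mdens (d1 : (0 < d)%N) k (eps : R) : 0 < eps <= 1 ->
  exists2 D, distance_sets k D & m D <= m1 ^+ k + eps.
Proof.
have /andP[m10 m1le] := mdens01 d [set (1 : R)].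
elim: k eps => [|k IH] eps eps01.
  exists set0; first by split => //; rewrite II0.
  by have /andP[_] := mdens01 d (set0 : set R); rewrite expr0; lra.
have e2 : 0 < eps / 2 <= 1 by lra.
have [D kD Dle] := IH _ e2.
have [t kD' D'le] := mdens_add_distance d1 e2 kD.
exists (D `|` [set t]) => //; apply: le_trans D'le _.
have := ler_wpM2r m10 Dle; rewrite exprSr mulrDl.
have : eps / 2 * m1 <= eps / 2 by rewrite -[leRHS]mulr1 ler_wpM2l //; lra.
lra.
Qed.

Lemma chromatic_sup_ge (d1 : (0 < d)%N) k (x : R) : x * m1 ^+ k < 1 ->
  (x%:E <= ereal_sup [set measurable_chromatic d.+1 D | D in distance_sets k])%E.
Proof.
have /andP[m10 m1le] := mdens01 d [set (1 : R)].
have q0 : 0 <= m1 ^+ k by rewrite exprn_ge0.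
move=> xq; pose y := Num.max x 0.
have yq : y * m1 ^+ k < 1 by rewrite /y; case: (leP x 0); rewrite ?mul0r.
have y0 : 0 <= y by rewrite le_max lexx orbT.
have y1 : 0 < y + 1 by lra.
(* This gives [y * (m1 ^ k + eps) <= 1]; the denominator [y + 1] is positive even for [y = 0]. *)
pose eps := Num.min 1 ((1 - y * m1 ^+ k) / (y + 1)).
have eps01 : 0 < eps <= 1 by rewrite lt_min ltr01 divr_gt0 ?subr_gt0 //= ge_min lexx.
have epsy : eps * (y + 1) <= 1 - y * m1 ^+ k by rewrite -ler_pdivlMr // ge_min lexx orbT.
have [D kD Dle] := small_mdens d1 k eps01.
apply: (@le_trans _ _ y%:E); first by rewrite lee_fin le_max lexx.
apply: le_trans (chromatic_ge y0 _) _; last by apply: ereal_sup_ubound; exists D.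
by apply: le_trans (ler_wpM2l y0 Dle) _; move: epsy; rewrite !mulrDr mulr1 [eps * y]mulrC; lra.
Qed.

End Main.

Local Open Scope ereal_scope.

Theorem mainTheorem2 (R : realType) (d k : nat) (hd : (2 <= d)%N)
    (hk : (1 <= k)%N) :
  (forall D : set R, distance_sets k D ->
     max_density d [set 1%R : R] ^+ k <= max_density d D) /\
  (max_density d [set 1%R : R] ^+ k)^-1 <=
    ereal_sup [set measurable_chromatic d D | D in distance_sets k].
Proof.
case: d hd => // d d1; split=> [D kD|].
  by rewrite !mdensE -EFin_expe lee_fin power_le_mdens.
rewrite mdensE -EFin_expe inver; have /andP[m10 _] := mdens01 d [set (1%R : R)].
case: eqP => [q0|/eqP q0].
  (* The inverse of 0 is [+oo], so the supremum has to exceed every real number. *)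
  rewrite leye_eq; apply/eqP/eqyP => A _; apply: chromatic_sup_ge => //.
  by rewrite q0 mulr0.
have qp : (0 < mdens d [set (1%R : R)] ^+ k)%R by rewrite lt_neqAle eq_sym q0 exprn_ge0.
(* The strict inequality in [chromatic_sup_ge] forces an approach to the inverse from below. *)
apply/lee_subgt0Pr => e e0; apply: chromatic_sup_ge => //.
by rewrite mulrBl mulVf // ltrBlDr ltrDl mulr_gt0.
Qed.
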